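(* Let $\mathbb{X}$ be a set of $5$ distinct points in $\mathbb{P}^2_k$. The Jacobian ideal of $I(\mathbb{X})$ is $\mathcal{VV}$-torsion free if and only if $\mathbb{X}$ is in one of the following configurations: (1) $\mathbb{X}$ is in general linear position; (4) $\mathbb{X}$ is a $3$-fold collinear configuration; (5) $\mathbb{X}$ is a $3$-fold collinear configuration such that the straight line through the remaining two points meets the line containing the three collinear points in a point of $\mathbb{X}$.
   Context: $k$ is an algebraically closed field of characteristic zero and $R=k[x,y,z]$ is the homogeneous coordinate ring of $\mathbb{P}^2_k$. A finite set of at least $3$ distinct points in $\mathbb{P}^2_k$ is in general linear position if no three of them lie on a line. Given integers $s\geq 4$ and $0\leq r\leq s-3$, an $(s-r)$-fold collinear configuration is a set of $s$ distinct points of $\mathbb{P}^2_k$ such that exactly $s-r$ of them lie on a straight line (i.e. there is a line containing exactly $s-r$ of the points). Thus here ($s=5$) a $3$-fold collinear configuration is a set of $5$ points for which some line contains exactly three of them. For a finite set $\mathbb{X}$ of distinct points, $J=I(\mathbb{X})\subset R$ is its (radical) homogeneous defining ideal. Let $\Theta$ be the Jacobian matrix of a set of homogeneous generators of $J$, and $I_2(\Theta)\subset R$ the ideal generated by its $2\times 2$ minors. Put $I=(J,I_2(\Theta))\subset R$; the Jacobian ideal of $I(\mathbb{X})$ is $I$ (equivalently its image $I/J$ in $R/J$); it does not depend on the choice of generators. The Jacobian ideal is called $\mathcal{VV}$-torsion free if the Valabrega--Valla module $\bigoplus_{t\ge 2}\frac{J\cap I^t}{J I^{t-1}}$ is zero,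 i.e. if $J\cap I^t=JI^{t-1}$ for all $t\geq 2$. *)

(* Defs.v *)
From mathcomp Require Import all_boot all_order all_algebra.
From mathcomp Require Import finmap.
From mathcomp.multinomials Require Import mpoly.

Set Implicit Arguments.
Unset Strict Implicit.
Unset Printing Implicit Defensive.

Import GRing.Theory.
Local Open Scope fset_scope.
Local Open Scope ring_scope.

(* Ideals are Prop-valued subsets of the ring, compared extensionally. *)
Section Ideals.
Variable A : comNzRingType.
Implicit Types (I J S : A -> Prop).

Definition ideal_span S : A -> Prop := fun f =>
  exists (n : nat) (c g : 'I_n -> A),
    (forall i, S (g i)) /\ f = \sum_(i < n) c i * g i.

Definition ideal_add I J : A -> Prop := ideal_span (fun f => I f \/ J f).

Definition ideal_mul I J : A -> Prop :=
  ideal_span (fun f => exists a b, [/\ I a, J b & f = a * b]).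

Fixpoint ideal_pow I (t : nat) : A -> Prop :=
  if t is t'.+1 then ideal_mul I (ideal_pow I t') else fun=> True.

Definition VV_torsion_free J I : Prop :=
  forall t : nat, (2 <= t)%N -> forall f : A,
    (J f /\ ideal_pow I t f) <-> ideal_mul J (ideal_pow I t.-1) f.

(* A minor comes from strictly increasing choices of rows and columns. *)
Definition minors_ideal (t m n : nat) (M : 'M[A]_(m, n)) : A -> Prop :=
  ideal_span (fun f => exists (r : 'I_t -> 'I_m) (c : 'I_t -> 'I_n),
    [/\ {homo r : i j / (i < j)%N}, {homo c : i j / (i < j)%N}
      & f = \det (mxsub r c M)]).

End Ideals.

Section JacobianIdeal.
Variables (k : fieldType) (n : nat).

Definition jacobian (m : nat) (g : 'I_m -> {mpoly k[n]}) :
    'M[{mpoly k[n]}]_(m, n) :=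
  \matrix_(i < m, j < n) mderiv j (g i).

Definition homogeneous_generators (J : {mpoly k[n]} -> Prop)
    (m : nat) (g : 'I_m -> {mpoly k[n]}) : Prop :=
  (forall i, exists d : nat, g i \is d.-homog) /\
  (forall f, J f <-> ideal_span (fun h => exists i, h = g i) f).

(* (J, I_2(Theta)), where Theta is the Jacobian matrix of the generators g
   of J. *)
Definition jacobian_ideal (J : {mpoly k[n]} -> Prop)
    (m : nat) (g : 'I_m -> {mpoly k[n]}) : {mpoly k[n]} -> Prop :=
  ideal_add J (minors_ideal 2 (jacobian g)).

End JacobianIdeal.

Section ProjectivePlane.
Variable k : fieldType.

(* Points and lines of P^2 are the subspaces of k^3 of dimension 1 and 2. *)
Definition P2 := {V : {vspace 'rV[k]_3} | \dim V == 1%N}.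
Definition line := {V : {vspace 'rV[k]_3} | \dim V == 2%N}.

Definition vanishes_at (f : {mpoly k[3]}) (P : P2) : Prop :=
  forall v : 'rV[k]_3, v \in val P -> v != 0 -> f.@[fun i => v 0 i] = 0.

Definition vanishing_ideal (X : {fset P2}) : {mpoly k[3]} -> Prop :=
  ideal_span (fun f => (exists d : nat, f \is d.-homog) /\
                       (forall P, P \in X -> vanishes_at f P)).

Definition points_on (X : {fset P2}) (L : line) : {fset P2} :=
  [fset P in X | (val P <= val L)%VS].

Definition general_linear_position (X : {fset P2}) : Prop :=
  (3 <= #|` X|)%N /\ forall L : line, ~ (3 <= #|` points_on X L|)%N.

(* The (s - r)-fold collinear configurations. *)
Definition collinear_configuration (s r : nat) (X : {fset P2}) : Prop :=
  [/\ (4 <= s)%N, (r <= s - 3)%N, #|` X| = s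
    & exists L : line, #|` points_on X L| = (s - r)%N].

(* The sum of the two subspaces val Q and val Q' is the line through Q, Q'. *)
Definition three_fold_meeting_in_point (X : {fset P2}) : Prop :=
  collinear_configuration 5 2 X /\
  exists (L : line) (Q Q' P : P2),
    [/\ #|` points_on X L| = 3%N, Q != Q',
        X `\` points_on X L = [fset Q; Q'], P \in X
      & (val L :&: (val Q + val Q'))%VS = val P].

End ProjectivePlane.

(* Main.v *)
Require Import Defs.
From HB Require Import structures.
From mathcomp Require Import all_boot all_order all_algebra.
From mathcomp Require Import finmap.
From mathcomp Require Import ring zify.
From mathcomp.multinomials Require Import mpoly.

(** Let J be the ideal of the five points, I its Jacobian ideal and m the
    irrelevant ideal. The inclusion of J I^(t-1) in J and in I^t is clear, so
    torsion freeness means that an element of J in I^t lies in J I^(t-1).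
    Both ideals have a description without choices: J consists of the
    polynomials that vanish along the lines of k^3 given by the points
    ([vanishing_idealP]), and I is generated by J and all the brackets
    D_u f D_w g - D_w f D_u g of elements f, g of J ([jacobian_idealP]). Hence
    the points may be rescaled, and a change of coordinates is replaced by
    the linear forms x, y, z dual to a convenient basis. Five points of the
    plane are in general linear position, or some line contains exactly three
    of them, or some line contains at least four.

    If d >= 4 points lie on the line z = 0, the condition fails already for
    t = 2 ([four_collinear_not_VV]). Let F of degree d cut out these points on
    the line, with partial derivatives P and Q along it. Modulo z, the ideal I
    is contained in (P, Q), and it contains x P, y P, x Q, y Q. If h generates
    the socle of k[x, y] / (P, Q), then F h lies in J and in I^2, because
    d F = x P + y Q while x h and y h are combinations of P and Q; but F h in
    J I would put h in (P, Q).

    In the other cases the powers of I are small modulo J: they are generated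
    by a few explicit forms, and a power of m lies in I.

    If exactly three points lie on a line, the line through the other two meets
    it either in one of the three ([meeting_in_point_VV]) or outside the
    configuration ([two_lines_VV]). With the two lines as x = 0 and y = 0, the
    product x y lies in J, so only pure products of generators of I survive
    modulo J I^(t-1), and further relations leave five generators of I^t.
    Evaluation at the points restricts the coefficients of a combination of
    these that lies in J so much that it must be in J I^(t-1).

    In general linear position ([general_position_VV]) J is generated by the
    conic q through the points and by three products of three lines with a
    double point at one of the five points. Here I = (q) + N with N of order 3,
    so only J intersected with N^t matters, which has order 3 t. The cubics in
    N are almost all cubics: brackets show that their values separate the
    points up to one linear condition. So m^4 = m N, and the single missing
    cubic is dealt with by regrouping its product with a cubic of J, modulo a
    conic of J, into another product of two cubics of J. *)

Set Implicit Arguments.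
Unset Strict Implicit.
Unset Printing Implicit Defensive.

Import GRing.Theory.
Local Open Scope fset_scope.
Local Open Scope ring_scope.

(** * Ideals as predicates *)

Section IdealCalculus.
Variable A : comNzRingType.
Implicit Types (I J K N S : A -> Prop) (s : seq A).

Definition is_ideal K :=
  [/\ K 0, forall a b, K a -> K b -> K (a + b) & forall r a, K a -> K (r * a)].

Lemma ideal0 K : is_ideal K -> K 0. Proof. by case. Qed.
Lemma idealD K a b : is_ideal K -> K a -> K b -> K (a + b).
Proof. by case=> _ + _; apply. Qed.
Lemma idealMl K r a : is_ideal K -> K a -> K (r * a).
Proof. by case=> _ _; apply. Qed.
Lemma idealMr K r a : is_ideal K -> K a -> K (a * r).
Proof. by rewrite mulrC; apply: idealMl. Qed.
Lemma idealN K a : is_ideal K -> K a -> K (- a).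
Proof. by rewrite -mulN1r; apply: idealMl. Qed.
Lemma idealB K a b : is_ideal K -> K a -> K b -> K (a - b).
Proof. by move=> iK Ka Kb; apply: idealD => //; apply: idealN. Qed.
Lemma ideal_sum K (T : Type) (r : seq T) (P : pred T) (F : T -> A) :
  is_ideal K -> (forall i, P i -> K (F i)) -> K (\sum_(i <- r | P i) F i).
Proof. by move=> iK KF; elim/big_ind: _ => //; [apply: ideal0|move=> *; apply: idealD]. Qed.

Lemma colon_ideall K b : is_ideal K -> is_ideal (fun a => K (a * b)).
Proof.
move=> iK; split=> [|a c ? ?|r a ?]; rewrite ?mul0r ?mulrDl -?mulrA;
  [exact: ideal0|exact: idealD|exact: idealMl].
Qed.

Lemma colon_idealr K a : is_ideal K -> is_ideal (fun b => K (a * b)).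
Proof.
move=> iK; split=> [|b c ? ?|r b ?]; rewrite ?mulr0 ?mulrDr ?[a * (r * _)]mulrCA;
  [exact: ideal0|exact: idealD|exact: idealMl].
Qed.

Lemma span_ideal S : is_ideal (ideal_span S).
Proof.
split=> [|f g|r f].
- by exists 0%N, (fun _ => 0), (fun _ => 0); split=> [[]//|]; rewrite big_ord0.
- move=> [n1 [c1 [g1 [S1 ->]]]] [n2 [c2 [g2 [S2 ->]]]].
  exists (n1 + n2)%N, (fun i => match split i with inl j => c1 j | inr j => c2 j end),
    (fun i => match split i with inl j => g1 j | inr j => g2 j end); split.
    by move=> i; case: (split i).
  rewrite big_split_ord /=; congr (_ + _); apply: eq_bigr => i _.
    by have -> : split (lshift n2 i) = inl i by exact: (unsplitK (inl i)).
  by have -> : split (rshift n1 i) = inr i by exact: (unsplitK (inr i)).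
- move=> [n [c [g [Sg ->]]]]; exists n, (fun i => r * c i), g; split=> //.
  by rewrite mulr_sumr; apply: eq_bigr => i _; rewrite mulrA.
Qed.

Lemma span_mem S a : S a -> ideal_span S a.
Proof.
by move=> Sa; exists 1%N, (fun _ => 1), (fun _ => a); rewrite big_ord1 mul1r.
Qed.

Lemma span_min S K : is_ideal K -> (forall a, S a -> K a) ->
  forall a, ideal_span S a -> K a.
Proof.
move=> iK SK a [n [c [g [Sg ->]]]].
by apply: ideal_sum => // i _; apply: idealMl => //; apply: SK.
Qed.

Lemma mul_ideal I J : is_ideal (ideal_mul I J). Proof. exact: span_ideal. Qed.
Lemma mul_mem I J a b : I a -> J b -> ideal_mul I J (a * b).
Proof. by move=> Ia Jb; apply: span_mem; exists a, b. Qed.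
Lemma mul_min I J K : is_ideal K -> (forall a b, I a -> J b -> K (a * b)) ->
  forall f, ideal_mul I J f -> K f.
Proof. by move=> iK H; apply: span_min => // _ [a [b [Ia Jb ->]]]; apply: H. Qed.

Lemma add_ideal I J : is_ideal (ideal_add I J). Proof. exact: span_ideal. Qed.
Lemma add_min I J K : is_ideal K -> (forall a, I a -> K a) ->
  (forall a, J a -> K a) -> forall f, ideal_add I J f -> K f.
Proof. by move=> iK HI HJ; apply: span_min => // a [/HI|/HJ]. Qed.

Lemma pow_ideal I t : is_ideal (ideal_pow I t).
Proof. by case: t => [|t]; [split|exact: span_ideal]. Qed.

Lemma pow1_mem I a : I a -> ideal_pow I 1 a.
Proof. by move=> Ia; rewrite -[a]mulr1; apply: mul_mem. Qed.

Lemma pow1_min I a : is_ideal I -> ideal_pow I 1 a -> I a.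
Proof. by move=> iI; apply: mul_min => // b c Ib _; apply: idealMr. Qed.

Lemma powS_mem I t a b : I a -> ideal_pow I t b -> ideal_pow I t.+1 (a * b).
Proof. exact: mul_mem. Qed.

Lemma powD_mem I i j a b :
  ideal_pow I i a -> ideal_pow I j b -> ideal_pow I (i + j) (a * b).
Proof.
elim: i a => [|i IH] a; first by move=> _; apply: idealMl; apply: pow_ideal.
move=> Ha Hb; move: a Ha.
apply: mul_min => [|a c Ia Hc]; first by apply: colon_ideall; exact: pow_ideal.
by rewrite addSn -mulrA; apply: powS_mem => //; apply: IH.
Qed.

(** I^(i+j) is generated by products of elements of I^i and I^j: the factors of
    the first are moved to the second one at a time. *)
Lemma powD_min I K i j : is_ideal K ->
  (forall a b, ideal_pow I i a -> ideal_pow I j b -> K (a * b)) ->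
  forall f, ideal_pow I (i + j) f -> K f.
Proof.
elim: i K => [|i IH] K iK H f.
  by rewrite add0n => Hf; rewrite -[f]mul1r; apply: H.
rewrite addSn; apply: mul_min => // a b Ia.
apply: (IH (fun b => K (a * b))) => [|c d Hc Hd]; first exact: colon_idealr.
by rewrite mulrA; apply: H => //; apply: powS_mem.
Qed.

Lemma pow_exp I t a : I a -> ideal_pow I t (a ^+ t).
Proof. by move=> Ia; elim: t => [//|t IH]; rewrite exprS; apply: powS_mem. Qed.

Lemma pow_anti I i j a : (j <= i)%N -> is_ideal I -> ideal_pow I i a -> ideal_pow I j a.
Proof.
move=> le_ji iI; rewrite -(subnKC le_ji); apply: powD_min; first exact: pow_ideal.
by move=> b c Hb _; apply: idealMr => //; apply: pow_ideal.
Qed.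

Lemma pow_sub I J t a : (forall b, I b -> J b) -> ideal_pow I t a -> ideal_pow J t a.
Proof.
move=> IJ; elim: t a => [//|t IH]; apply: mul_min; first exact: pow_ideal.
by move=> b c /IJ Jb /IH Hc; apply: powS_mem.
Qed.

Lemma mul_sub I J I' J' a : (forall b, I b -> I' b) -> (forall b, J b -> J' b) ->
  ideal_mul I J a -> ideal_mul I' J' a.
Proof.
move=> II JJ; apply: mul_min; first exact: mul_ideal.
by move=> b c /II ? /JJ ?; apply: mul_mem.
Qed.

(** Multiplication by [I] maps the error term of step [t] of an induction on
    powers into the error term of step [t.+1]. *)
Lemma mul_powS_mem I J t a b : I a -> ideal_mul J (ideal_pow I t) b ->
  ideal_mul J (ideal_pow I t.+1) (a * b).
Proof.
move=> Ia; move: b; apply: mul_min => [|b c Jb Ic].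
  by apply: colon_idealr; exact: mul_ideal.
by rewrite mulrCA; apply: mul_mem => //; apply: powS_mem.
Qed.

(** Recursion on the list of generators makes membership unfold to an explicit
    combination. *)
Fixpoint gen s : A -> Prop :=
  if s is g :: s' then fun f => exists r f', gen s' f' /\ f = r * g + f'
  else fun f => f = 0.

Lemma gen_ideal s : is_ideal (gen s).
Proof.
elim: s => [|g s IH] /=.
  by split=> [//|a b -> ->|r a ->]; rewrite ?addr0 ?mulr0.
split=> [|_ _ [r [f [Hf ->]]] [r' [f' [Hf' ->]]]|c _ [r [f [Hf ->]]]].
- by exists 0, 0; rewrite mul0r addr0; split=> //; apply: ideal0.
- by exists (r + r'), (f + f'); split; [apply: idealD|rewrite mulrDl addrACA].
- by exists (c * r), (c * f); split; [apply: idealMl|rewrite mulrDr mulrA].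
Qed.

Lemma gen_mem s g : g \in s -> gen s g.
Proof.
elim: s => [//|h s IH]; rewrite in_cons => /orP[/eqP->|/IH Hg] /=.
  by exists 1, 0; rewrite mul1r addr0; split=> //; apply: ideal0; apply: gen_ideal.
by exists 0, g; rewrite mul0r add0r.
Qed.

Lemma gen_min s K : is_ideal K -> (forall g, g \in s -> K g) ->
  forall f, gen s f -> K f.
Proof.
move=> iK; elim: s => [_ f /= ->|g s IH H f /= [r [f' [Hf' ->]]]]; first exact: ideal0.
apply: idealD => //.
  by apply: idealMl => //; apply: H; rewrite mem_head.
by apply: IH => // h hs; apply: H; rewrite in_cons hs orbT.
Qed.

(** The sum of two ideals, with a single summand from each. *)
Definition isum I J : A -> Prop := fun f => exists a b, [/\ I a, J b & f = a + b].

Lemma isum_ideal I J : is_ideal I -> is_ideal J -> is_ideal (isum I J).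
Proof.
move=> iI iJ; split=> [|_ _ [a [b [Ia Jb ->]]] [c [d [Ic Jd ->]]]|r _ [a [b [Ia Jb ->]]]].
- by exists 0, 0; rewrite addr0; split=> //; apply: ideal0.
- by exists (a + c), (b + d); rewrite addrACA; split=> //; apply: idealD.
- by exists (r * a), (r * b); rewrite mulrDr; split=> //; apply: idealMl.
Qed.

Lemma isuml I J a : is_ideal J -> I a -> isum I J a.
Proof. by move=> iJ Ia; exists a, 0; rewrite addr0; split=> //; apply: ideal0. Qed.
Lemma isumr I J a : is_ideal I -> J a -> isum I J a.
Proof. by move=> iI Ja; exists 0, a; rewrite add0r; split=> //; apply: ideal0. Qed.

Lemma capI_ideal I J : is_ideal I -> is_ideal J -> is_ideal (fun f => I f /\ J f).
Proof.
move=> iI iJ; split=> [|a b [? ?] [? ?]|r a [? ?]]; split;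
  by [apply: ideal0|apply: idealD|apply: idealMl].
Qed.

(** Only one inclusion of the Valabrega-Valla condition has content. *)
Lemma VV_intro J I : is_ideal J -> (forall a, J a -> I a) ->
  (forall t f, (2 <= t)%N -> J f -> ideal_pow I t f ->
     ideal_mul J (ideal_pow I t.-1) f) ->
  VV_torsion_free J I.
Proof.
move=> iJ JI H t t2 f; split=> [[Jf If]|]; first exact: H.
move=> Hf; split.
  by move: f Hf; apply: mul_min => // a b Ja _; apply: idealMr.
move: t t2 Hf => [//|t] _ /=; apply: mul_sub => // a; exact: JI.
Qed.

End IdealCalculus.

(** Collecting the cofactors of [x] and of [y] in a product with [K]. *)
Lemma gen_pair (A : comNzRingType) (x y : A) K f : is_ideal K ->
  ideal_mul (gen [:: x; y]) K f -> exists a b, [/\ K a, K b & f = x * a + y * b].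
Proof.
move=> iK; move: f; apply: mul_min.
  split=> [|_ _ [a [b [Ka Kb ->]]] [c [d [Kc Kd ->]]]|r _ [a [b [Ka Kb ->]]]].
  - by exists 0, 0; rewrite !mulr0 addr0; split=> //; apply: ideal0.
  - exists (a + c), (b + d); split; [exact: idealD|exact: idealD|ring].
  - exists (r * a), (r * b); split; [exact: idealMl|exact: idealMl|ring].
move=> _ b [r [_ [[r' [_ [-> ->]]] ->]]] Kb.
exists (r * b), (r' * b); split; [exact: idealMl|exact: idealMl|ring].
Qed.

(** * Rays, grading and directional derivatives *)

(** [grade f] is the sum of f_d s^d over the homogeneous components f_d; being
    a ring morphism, it gives access to these components without any
    bookkeeping on monomials. This definition and the next two are locked to
    keep conversion from computing with polynomials. *)
HB.lock Definition grade (k : fieldType) (n : nat) (f : {mpoly k[n]}) :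
    {poly {mpoly k[n]}} :=
  mmap (polyC \o @mpolyC n k) (fun i => ('X_i)%:P * 'X) f.

(** The polynomial f(s v) in one variable s. That it is zero says that f and
    all its homogeneous components vanish at the projective point [v]. *)
HB.lock Definition ray (k : fieldType) (n : nat) (v : 'rV[k]_n)
    (f : {mpoly k[n]}) : {poly k} :=
  map_poly (meval (v 0)) (grade f).

(** Homogeneity of degree [d], read off from [grade]. *)
HB.lock Definition form (k : fieldType) (n d : nat) (g : {mpoly k[n]}) : Prop :=
  grade g = g%:P * 'X^d.

Section Polynomials.
Variables (k : fieldType) (n : nat).
Local Notation R := {mpoly k[n]}.
Implicit Types (f g : R) (u v w : 'rV[k]_n) (K : R -> Prop).

Lemma mpoly_ring_ind (P : R -> Prop) :
  (forall c, P c%:MP) -> (forall i, P 'X_i) ->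
  (forall f g, P f -> P g -> P (f + g)) ->
  (forall f g, P f -> P g -> P (f * g)) -> forall f, P f.
Proof.
move=> PC PX PD PM; elim/mpolyind => [|c m f _ _ Pf]; first by rewrite -mpolyC0.
apply: (PD) => //; rewrite -mul_mpolyC; apply: (PM) => //.
rewrite mpolyXE_id; elim/big_ind: _ => //; first by rewrite -mpolyC1.
by move=> i _; elim: (m i) => [|e IH]; [rewrite expr0 -mpolyC1|rewrite exprS; apply: PM].
Qed.

Lemma gradeD : {morph (fun f : R => grade f) : f g / f + g}.
Proof. by move=> f g; rewrite grade.unlock rmorphD. Qed.
Lemma gradeM : {morph (fun f : R => grade f) : f g / f * g}.
Proof. by move=> f g; rewrite grade.unlock rmorphM. Qed.
Lemma grade0 : grade (0 : R) = 0.
Proof. by rewrite grade.unlock rmorph0. Qed.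
Lemma gradeC (c : k) : grade (c%:MP : R) = c%:MP%:P.
Proof. by rewrite grade.unlock mmapC. Qed.
Lemma gradeX i : grade ('X_i : R) = ('X_i)%:P * 'X.
Proof. by rewrite grade.unlock mmapX mmap1U. Qed.

Lemma rayE v f : ray v f = map_poly (meval (v 0)) (grade f).
Proof. by rewrite ray.unlock. Qed.
Lemma rayD v : {morph ray v : f g / f + g}.
Proof. by move=> f g; rewrite !rayE gradeD rmorphD. Qed.
Lemma rayM v : {morph ray v : f g / f * g}.
Proof. by move=> f g; rewrite !rayE gradeM rmorphM. Qed.
Lemma ray0 v : ray v (0 : R) = 0.
Proof. by rewrite rayE grade0 rmorph0. Qed.
Lemma rayC v c : ray v (c%:MP : R) = c%:P.
Proof. by rewrite rayE gradeC map_polyC /= mevalC. Qed.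
Lemma rayX v i : ray v ('X_i : R) = v 0 i *: 'X.
Proof. by rewrite rayE gradeX rmorphM /= map_polyC map_polyX /= mevalXU mul_polyC. Qed.
Lemma rayN v : {morph ray v : f / - f}.
Proof.
by move=> f; rewrite -mulN1r -mpolyC1 -mpolyCN rayM rayC polyCN mulN1r.
Qed.
Lemma rayB v : {morph ray v : f g / f - g}.
Proof. by move=> f g; rewrite rayD rayN. Qed.
Lemma ray1 v : ray v (1 : R) = 1.
Proof. by rewrite -mpolyC1 rayC. Qed.
Lemma rayXn v e : {morph ray v : f / f ^+ e}.
Proof. by move=> f; elim: e => [|e IH]; rewrite ?ray1 // !exprS rayM IH. Qed.

Lemma ray_ideal v : is_ideal (fun f => ray v f = 0).
Proof.
split=> [|f g Hf Hg|r f Hf]; first by rewrite ray0.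
  by rewrite rayD /= Hf Hg addr0.
by rewrite rayM /= Hf mulr0.
Qed.

Lemma ray_scale v c f : ray v f = 0 -> ray (c *: v) f = 0.
Proof.
suff -> : ray (c *: v) f = ray v f \Po (c *: 'X) by move=> ->; rewrite comp_poly0.
elim/mpoly_ring_ind: f => [a|i|f g Hf Hg|f g Hf Hg].
- by rewrite !rayC comp_polyC.
- by rewrite !rayX comp_polyZ comp_polyX mxE scalerA mulrC.
- by rewrite !rayD comp_polyD Hf Hg.
- by rewrite !rayM comp_polyM Hf Hg.
Qed.

Lemma coef_ray v f e : (ray v f)`_e = ((grade f)`_e).@[v 0].
Proof. by rewrite rayE coef_map. Qed.

(** A polynomial vanishing on the line spanned by [v] lies in every ideal
    modulo which all the variables become multiples [v_i * u] of one element: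
    modulo such an ideal, f(x) = f(v u), and this is 0. *)
Lemma ray_vanish_mem v (a : R) K f : is_ideal K ->
  (forall i, K ('X_i - (v 0 i)%:MP * a)) -> ray v f = 0 -> K f.
Proof.
move=> iK KX.
suff H : K (f - (map_poly (@mpolyC n k) (ray v f)).[a]).
  by move=> f0; move: H; rewrite f0 rmorph0 horner0 subr0.
elim/mpoly_ring_ind: f => [c|i|f g Hf Hg|f g Hf Hg].
- by rewrite rayC map_polyC hornerC subrr; apply: ideal0.
- by rewrite rayX map_polyZ map_polyX hornerZ hornerX; apply: KX.
- by rewrite rayD rmorphD hornerD opprD addrACA; apply: idealD.
- rewrite rayM rmorphM hornerM.
  set f' := (map_poly _ (ray v f)).[a] in Hf *; set g' := (map_poly _ _).[a] in Hg *.
  have -> : f * g - f' * g' = g * (f - f') + f' * (g - g') by ring.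
  by apply: idealD => //; apply: idealMl.
Qed.

(** The irrelevant ideal, as the ideal of the origin of k^n. *)
Definition irr f : Prop := f.@[(0 : 'rV[k]_n) 0] = 0.

Lemma irr_ideal : is_ideal irr.
Proof.
split=> [|f g Hf Hg|r f Hf]; rewrite /irr; first by rewrite meval0.
  by rewrite mevalD Hf Hg addr0.
by rewrite mevalM Hf mulr0.
Qed.

Lemma irrX i : irr 'X_i. Proof. by rewrite /irr mevalXU mxE. Qed.

Lemma irr_decomp f : irr (f - (f.@[(0 : 'rV[k]_n) 0])%:MP).
Proof. by rewrite /irr mevalB mevalC subrr. Qed.

Lemma irr_min K : is_ideal K -> (forall i, K 'X_i) -> forall f, irr f -> K f.
Proof.
move=> iK KX f f0.
have H : K (f - (f.@[(0 : 'rV[k]_n) 0])%:MP).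
  elim/mpoly_ring_ind: f {f0} => [c|i|f g Hf Hg|f g Hf Hg].
  - by rewrite mevalC subrr; apply: ideal0.
  - by rewrite mevalXU mxE mpolyC0 subr0.
  - by rewrite mevalD mpolyCD opprD addrACA; apply: idealD.
  - rewrite mevalM mpolyCM.
    set a := (f.@[_])%:MP in Hf *; set b := (g.@[_])%:MP in Hg *.
    have -> : f * g - a * b = g * (f - a) + a * (g - b) by ring.
    by apply: idealD => //; apply: idealMl.
by move: H; rewrite f0 mpolyC0 subr0.
Qed.

Lemma formP d g : form d g <-> grade g = g%:P * 'X^d.
Proof. by rewrite form.unlock. Qed.

Lemma formD d f g : form d f -> form d g -> form d (f + g).
Proof. by rewrite !formP gradeD polyCD mulrDl => -> ->. Qed.
Lemma formM d e f g : form d f -> form e g -> form (d + e) (f * g).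
Proof. by rewrite !formP gradeM polyCM exprD => -> ->; rewrite mulrACA. Qed.
Lemma formC (c : k) : form 0 (c%:MP : R).
Proof. by rewrite formP gradeC expr0 mulr1. Qed.
Lemma formX i : form 1 ('X_i : R). Proof. by rewrite formP gradeX. Qed.
Lemma formCM d c f : form d f -> form d (c%:MP * f).
Proof. by move=> Hf; rewrite -[d]add0n; apply: formM; [exact: formC|exact: Hf]. Qed.
Lemma form0 d : form d (0 : R).
Proof. by rewrite formP grade0 polyC0 mul0r. Qed.
Lemma formB d f g : form d f -> form d g -> form d (f - g).
Proof.
move=> Hf Hg; have -> : - g = (-1)%:MP * g by rewrite mpolyCN mpolyC1 mulN1r.
by apply: formD; [exact: Hf|apply: formCM; exact: Hg].
Qed.
Lemma form_sum d (T : Type) (r : seq T) (P : pred T) (F : T -> R) :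
  (forall i, P i -> form d (F i)) -> form d (\sum_(i <- r | P i) F i).
Proof. by move=> H; elim/big_ind: _ => //; [apply: form0|move=> *; apply: formD]. Qed.

Lemma ray_form d v g : form d g -> ray v g = g.@[v 0] *: 'X^d.
Proof. by move=> /formP Hg; rewrite rayE Hg rmorphM /= map_polyC map_polyXn /= mul_polyC. Qed.

Lemma ray_form_eq0 d v g : form d g -> g.@[v 0] = 0 -> ray v g = 0.
Proof. by move=> /(ray_form v) -> ->; rewrite scale0r. Qed.

Lemma dhomog_form d g : g \is d.-homog -> form d g.
Proof.
move=> /dhomogP Hg; rewrite [g]mpolyE big_seq.
apply: form_sum => m /Hg Hd; rewrite -mul_mpolyC; apply: formCM.
have {Hd}-> : d = \sum_i m i by rewrite -mdegE.
rewrite mpolyXE_id; elim/big_ind2: _ => //; first exact: formC.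
  by move=> *; apply: formM.
move=> i _; elim: (m i) => [|e IH]; first exact: formC.
by rewrite exprS -add1n; apply: formM => //; apply: formX.
Qed.

Lemma grade_dhomog f e : (grade f)`_e \is e.-homog.
Proof.
elim/mpoly_ring_ind: f e => [c|i|f g Hf Hg|f g Hf Hg] e.
- rewrite gradeC coefC; case: e => [|e] /=; last exact: dhomog0.
  by rewrite -[c%:MP]mulr1 mul_mpolyC; apply: dhomogZ; apply: dhomog1.
- rewrite gradeX coefMX coefC; case: e => [|[|e]] /=; try exact: dhomog0.
  by rewrite dhomogX; apply/eqP; exact: mdeg1.
- by rewrite gradeD coefD; apply: dhomogD.
- rewrite gradeM coefM; apply: rpred_sum => i _.
  have := dhomogM (Hf i) (Hg (e - i)%N).
  by rewrite subnKC // -ltnS.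
Qed.

Lemma grade_sum f : f = \sum_(e < size (grade f)) (grade f)`_e.
Proof.
have {1}-> : f = (grade f).[1].
  elim/mpoly_ring_ind: f => [c|i|f g Hf Hg|f g Hf Hg].
  - by rewrite gradeC hornerC.
  - by rewrite gradeX hornerM hornerC hornerX mulr1.
  - by rewrite gradeD hornerD -Hf -Hg.
  - by rewrite gradeM hornerM -Hf -Hg.
by rewrite horner_coef; apply: eq_bigr => i _; rewrite expr1n mulr1.
Qed.

(** A homogeneous component of degree [e] has order at least [e] at the
    origin; with [grade_pow_irr], this identifies the powers of the irrelevant
    ideal with the filtration by order. *)
Lemma grade_irr f e : ideal_pow irr e (grade f)`_e.
Proof.
elim/mpoly_ring_ind: f e => [c|i|f g Hf Hg|f g Hf Hg] e.
- rewrite gradeC coefC; case: e => [|e] //=; apply: (@ideal0 _ (ideal_pow irr e.+1)).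
  exact: pow_ideal.
- rewrite gradeX coefMX coefC; case: e => [|[|e]] //=.
    by apply: (@pow1_mem _ irr); apply: irrX.
  by apply: (@ideal0 _ (ideal_pow irr e.+2)); apply: pow_ideal.
- by rewrite gradeD coefD; apply: idealD => //; apply: pow_ideal.
- rewrite gradeM coefM; apply: ideal_sum => [|i _]; first exact: pow_ideal.
  have := powD_mem (Hf i) (Hg (e - i)%N).
  by rewrite subnKC // -ltnS.
Qed.

Lemma form_irr d f : form d f -> ideal_pow irr d f.
Proof.
by move=> /formP Hf; have := grade_irr f d; rewrite Hf coefCM coefXn eqxx mulr1.
Qed.

Lemma grade_pow_irr d f : ideal_pow irr d f -> exists p : {poly R}, grade f = p * 'X^d.
Proof.
elim: d f => [|d IH] f; first by move=> _; exists (grade f); rewrite expr0 mulr1.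
move: f; apply: mul_min => [|a b Ha /IH [g Hg]].
  split=> [|f g [a Ha] [b Hb]|r f [a Ha]].
  - by exists 0; rewrite grade0 mul0r.
  - by exists (a + b); rewrite gradeD Ha Hb mulrDl.
  - by exists (grade r * a); rewrite gradeM Ha mulrA.
have [h Hh] : exists h : {poly R}, grade a = h * 'X.
  move: a Ha; apply: irr_min => [|i]; last by exists ('X_i)%:P; apply: gradeX.
  split=> [|f g' [a Ha] [c Hb]|r f [a Ha]].
  - by exists 0; rewrite grade0 mul0r.
  - by exists (a + c); rewrite gradeD Ha Hb mulrDl.
  - by exists (grade r * a); rewrite gradeM Ha mulrA.
by exists (h * g); rewrite gradeM Hg Hh exprS mulrACA.
Qed.

Lemma coef_ray_pow_irr d f e v : ideal_pow irr d f -> (e < d)%N -> (ray v f)`_e = 0.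
Proof.
by move=> /grade_pow_irr [g Hg] lt_ed; rewrite coef_ray Hg coefMXn lt_ed meval0.
Qed.

Lemma irr_pow_min d K : is_ideal K -> (forall f, form d f -> K f) ->
  forall f, ideal_pow irr d f -> K f.
Proof.
elim: d K => [|d IH] K iK KF f.
  by move=> _; rewrite -[f]mulr1; apply: idealMl => //; apply: KF; rewrite -mpolyC1; apply: formC.
apply: mul_min => // a b Ha; move: b.
apply: (IH (fun b => K (a * b))) => [|b Hb]; first exact: colon_idealr.
move: a Ha; apply: irr_min => [|i]; first exact: colon_ideall.
by apply: KF; rewrite -add1n; apply: formM => //; apply: formX.
Qed.

(** The statement is not closed under products, so the induction on [f] carries
    the components of degrees 0 and 1 of an arbitrary polynomial. *)
Lemma form1_linear f : form 1 f -> exists l : 'I_n -> k, f = \sum_i (l i)%:MP * 'X_i.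
Proof.
suff H g : (exists c : k, (grade g)`_0 = c%:MP) /\
    (exists l : 'I_n -> k, (grade g)`_1 = \sum_i (l i)%:MP * 'X_i).
  by move=> /formP Hf; have [_ [l]] := H f; rewrite Hf coefCM coefX mulr1 => ?; exists l.
elim/mpoly_ring_ind: g => [c|i|g h [[a Ha] [l Hl]] [[b Hb] [m Hm]]|
    g h [[a Ha] [l Hl]] [[b Hb] [m Hm]]].
- rewrite gradeC !coefC /=; split; first by exists c.
  by exists (fun=> 0); rewrite big1 // => i _; rewrite mpolyC0 mul0r.
- rewrite gradeX !coefMX !coefC /=; split; first by exists 0; rewrite mpolyC0.
  exists (fun j => (j == i)%:R); rewrite (bigD1 i) //= eqxx mpolyC1 mul1r big1 ?addr0 //.
  by move=> j /negbTE ->; rewrite mpolyC0 mul0r.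
- rewrite gradeD !coefD Ha Hb Hl Hm; split; first by exists (a + b); rewrite mpolyCD.
  by exists (fun i => l i + m i); rewrite -big_split; apply: eq_bigr => i _; rewrite mpolyCD mulrDl.
- rewrite gradeM !coefM !big_ord_recl !big_ord0 /= !addr0 Ha Hb Hl Hm.
  split; first by exists (a * b); rewrite mpolyCM.
  exists (fun i => a * m i + l i * b); rewrite mulr_suml mulr_sumr -big_split.
  by apply: eq_bigr => i _; rewrite mpolyCD !mpolyCM /=; ring.
Qed.

(** In a homogeneous ideal, the cofactors of an element of order at least [D]
    can be taken of the expected order: drop the others, which by degree
    cancel. *)
Lemma graded_gen_min (s : seq (R * nat)) K D : is_ideal K ->
  (forall p, p \in s -> form p.2 p.1) ->
  (forall p a, p \in s -> ideal_pow irr (D - p.2) a -> K (a * p.1)) ->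
  forall f, gen [seq p.1 | p <- s] f -> ideal_pow irr D f -> K f.
Proof.
move=> iK sF sK f Hf /grade_pow_irr [g Hg].
have H e : (D <= e)%N -> K (grade f)`_e.
  move=> le_De; elim: s sF sK f Hf {g Hg} => [|p s IH] sF sK f /=.
    by move=> ->; rewrite grade0 coef0; apply: ideal0.
  move=> [r [f' [Hf' ->]]]; rewrite gradeD coefD; apply: idealD => //; last first.
    by apply: IH => // [q qs|q a qs]; [apply: sF|apply: sK]; rewrite in_cons qs orbT.
  have /formP gradep := sF p (mem_head p s).
  rewrite gradeM gradep mulrA coefMXn coefMC.
  case: ltnP => [_|le_pe]; first exact: ideal0.
  apply: sK; first exact: mem_head.
  apply: (pow_anti (i := (e - p.2)%N)); last exact: grade_irr.
    by apply: leq_sub2r.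
  exact: irr_ideal.
rewrite [f]grade_sum; apply: ideal_sum => // e _.
have [/H//|lt_eD] := leqP D e.
have -> : (grade f)`_e = 0 by move: lt_eD; case: e => e _ /=; rewrite Hg coefMXn => ->.
exact: ideal0.
Qed.

(** ** Directional derivatives *)

Definition dd u f : R := \sum_c (u 0 c)%:MP * f^`M(c).

Lemma ddD u f g : dd u (f + g) = dd u f + dd u g.
Proof. by rewrite -big_split; apply: eq_bigr => c _; rewrite mderivD mulrDr. Qed.
Lemma dd0 u : dd u 0 = 0.
Proof. by apply: big1 => c _; rewrite mderiv0 mulr0. Qed.
Lemma ddN u f : dd u (- f) = - dd u f.
Proof. by rewrite -sumrN; apply: eq_bigr => c _; rewrite mderivN mulrN. Qed.
Lemma ddB u f g : dd u (f - g) = dd u f - dd u g.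
Proof. by rewrite ddD ddN. Qed.
Lemma ddM u f g : dd u (f * g) = dd u f * g + f * dd u g.
Proof.
rewrite mulr_suml mulr_sumr -big_split; apply: eq_bigr => c _ /=.
by rewrite mderivM; ring.
Qed.
Lemma ddC u c : dd u c%:MP = 0.
Proof. by apply: big1 => i _; rewrite mderivC mulr0. Qed.
Lemma ddCM u c f : dd u (c%:MP * f) = c%:MP * dd u f.
Proof. by rewrite ddM ddC mul0r add0r. Qed.
Lemma ddX u i : dd u 'X_i = (u 0 i)%:MP.
Proof.
rewrite /dd (bigD1 i) //= big1 ?addr0 => [|j ji].
  have E : (U_(i) - U_(i))%MM = 0%MM :> 'X_{1..n} by apply/mnmP => j; rewrite mnmBE subnn mnm0E.
  by rewrite mderivX mnm1E eqxx E mpolyX0 scale1r mulr1.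
by rewrite mderivX mnm1E eq_sym (negbTE ji) scale0r mulr0.
Qed.
Lemma dd_addl u w f : dd (u + w) f = dd u f + dd w f.
Proof. by rewrite -big_split; apply: eq_bigr => c _; rewrite mxE mpolyCD mulrDl. Qed.
Lemma dd_scalel a u f : dd (a *: u) f = a%:MP * dd u f.
Proof. by rewrite mulr_sumr; apply: eq_bigr => c _; rewrite mxE mpolyCM mulrA. Qed.
Lemma dd_sum u (T : Type) (r : seq T) (P : pred T) (F : T -> R) :
  dd u (\sum_(i <- r | P i) F i) = \sum_(i <- r | P i) dd u (F i).
Proof. by elim/big_rec2: _ => [|i a b _ <-]; rewrite ?dd0 ?ddD. Qed.
Lemma dd_delta c f : dd (delta_mx 0 c) f = f^`M(c).
Proof.
rewrite /dd (bigD1 c) //= big1 ?addr0 ?mxE ?eqxx ?mpolyC1 ?mul1r // => j ji.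
by rewrite mxE (negbTE ji) /= mpolyC0 mul0r.
Qed.

(** Differentiation lowers the exponent of a power of an ideal by one. *)
Lemma dd_pow (K : R -> Prop) u j f : is_ideal K ->
  ideal_pow K j.+1 f -> ideal_pow K j (dd u f).
Proof.
move=> iK; elim: j f => [//|j IH] f Hf.
suff : ideal_pow K j.+2 f /\ ideal_pow K j.+1 (dd u f) by case.
move: f Hf; apply: mul_min => [|a b Ha Hb]; last first.
  split; first exact: powS_mem.
  rewrite ddM; apply: idealD; [exact: pow_ideal|by apply: idealMl => //; apply: pow_ideal|].
  by apply: powS_mem => //; apply: IH.
have iP1 := pow_ideal K j.+1; have iP2 := pow_ideal K j.+2.
split=> [|a b [Ha Ha'] [Hb Hb']|r a [Ha Ha']].
- by rewrite dd0; split; apply: ideal0.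
- by rewrite ddD; split; apply: idealD.
- rewrite ddM; split; first exact: idealMl.
  apply: idealD => //; apply: idealMl => //.
  by apply: (@pow_anti _ K j.+2 j.+1) => //; exact: leqnSn.
Qed.

(** A 2x2 minor of the Jacobian matrix of f, g, in arbitrary directions. *)
Definition bracket u w f g : R := dd u f * dd w g - dd w f * dd u g.

(** The Jacobian ideal, without choosing generators or coordinates. *)
Definition jac (J : R -> Prop) : R -> Prop :=
  ideal_add J (ideal_span (fun h => exists u w f g, [/\ J f, J g & h = bracket u w f g])).

Lemma jac_ideal J : is_ideal (jac J). Proof. exact: add_ideal. Qed.
Lemma jac_sub J f : J f -> jac J f.
Proof. by move=> Jf; apply: span_mem; left. Qed.
Lemma jac_bracket J u w f g : J f -> J g -> jac J (bracket u w f g).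
Proof. by move=> Jf Jg; apply: span_mem; right; apply: span_mem; exists u, w, f, g. Qed.

Lemma jac_sub_min (J K : R -> Prop) : is_ideal K -> (forall f, J f -> K f) ->
  (forall u w f g, J f -> J g -> K (bracket u w f g)) -> forall f, jac J f -> K f.
Proof.
move=> iK JK HK; apply: add_min => //; apply: span_min => //.
by move=> _ [u [w [f [g [Jf Jg ->]]]]]; apply: HK.
Qed.

Lemma bracketC u w f g : bracket u w g f = - bracket u w f g.
Proof. by rewrite /bracket; ring. Qed.
Lemma bracketff u w f : bracket u w f f = 0.
Proof. by rewrite /bracket; ring. Qed.

(** By the Leibniz rule, brackets of generators suffice. *)
Lemma bracket_gen_min (J S K : R -> Prop) u w : is_ideal K ->
  (forall f, J f -> ideal_span S f) -> (forall f, S f -> K f) ->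
  (forall f g, S f -> S g -> K (bracket u w f g)) ->
  forall f g, J f -> J g -> K (bracket u w f g).
Proof.
move=> iK JS SK HK f g /JS Hf /JS Hg.
have SK' := span_min iK SK.
have H g' : S g' -> K (bracket u w f g').
  move=> Sg'; move: Hf => [m [c [h [Sh ->]]]].
  rewrite /bracket !dd_sum !mulr_suml -sumrB; apply: ideal_sum => // i _.
  have -> : dd u (c i * h i) * dd w g' - dd w (c i * h i) * dd u g' =
    (dd u (c i) * dd w g' - dd w (c i) * dd u g') * h i + c i * bracket u w (h i) g'.
    by rewrite !ddM /bracket; ring.
  apply: idealD => //; apply: idealMl => //; [exact: SK|exact: HK].
move: Hg => [m [c [h [Sh ->]]]].
rewrite /bracket !dd_sum !mulr_sumr -sumrB; apply: ideal_sum => // i _.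
have -> : dd u f * dd w (c i * h i) - dd w f * dd u (c i * h i) =
    (dd u f * dd w (c i) - dd w f * dd u (c i)) * h i + c i * bracket u w f (h i).
  by rewrite !ddM /bracket; ring.
apply: idealD => //; apply: idealMl => //; [exact: SK|exact: H].
Qed.

(** Antisymmetry leaves three brackets to check for three generators. *)
Lemma bracket_gen3_min (J K : R -> Prop) u w f1 f2 f3 : is_ideal K ->
  (forall f, J f -> gen [:: f1; f2; f3] f) -> K f1 -> K f2 -> K f3 ->
  K (bracket u w f1 f2) -> K (bracket u w f1 f3) -> K (bracket u w f2 f3) ->
  forall f g, J f -> J g -> K (bracket u w f g).
Proof.
move=> iK JG K1 K2 K3 K12 K13 K23.
have Ks f g : K (bracket u w f g) -> K (bracket u w g f).
  by rewrite [bracket u w g f]bracketC; apply: (idealN iK).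
have K0 f : K (bracket u w f f) by rewrite bracketff; exact: (ideal0 iK).
apply: (bracket_gen_min (S := fun f => [\/ f = f1, f = f2 | f = f3]) iK).
- move=> f /JG; move: f; apply: gen_min; first exact: span_ideal.
  move=> f; rewrite !inE => /or3P[]/eqP ->; apply: span_mem;
    by [apply: Or31|apply: Or32|apply: Or33].
- by move=> f [] ->; [exact: K1|exact: K2|exact: K3].
move=> f g [] -> [] ->; solve [exact: K0|exact: K12|exact: K13|exact: K23|
  exact: (Ks _ _ K12)|exact: (Ks _ _ K13)|exact: (Ks _ _ K23)].
Qed.

End Polynomials.

(** * The intrinsic form of the data of the theorem *)

Lemma det_mx22 (A : comNzRingType) (M : 'M[A]_2) : \det M = M 0 0 * M 1 1 - M 0 1 * M 1 0.
Proof.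
rewrite (expand_det_row _ 0) !big_ord_recl big_ord0 addr0 /cofactor !det_mx11 !mxE /=.
rewrite expr0 mul1r expr1 mulN1r mulrN.
by congr (_ * M _ _ - M _ _ * M _ _); apply: val_inj.
Qed.

(** By the Leibniz rule brackets of elements of J reduce, modulo J, to brackets
    of the generators, and these expand bilinearly into the 2x2 minors in the
    coordinate directions, which up to sign and repetition are those with
    increasing indices. *)
Lemma jacobian_idealP (k : fieldType) n (J : {mpoly k[n]} -> Prop) m
    (g : 'I_m -> {mpoly k[n]}) : homogeneous_generators J g ->
  forall f, jacobian_ideal J g f <-> jac J f.
Proof.
move=> [_ Jg] f; split; last first.
  move: f; have iK : is_ideal (jacobian_ideal J g) by exact: add_ideal.
  have JK h : J h -> jacobian_ideal J g h by move=> Jh; apply: span_mem; left.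
  apply: jac_sub_min => // u w.
  apply: (bracket_gen_min (S := fun h => exists i, h = g i)) => //.
  - by move=> h /Jg.
  - by move=> h Sh; apply: JK; apply/Jg; apply: span_mem.
  move=> _ _ [i ->] [j ->].
  pose M i j c d := (g i)^`M(c) * (g j)^`M(d) - (g i)^`M(d) * (g j)^`M(c).
  have minor (i' j' : 'I_m) (c d : 'I_n) : (i' < j')%N -> (c < d)%N -> jacobian_ideal J g (M i' j' c d).
    move=> ij cd; apply: span_mem; right; apply: span_mem.
    exists (fun s : 'I_2 => if s == ord0 then i' else j'),
      (fun s : 'I_2 => if s == ord0 then c else d); split.
    - by move=> [[|[|?]] ?] [[|[|?]] ?].
    - by move=> [[|[|?]] ?] [[|[|?]] ?].
    by rewrite det_mx22 !mxE.
  have MK (i' j' : 'I_m) (c d : 'I_n) : jacobian_ideal J g (M i' j' c d).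
    have [lt_cd|lt_dc|/val_inj <-] := ltngtP c d; last first.
    - by rewrite /M subrr; apply: ideal0.
    - have -> : M i' j' c d = - M i' j' d c by rewrite /M; ring.
      apply: idealN => //; have [|lt_ji|/val_inj <-] := ltngtP i' j'; first by move=> /minor; apply.
        have -> : M i' j' d c = - M j' i' d c by rewrite /M; ring.
        by apply: idealN => //; apply: minor.
      have -> : M i' i' d c = 0 by rewrite /M; ring.
      exact: ideal0.
    have [|lt_ji|/val_inj <-] := ltngtP i' j'; first by move=> /minor; apply.
      have -> : M i' j' c d = - M j' i' c d by rewrite /M; ring.
      by apply: idealN => //; apply: minor.
    have -> : M i' i' c d = 0 by rewrite /M; ring.
    exact: ideal0.
  have -> : bracket u w (g i) (g j) =
      \sum_c \sum_d (u 0 c)%:MP * (w 0 d)%:MP * M i j c d.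
    rewrite /bracket /dd !big_distrlr /= [X in _ - X]exchange_big -sumrB.
    apply: eq_bigr => c _; rewrite -sumrB; apply: eq_bigr => d _; rewrite /M; ring.
  by apply: ideal_sum => // c _; apply: ideal_sum => // d _; apply: idealMl.
move: f; apply: add_min => [||f]; [exact: jac_ideal|exact: jac_sub|].
apply: span_min; first exact: jac_ideal.
move=> _ [r [c [_ _ ->]]]; rewrite det_mx22 !mxE -!dd_delta.
have Jgi i : J (g i) by apply/Jg; apply: span_mem; exists i.
exact: (jac_bracket (delta_mx 0 (c 0)) (delta_mx 0 (c 1)) (Jgi (r 0)) (Jgi (r 1))).
Qed.

(** The homogeneous ideal of the projective points represented by [vs]. *)
Definition vanish (k : fieldType) (vs : seq 'rV[k]_3) (f : {mpoly k[3]}) : Prop :=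
  forall v, v \in vs -> ray v f = 0.

Definition i0 : 'I_3 := @Ordinal 3 0 isT.
Definition i1 : 'I_3 := @Ordinal 3 1 isT.
Definition i2 : 'I_3 := @Ordinal 3 2 isT.

(** The equation of the line through two points. *)
HB.lock Definition lf (k : fieldType) (a b : 'rV[k]_3) : {mpoly k[3]} :=
  (a 0 i1 * b 0 i2 - a 0 i2 * b 0 i1)%:MP * 'X_i0 +
  (a 0 i2 * b 0 i0 - a 0 i0 * b 0 i2)%:MP * 'X_i1 +
  (a 0 i0 * b 0 i1 - a 0 i1 * b 0 i0)%:MP * 'X_i2.

Section Points.
Variable k : fieldType.
Local Notation R := {mpoly k[3]}.
Implicit Types (f g : R) (a b c u v : 'rV[k]_3).

Lemma vanish_ideal (vs : seq 'rV[k]_3) : is_ideal (vanish vs).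
Proof.
by split=> [v _|f g Hf Hg v vvs|r f Hf v vvs];
  have := ray_ideal v; [exact: ideal0|move/idealD; apply; [exact: Hf|exact: Hg]|
  move/idealMl; apply; exact: Hf].
Qed.

Lemma P2_dim (P : P2 k) : \dim (val P) = 1%N.
Proof. exact: (eqP (valP P)). Qed.

Lemma P2_vpick_neq0 (P : P2 k) : vpick (val P) != 0.
Proof.
rewrite vpick0; apply/eqP => P0; have := P2_dim P.
by move: (val P) P0 => V ->; rewrite dimv0.
Qed.

Lemma P2_vline (P : P2 k) : val P = <[vpick (val P)]>%VS.
Proof.
apply/esym/eqP; rewrite eqEdim -memvE memv_pick /= P2_dim dim_vline.
by rewrite P2_vpick_neq0.
Qed.

(** The coefficients of the rays of an element of [vanish] are the values of
    its homogeneous components, so these are forms vanishing at the points. *)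
Lemma vanishing_idealP (X : {fset P2 k}) f :
  vanishing_ideal X f <-> vanish [seq vpick (val P) | P <- X] f.
Proof.
split.
  move: f; apply: span_min; first exact: vanish_ideal.
  move=> f [[d /dhomog_form Hf] H] _ /mapP[P PX ->].
  apply: (ray_form_eq0 Hf); apply: (H P PX); first exact: memv_pick.
  exact: P2_vpick_neq0.
move=> H; rewrite [f]grade_sum; apply: ideal_sum; first exact: span_ideal.
move=> e _; apply: span_mem; split; first by exists e; exact: grade_dhomog.
move=> P PX v; rewrite P2_vline => /vlineP[c ->] _.
rewrite -[X in meval X]/((c *: vpick (val P)) 0) -coef_ray.
by rewrite ray_scale ?coef0 //; apply: H; apply/mapP; exists P.
Qed.

Lemma sum3 (V : zmodType) (F : 'I_3 -> V) : \sum_i F i = F i0 + F i1 + F i2.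
Proof.
rewrite !big_ord_recl big_ord0 addr0 addrA.
by congr (F _ + F _ + F _); apply: val_inj.
Qed.

Lemma ord3P (P : 'I_3 -> Prop) : P i0 -> P i1 -> P i2 -> forall i, P i.
Proof.
by move=> P0 P1 P2 [[|[|[|//]]] lt_i]; [move: P0|move: P1|move: P2]; congr P; apply: val_inj.
Qed.

Definition det3 a b c : k :=
  (a 0 i1 * b 0 i2 - a 0 i2 * b 0 i1) * c 0 i0 +
  (a 0 i2 * b 0 i0 - a 0 i0 * b 0 i2) * c 0 i1 +
  (a 0 i0 * b 0 i1 - a 0 i1 * b 0 i0) * c 0 i2.

Lemma lf_form a b : form 1 (lf a b).
Proof. by rewrite lf.unlock; do 2?[apply: formD]; apply: formCM; exact: formX. Qed.

Lemma lf_eval a b v : (lf a b).@[v 0] = det3 a b v.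
Proof. by rewrite lf.unlock !mevalD !mevalM !mevalC !mevalXU. Qed.

Lemma lf_ray a b v : ray v (lf a b) = det3 a b v *: 'X.
Proof. by rewrite (ray_form _ (lf_form a b)) lf_eval. Qed.

Lemma lf_dd a b u : dd u (lf a b) = (det3 a b u)%:MP.
Proof. by rewrite lf.unlock !ddD !ddCM !ddX -!mpolyCM -!mpolyCD. Qed.

Lemma det3_aab a b : det3 a a b = 0. Proof. by rewrite /det3; ring. Qed.
Lemma det3_aba a b : det3 a b a = 0. Proof. by rewrite /det3; ring. Qed.
Lemma det3_abb a b : det3 a b b = 0. Proof. by rewrite /det3; ring. Qed.
Lemma det3_swap12 a b c : det3 b a c = - det3 a b c. Proof. by rewrite /det3; ring. Qed.
Lemma det3_rot a b c : det3 b c a = det3 a b c. Proof. by rewrite /det3; ring. Qed.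
Lemma det3D a b c c' : det3 a b (c + c') = det3 a b c + det3 a b c'.
Proof. by rewrite /det3 !mxE; ring. Qed.
Lemma det3Z a b c x : det3 a b (x *: c) = x * det3 a b c.
Proof. by rewrite /det3 !mxE; ring. Qed.

(** Up to the determinant, the linear forms dual to the basis [a], [b], [c] are
    the equations of the sides of the triangle. *)
Lemma cramer a b c i :
  (det3 a b c)%:MP * 'X_i =
  (a 0 i)%:MP * lf b c + (b 0 i)%:MP * lf c a + (c 0 i)%:MP * lf a b :> R.
Proof. by move: i; apply: ord3P; rewrite lf.unlock /det3; ring. Qed.

End Points.

(** * Coordinates adapted to a basis *)

Section Coordinates.
Variable k : fieldType.
Local Notation R := {mpoly k[3]}.

(** [x], [y], [z] are the linear forms dual to the basis [e1], [e2], [e3];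
    working with them replaces changes of coordinates. *)
Record coords (e1 e2 e3 : 'rV[k]_3) (x y z : R) : Prop := Coords {
  coordsX : forall i, 'X_i = (e1 0 i)%:MP * x + (e2 0 i)%:MP * y + (e3 0 i)%:MP * z;
  coords_basis : forall v, exists a b c, v = a *: e1 + b *: e2 + c *: e3;
  coords_formx : form 1 x;
  coords_formy : form 1 y;
  coords_formz : form 1 z;
  coords_evalx : forall a b c, x.@[(a *: e1 + b *: e2 + c *: e3) 0] = a;
  coords_evaly : forall a b c, y.@[(a *: e1 + b *: e2 + c *: e3) 0] = b;
  coords_evalz : forall a b c, z.@[(a *: e1 + b *: e2 + c *: e3) 0] = c;
  coords_dx : forall a b c, dd (a *: e1 + b *: e2 + c *: e3) x = a%:MP;
  coords_dy : forall a b c, dd (a *: e1 + b *: e2 + c *: e3) y = b%:MP;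
  coords_dz : forall a b c, dd (a *: e1 + b *: e2 + c *: e3) z = c%:MP
}.

Lemma coords_exist (e1 e2 e3 : 'rV[k]_3) : det3 e1 e2 e3 != 0 ->
  coords e1 e2 e3 ((det3 e1 e2 e3)^-1%:MP * lf e2 e3)
    ((det3 e1 e2 e3)^-1%:MP * lf e3 e1) ((det3 e1 e2 e3)^-1%:MP * lf e1 e2).
Proof.
move=> D0; set D := det3 e1 e2 e3.
have DV (c : k) : D^-1 * (c * D) = c by rewrite mulrC mulfK.
have H1 a b c : det3 e2 e3 (a *: e1 + b *: e2 + c *: e3) = a * D.
  by rewrite !det3D !det3Z det3_aba det3_abb /D /det3; ring.
have H2 a b c : det3 e3 e1 (a *: e1 + b *: e2 + c *: e3) = b * D.
  by rewrite !det3D !det3Z det3_aba det3_abb /D /det3; ring.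
have H3 a b c : det3 e1 e2 (a *: e1 + b *: e2 + c *: e3) = c * D.
  by rewrite !det3D !det3Z det3_aba det3_abb /D; ring.
split.
- move=> i; have := cramer e1 e2 e3 i; rewrite -/D => E.
  transitivity (D^-1%:MP * (D%:MP * 'X_i) : R).
    by rewrite mulrA -mpolyCM mulVf // mpolyC1 mul1r.
  by rewrite E; ring.
- move=> v; exists (D^-1 * det3 e2 e3 v), (D^-1 * det3 e3 e1 v), (D^-1 * det3 e1 e2 v).
  have E t w : D * (D^-1 * t * w) = t * w by rewrite !mulrA mulfV // mul1r.
  by apply/rowP; apply: ord3P; rewrite !mxE; apply: (mulfI D0);
    rewrite 2!(mulrDr (det3 e1 e2 e3)) -/D !E /D /det3; ring.
- by apply: formCM; exact: lf_form.
- by apply: formCM; exact: lf_form.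
- by apply: formCM; exact: lf_form.
- by move=> a b c; rewrite mevalM mevalC lf_eval H1 DV.
- by move=> a b c; rewrite mevalM mevalC lf_eval H2 DV.
- by move=> a b c; rewrite mevalM mevalC lf_eval H3 DV.
- by move=> a b c; rewrite ddCM lf_dd H1 -mpolyCM DV.
- by move=> a b c; rewrite ddCM lf_dd H2 -mpolyCM DV.
- by move=> a b c; rewrite ddCM lf_dd H3 -mpolyCM DV.
Qed.

Lemma coords_rot e1 e2 e3 x y z : coords e1 e2 e3 x y z -> coords e2 e3 e1 y z x.
Proof.
have E (a b c : k) : a *: e2 + b *: e3 + c *: e1 = c *: e1 + a *: e2 + b *: e3.
  by rewrite addrC addrA.
case=> cX cb fx fy fz vx vy vz dx dy dz; split=> //; try by move=> a b c; rewrite E.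
- by move=> i; rewrite cX -addrA addrC.
- by move=> v; have [a [b [c ->]]] := cb v; exists b, c, a; rewrite E.
Qed.

Lemma coords_swap e1 e2 e3 x y z : coords e1 e2 e3 x y z -> coords e2 e1 e3 y x z.
Proof.
have E (a b c : k) : a *: e2 + b *: e1 + c *: e3 = b *: e1 + a *: e2 + c *: e3.
  by congr (_ + _); rewrite addrC.
case=> cX cb fx fy fz vx vy vz dx dy dz; split=> //; try by move=> a b c; rewrite E.
- by move=> i; rewrite cX; congr (_ + _); rewrite addrC.
- by move=> v; have [a [b [c ->]]] := cb v; exists b, a, c; rewrite E.
Qed.

Section Fixed.
Variables (e1 e2 e3 : 'rV[k]_3) (x y z : R).
Hypothesis C : coords e1 e2 e3 x y z.

Lemma coords_rayx a b c : ray (a *: e1 + b *: e2 + c *: e3) x = a *: 'X.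
Proof. by rewrite (ray_form _ (coords_formx C)) (coords_evalx C). Qed.
Lemma coords_rayy a b c : ray (a *: e1 + b *: e2 + c *: e3) y = b *: 'X.
Proof. by rewrite (ray_form _ (coords_formy C)) (coords_evaly C). Qed.
Lemma coords_rayz a b c : ray (a *: e1 + b *: e2 + c *: e3) z = c *: 'X.
Proof. by rewrite (ray_form _ (coords_formz C)) (coords_evalz C). Qed.

Lemma e1E : e1 = 1 *: e1 + 0 *: e2 + 0 *: e3.
Proof. by rewrite scale1r !scale0r !addr0. Qed.
Lemma e2E : e2 = 0 *: e1 + 1 *: e2 + 0 *: e3.
Proof. by rewrite scale1r !scale0r add0r addr0. Qed.
Lemma e3E : e3 = 0 *: e1 + 0 *: e2 + 1 *: e3.
Proof. by rewrite scale1r !scale0r !add0r. Qed.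
Lemma e12E a : e1 + a *: e2 = 1 *: e1 + a *: e2 + 0 *: e3.
Proof. by rewrite scale1r scale0r addr0. Qed.

Lemma ray_e2 : (ray e2 x = 0) * (ray e2 y = 'X) * (ray e2 z = 0).
Proof.
by have := (coords_rayx 0 1 0, coords_rayy 0 1 0, coords_rayz 0 1 0);
  rewrite -e2E scale1r !scale0r.
Qed.
Lemma ray_e3 : (ray e3 x = 0) * (ray e3 y = 0) * (ray e3 z = 'X).
Proof.
by have := (coords_rayx 0 0 1, coords_rayy 0 0 1, coords_rayz 0 0 1);
  rewrite -e3E scale1r !scale0r.
Qed.
Lemma ray_e12 c :
  (ray (e1 + c *: e2) x = 'X) * (ray (e1 + c *: e2) y = c%:P * 'X) *
  (ray (e1 + c *: e2) z = 0).
Proof.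
by have := (coords_rayx 1 c 0, coords_rayy 1 c 0, coords_rayz 1 c 0);
  rewrite -e12E scale1r scale0r mul_polyC.
Qed.

Lemma dx1 : dd e1 x = 1. Proof. by rewrite {1}e1E (coords_dx C) mpolyC1. Qed.
Lemma dx2 : dd e2 x = 0. Proof. by rewrite {1}e2E (coords_dx C) mpolyC0. Qed.
Lemma dx3 : dd e3 x = 0. Proof. by rewrite {1}e3E (coords_dx C) mpolyC0. Qed.
Lemma dy1 : dd e1 y = 0. Proof. by rewrite {1}e1E (coords_dy C) mpolyC0. Qed.
Lemma dy2 : dd e2 y = 1. Proof. by rewrite {1}e2E (coords_dy C) mpolyC1. Qed.
Lemma dy3 : dd e3 y = 0. Proof. by rewrite {1}e3E (coords_dy C) mpolyC0. Qed.
Lemma dz1 : dd e1 z = 0. Proof. by rewrite {1}e1E (coords_dz C) mpolyC0. Qed.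
Lemma dz2 : dd e2 z = 0. Proof. by rewrite {1}e2E (coords_dz C) mpolyC0. Qed.
Lemma dz3 : dd e3 z = 1. Proof. by rewrite {1}e3E (coords_dz C) mpolyC1. Qed.

Definition coords_dE := (dx1, dx2, dx3, dy1, dy2, dy3, dz1, dz2, dz3).

(** The ideal of finitely many points on a line is generated by an equation of
    the line and by the product of linear forms through the points; the points
    are peeled off one at a time with [ray_vanish_mem]. *)
Lemma collinear_mem (cs : seq k) f : uniq cs ->
  (forall c, c \in cs -> ray (e1 + c *: e2) f = 0) ->
  exists a b, f = \prod_(c <- cs) (y - c%:MP * x) * a + z * b.
Proof.
elim: cs f => [|c cs IH] f /=.
  by exists f, 0; rewrite big_nil mul1r mulr0 addr0.
move=> /andP[c_cs cs_uniq] Hf.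
have [r [_ [[s [_ [-> ->]]] Ef]]] : gen [:: y - c%:MP * x; z] f.
  apply: (ray_vanish_mem (v := e1 + c *: e2) (a := x)); first exact: gen_ideal.
    move=> i; exists (e2 0 i)%:MP, ((e3 0 i)%:MP * z); split.
      by exists (e3 0 i)%:MP, 0; rewrite addr0.
    by rewrite (coordsX C) !mxE mpolyCD mpolyCM; ring.
  by apply: Hf; rewrite mem_head.
have [a [b Er]] : exists a b, r = \prod_(c <- cs) (y - c%:MP * x) * a + z * b.
  apply: IH => // d dcs; have := Hf d; rewrite in_cons dcs orbT => /(_ isT).
  rewrite Ef !(rayB, rayD, rayM, rayN, rayC) !ray_e12.
  rewrite polyC0 mulr0 !addr0 -mulrBl -polyCB => /eqP.
  rewrite !mulf_eq0 polyX_eq0 polyC_eq0 subr_eq0 orbF => /orP[/eqP->//|/eqP E].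
  by rewrite -E dcs in c_cs.
by exists a, ((y - c%:MP * x) * b + s); rewrite big_cons Ef Er; ring.
Qed.

Lemma irr_coords : [/\ irr x, irr y & irr z].
Proof.
have H l : form 1 l -> irr l.
  by move=> /form_irr /pow1_min; apply; exact: irr_ideal.
by split; apply: H; [exact: coords_formx C|exact: coords_formy C|exact: coords_formz C].
Qed.

Lemma irr_gen f : irr f -> gen [:: x; y; z] f.
Proof.
apply: irr_min; first exact: gen_ideal.
move=> i; rewrite (coordsX C).
by exists (e1 0 i)%:MP, ((e2 0 i)%:MP * y + (e3 0 i)%:MP * z); split; [
  exists (e2 0 i)%:MP, ((e3 0 i)%:MP * z); split=> //; exists (e3 0 i)%:MP, 0; rewrite addr0|
  rewrite addrA].
Qed.

(** Splits off the only monomial of degree [j.+1] outside ([x], [y]). *)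
Lemma irr_pow_split j f : ideal_pow (@irr k 3) j.+1 f ->
  exists a b c, [/\ ideal_pow (@irr k 3) j a, ideal_pow (@irr k 3) j b &
    f = x * a + y * b + c * z ^+ j.+1].
Proof.
have [ix iy iz] := irr_coords.
elim: j f => [|j IH] f.
  move=> /(pow1_min (irr_ideal k 3)) /irr_gen.
  move=> [r [_ [[s [_ [[t [_ [-> ->]]] ->]]] ->]]].
  by exists r, s, t; split=> //; rewrite expr1; ring.
have iP := pow_ideal (@irr k 3) j.+1.
move: f; apply: mul_min => [|g h ig /IH [a [b [c [Ha Hb ->]]]]].
  split=> [|_ _ [a [b [c [Ha Hb ->]]]] [a' [b' [c' [Ha' Hb' ->]]]]|r _ [a [b [c [Ha Hb ->]]]]].
  - by exists 0, 0, 0; split; [exact: ideal0|exact: ideal0|ring].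
  - by exists (a + a'), (b + b'), (c + c'); split; [exact: idealD|exact: idealD|ring].
  - by exists (r * a), (r * b), (r * c); split; [exact: idealMl|exact: idealMl|ring].
have [r [_ [[s [_ [[t [_ [-> ->]]] ->]]] Er]]] := irr_gen ig.
have zP : ideal_pow (@irr k 3) j.+1 (z ^+ j.+1) by apply: pow_exp.
exists (g * a + r * c * z ^+ j.+1), (g * b + s * c * z ^+ j.+1), (t * c); split.
- by apply: idealD; [exact: iP|exact: powS_mem|exact: idealMl].
- by apply: idealD; [exact: iP|exact: powS_mem|exact: idealMl].
- by rewrite [z ^+ j.+2]exprS Er; ring.
Qed.

(** Brackets are bilinear and alternating in the directions. *)
Lemma bracket_coords_min (K : R -> Prop) f g : is_ideal K ->
  K (bracket e1 e2 f g) -> K (bracket e2 e3 f g) -> K (bracket e3 e1 f g) ->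
  forall u w, K (bracket u w f g).
Proof.
move=> iK K12 K23 K31 u w.
have [a [b [c ->]]] := coords_basis C u; have [a' [b' [c' ->]]] := coords_basis C w.
have -> : bracket (a *: e1 + b *: e2 + c *: e3) (a' *: e1 + b' *: e2 + c' *: e3) f g =
  (a * b' - b * a')%:MP * bracket e1 e2 f g + (b * c' - c * b')%:MP * bracket e2 e3 f g
  + (c * a' - a * c')%:MP * bracket e3 e1 f g.
  by rewrite /bracket !dd_addl !dd_scalel; ring.
by do 2?[apply: idealD => //]; apply: idealMl.
Qed.

End Fixed.
End Coordinates.

(** * At least four points on a line *)

(** The points e1 + c e2 lie on the line [z] = 0, and [e3] is the only other
    point that may occur; [F] cuts out the former on the line. *)
Section FourCollinear.
Variable k : fieldType.
Hypothesis char0 : [pchar k] =i pred0.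
Local Notation R := {mpoly k[3]}.
Variables (e1 e2 e3 : 'rV[k]_3) (x y z : R).
Hypothesis C : coords e1 e2 e3 x y z.
Variables (cs : seq k) (vs : seq 'rV[k]_3).
Hypothesis cs_uniq : uniq cs.
Hypothesis cs_size : (4 <= size cs)%N.
Hypothesis vs_cs : forall c, c \in cs -> e1 + c *: e2 \in vs.
Hypothesis vs_sub : forall v, v \in vs -> (exists2 c, c \in cs & v = e1 + c *: e2) \/ v = e3.

Let J := vanish vs.
Let I := jac J.
Let L (c : k) : R := y - c%:MP * x.
Let F : R := \prod_(c <- cs) L c.
Let P := dd e1 F.
Let Q := dd e2 F.
Let n := gen [:: x; y].

Local Lemma dL1 c : dd e1 (L c) = - c%:MP.
Proof. by rewrite /L ddB ddCM !(coords_dE C) mulr1 sub0r. Qed.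
Local Lemma dL2 c : dd e2 (L c) = 1.
Proof. by rewrite /L ddB ddCM !(coords_dE C) mulr0 subr0. Qed.
Local Lemma dL3 c : dd e3 (L c) = 0.
Proof. by rewrite /L ddB ddCM !(coords_dE C) mulr0 subr0. Qed.

Local Lemma euler : (size cs)%:R%:MP * F = x * P + y * Q.
Proof.
rewrite /P /Q /F; elim: (cs) => [|c s IH] /=.
  by rewrite big_nil mpolyC0 mul0r -mpolyC1 !ddC !mulr0 addr0.
rewrite big_cons !ddM dL1 dL2 -[(size s).+1]add1n natrD mpolyCD mpolyC1 mulrDl mul1r.
have -> : (size s)%:R%:MP * (L c * \prod_(j <- s) L j) =
  L c * (x * dd e1 (\prod_(j <- s) L j) + y * dd e2 (\prod_(j <- s) L j)).
  by rewrite -IH; ring.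
by rewrite /L; ring.
Qed.

Local Lemma dF3 : dd e3 F = 0.
Proof.
rewrite /F; elim: (cs) => [|c s IH]; first by rewrite big_nil -mpolyC1 ddC.
by rewrite big_cons ddM dL3 IH mul0r mulr0 addr0.
Qed.

Local Lemma ddF u : exists a b : k, dd u F = a%:MP * P + b%:MP * Q.
Proof.
have [a [b [c ->]]] := coords_basis C u; exists a, b.
by rewrite !dd_addl !dd_scalel dF3 mulr0 addr0.
Qed.

Local Lemma size_neq0 : (size cs)%:R != 0 :> k.
Proof. by rewrite (proj1 (pcharf0P k) char0); case: (cs) cs_size. Qed.

Local Lemma JF : J F.
Proof.
move=> v /vs_sub [[c ccs ->]|->].
  rewrite /F (big_rem c ccs) /= rayM /L.
  by rewrite rayB rayM rayC !(ray_e12 C) subrr mul0r.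
have : (0 < size cs)%N by apply: leq_trans cs_size.
rewrite /F; case: (cs) => [//|c s] _; rewrite big_cons rayM /L rayB rayM rayC.
by rewrite !(ray_e3 C) mulr0 subrr mul0r.
Qed.

Local Lemma Jxz : J (x * z).
Proof.
by move=> v /vs_sub [[c ccs ->]|->];
  rewrite rayM ?(ray_e12 C) ?(ray_e3 C) ?mulr0 ?mul0r.
Qed.

Local Lemma Jyz : J (y * z).
Proof.
by move=> v /vs_sub [[c ccs ->]|->];
  rewrite rayM ?(ray_e12 C) ?(ray_e3 C) ?mulr0 ?mul0r.
Qed.

Local Lemma line_J_mem f : J f -> exists a b, f = F * a + z * b.
Proof. by move=> Jf; apply: (collinear_mem C) => // c ccs; apply: Jf; apply: vs_cs. Qed.

Local Lemma I_xyPQ l : l \in [:: x; y] -> I (l * P) /\ I (l * Q).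
Proof.
have step l' : J (l' * z) -> dd e3 (l' * z) = l' -> I (l' * P) /\ I (l' * Q).
  move=> Jl dl; split.
    by have := jac_bracket e3 e1 Jl JF; rewrite /bracket dF3 mulr0 subr0 dl.
  by have := jac_bracket e3 e2 Jl JF; rewrite /bracket dF3 mulr0 subr0 dl.
rewrite !inE => /orP[]/eqP->; apply: step; try exact: Jxz; try exact: Jyz;
  by rewrite ddM !(coords_dE C) mul0r add0r mulr1.
Qed.

Local Lemma I_nPQ a : n a -> I (a * P) /\ I (a * Q).
Proof.
have iI := jac_ideal J.
move: a; apply: gen_min; last exact: I_xyPQ.
by apply: capI_ideal; apply: colon_ideall.
Qed.

Local Lemma I2_n2 a S T : (S = P \/ S = Q) -> (T = P \/ T = Q) ->
  ideal_pow n 2 a -> ideal_pow I 2 (a * S * T).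
Proof.
move=> HS HT; have iP := pow_ideal I 2.
move: a; apply: (mul_min (K := fun a => ideal_pow I 2 (a * S * T))) => [|a b na nb].
  split=> [|a b ? ?|r a ?].
  - by rewrite !mul0r; apply: ideal0.
  - by rewrite !mulrDl; apply: idealD.
  - by rewrite -!mulrA; apply: idealMl => //; rewrite mulrA.
have {}nb : n b by apply: pow1_min nb; apply: gen_ideal.
have -> : a * b * S * T = (a * S) * (b * T) by ring.
have [aP aQ] := I_nPQ na; have [bP bQ] := I_nPQ nb.
apply: powS_mem; last apply: (@pow1_mem _ I).
  by case: HS => ->.
by case: HT => ->.
Qed.

(** Modulo [z] the ideal [J] is generated by [F], whose derivatives are
    combinations of [P] and [Q], and so is [F] by the Euler relation. *)
Local Lemma line_I_mem f : I f -> gen [:: P; Q; z] f.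
Proof.
have iK := gen_ideal [:: P; Q; z].
have KP : gen [:: P; Q; z] P by apply: gen_mem; rewrite !inE eqxx.
have KQ : gen [:: P; Q; z] Q by apply: gen_mem; rewrite !inE eqxx orbT.
have Kz : gen [:: P; Q; z] z by apply: gen_mem; rewrite !inE eqxx !orbT.
have KF : gen [:: P; Q; z] F.
  have -> : F = (size cs)%:R^-1%:MP * (x * P + y * Q).
    by rewrite -euler mulrA -mpolyCM mulVf ?size_neq0 // mpolyC1 mul1r.
  by apply: idealMl => //; apply: idealD => //; apply: idealMl.
have KdF u : gen [:: P; Q; z] (dd u F).
  by have [a [b ->]] := ddF u; apply: idealD => //; apply: idealMl.
move: f; apply: jac_sub_min => //.
  by move=> f /line_J_mem [a [b ->]]; apply: idealD => //; apply: idealMr.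
move=> u w; apply: (bracket_gen_min (S := fun f => f = F \/ f = z)) => //.
- move=> f /line_J_mem [a [b ->]]; apply: idealD; first exact: span_ideal.
    by apply: idealMr; [exact: span_ideal|apply: span_mem; left].
  by apply: idealMr; [exact: span_ideal|apply: span_mem; right].
- by move=> f [] ->.
have KFz : gen [:: P; Q; z] (bracket u w F z).
  by rewrite /bracket; apply: idealB => //; apply: idealMr.
move=> f g [] -> [] ->; rewrite ?bracketff //; try exact: ideal0.
by rewrite bracketC; apply: idealN.
Qed.

Local Lemma ray_F_e2 : ray e2 F = 'X^(size cs).
Proof.
rewrite /F; elim: (cs) => [|c s IH]; first by rewrite big_nil ray1.
by rewrite big_cons rayM /L rayB rayM rayC !(ray_e2 C) mulr0 subr0 IH exprS.
Qed.

(** [F] is not a zero divisor modulo [z]: the quotient by [z] is a domain,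
    realised as the image of the projection [pr] along [e3], and [F] does not
    vanish at [e2]. *)
Local Lemma z_prime w b : F * w = z * b -> exists b', w = z * b'.
Proof.
have [l El] := form1_linear (coords_formz C).
pose pr : R -> R := mmap (@mpolyC 3 k) (fun i => 'X_i - (e3 0 i)%:MP * z).
have prM f g : pr (f * g) = pr f * pr g by exact: rmorphM.
have prD f g : pr (f + g) = pr f + pr g by exact: rmorphD.
have prC (c : k) : pr c%:MP = c%:MP by rewrite /pr mmapC.
have prX i : pr 'X_i = 'X_i - (e3 0 i)%:MP * z by rewrite /pr mmapX mmap1U.
have pr_sum (G : 'I_3 -> R) : pr (\sum_i G i) = \sum_i pr (G i) by rewrite !sum3 !prD.
have prz : pr z = 0.
  have E : \sum_i l i * e3 0 i = 1.
    have := coords_evalz C 0 0 1; rewrite -e3E El raddf_sum /= => <-.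
    by apply: eq_bigr => i _; rewrite mevalM mevalC mevalXU.
  rewrite {1}El pr_sum.
  transitivity (z - (\sum_i l i * e3 0 i)%:MP * z : R).
    rewrite raddf_sum mulr_suml [X in X - _]El -sumrB /=; apply: eq_bigr => i _.
    by rewrite prM prC prX mpolyCM; ring.
  by rewrite E mpolyC1 mul1r subrr.
have prE f : exists b, f = pr f + z * b.
  elim/mpoly_ring_ind: f => [c|i|f g [a Ha] [c Hc]|f g [a Ha] [c Hc]].
  - by exists 0; rewrite prC mulr0 addr0.
  - by exists (e3 0 i)%:MP; rewrite prX; ring.
  - by exists (a + c); rewrite prD {1}Ha {1}Hc; ring.
  - by exists (pr f * c + pr g * a + z * a * c); rewrite prM {1}Ha {1}Hc; ring.
move=> /(congr1 pr); rewrite !prM prz mul0r => /eqP; rewrite mulf_eq0 => /orP[/eqP F0|/eqP w0].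
  have [a Ea] := prE F; have := ray_F_e2.
  rewrite Ea F0 add0r rayM !(ray_e2 C) mul0r => /eqP.
  by rewrite eq_sym expf_eq0 polyX_eq0 andbF.
by have [a Ea] := prE w; exists a; rewrite {1}Ea w0 add0r.
Qed.

(** The roots of [F] on the line are simple. *)
Local Lemma ray_Q_neq0 c : c \in cs -> ray (e1 + c *: e2) Q != 0.
Proof.
move=> ccs; rewrite /Q /F (big_rem c ccs) /= ddM dL2 mul1r rayD rayM.
have -> : ray (e1 + c *: e2) (L c) = 0.
  by rewrite /L rayB rayM rayC !(ray_e12 C) subrr.
rewrite mul0r addr0.
have : c \notin rem c cs by rewrite mem_rem_uniq // inE eqxx.
elim: (rem c cs) => [|d s IH]; first by rewrite big_nil ray1 oner_neq0.
rewrite in_cons negb_or => /andP[cd /IH cs']; rewrite big_cons rayM mulf_neq0 //.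
rewrite /L rayB rayM rayC !(ray_e12 C) -mulrBl -polyCB mulf_neq0 ?polyX_eq0 //.
by rewrite polyC_eq0 subr_eq0.
Qed.

(** With P = x P1 + y P2 and Q = x Q1 + y Q2, the form h = P1 Q2 - P2 Q1
    generates the socle of k[x, y] / (P, Q): both x h = Q2 P - P2 Q and
    y h = P1 Q - Q1 P lie in (P, Q), while h itself does not. By the Euler
    relation d F h = x h P + y h Q, where d is the degree of F. As soon as
    d >= 4 the P_i and Q_i lie in (x, y)^2, and since I contains (x, y) P and
    (x, y) Q, this makes F h an element of the square of I. If F h were in J I,
    then reducing modulo z and dividing by F would put h in (P, Q). *)
Lemma four_collinear_not_VV : ~ VV_torsion_free J I.
Proof.
move=> VV.
have iN := gen_ideal [:: x; y].
have nL c : n (L c).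
  by apply: idealB; rewrite //; last apply: idealMl => //; apply: gen_mem; rewrite !inE eqxx ?orbT.
have nF : ideal_pow n 4 F.
  apply: (pow_anti cs_size) => //; rewrite /F; elim: (cs) => [|c s IH] //.
  by rewrite big_cons; apply: powS_mem.
have [P1 [P2 [nP1 nP2 EP]]] : exists a b, [/\ ideal_pow n 2 a, ideal_pow n 2 b & P = x * a + y * b].
  by apply: gen_pair; [exact: pow_ideal|exact: (@dd_pow _ _ n e1 3 F iN nF)].
have [Q1 [Q2 [nQ1 nQ2 EQ]]] : exists a b, [/\ ideal_pow n 2 a, ideal_pow n 2 b & Q = x * a + y * b].
  by apply: gen_pair; [exact: pow_ideal|exact: (@dd_pow _ _ n e2 3 F iN nF)].
pose h := P1 * Q2 - P2 * Q1.
have Exh : x * h = Q2 * P - P2 * Q by rewrite EP EQ /h; ring.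
have Eyh : y * h = P1 * Q - Q1 * P by rewrite EP EQ /h; ring.
have d0 := size_neq0.
have [u [v [b Eh]]] : exists u v b, h = u * P + v * Q + z * b.
  have : ideal_mul J (ideal_pow I 1) (F * h).
    apply: (proj1 (VV 2%N isT (F * h))); split.
      exact: (idealMr h (vanish_ideal vs) JF).
    have -> : F * h = (size cs)%:R^-1%:MP *
        (Q2 * P * P - P2 * Q * P + (P1 * Q * Q - Q1 * P * Q)).
      have -> : Q2 * P * P - P2 * Q * P + (P1 * Q * Q - Q1 * P * Q) =
        (size cs)%:R%:MP * F * h.
        by rewrite euler mulrDl -[x * P * h]mulrAC Exh -[y * Q * h]mulrAC Eyh; ring.
      by rewrite !mulrA -mpolyCM mulVf // mpolyC1 mul1r.
    have iP := pow_ideal I 2.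
    by apply: idealMl => //; apply: idealD => //; apply: idealB => //; apply: I2_n2; auto.
  have : forall f, ideal_mul J (ideal_pow I 1) f ->
      exists u v b, f = F * (u * P + v * Q) + z * b.
    apply: mul_min => [|f g /line_J_mem [a [c ->]] Ig].
      split=> [|_ _ [u [v [b ->]]] [u' [v' [b' ->]]]|r _ [u [v [b ->]]]].
      - by exists 0, 0, 0; ring.
      - by exists (u + u'), (v + v'), (b + b'); ring.
      - by exists (r * u), (r * v), (r * b); ring.
    have {}Ig : I g by apply: pow1_min Ig; exact: jac_ideal.
    have [r [_ [[s [_ [[t [_ [-> ->]]] ->]]] ->]]] := line_I_mem Ig.
    by exists (a * r), (a * s), (F * a * t + c * (r * P + (s * Q + (t * z + 0)))); ring.
  move=> H /H [u [v [b E]]].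
  have /z_prime [b' Eb'] : F * (h - (u * P + v * Q)) = z * b by rewrite mulrBr E; ring.
  by exists u, v, b'; rewrite -Eb'; ring.
(* P and Q are coprime modulo z, so the relation alpha P = beta Q makes alpha a
   multiple of Q; concretely, gamma vanishes at the points, hence is a multiple
   theta of F, and d alpha = theta Q; at e2, where x = 0, alpha has the value
   of Q2 and Q that of y Q2, so that for degree reasons Q2 vanishes, then Q, and
   then F by the Euler relation, which it does not *)
pose alpha := Q2 - x * u; pose beta := P2 + x * v.
have Eab : alpha * P = beta * Q + x * z * b.
  have -> : x * z * b = x * h - x * (u * P + v * Q) by rewrite Eh; ring.
  by rewrite Exh /alpha /beta; ring.
pose gamma := alpha * y + beta * x.
have EgQ : (size cs)%:R%:MP * alpha * F = gamma * Q + z * (x * x * b).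
  have -> : (size cs)%:R%:MP * alpha * F = x * (alpha * P) + y * alpha * Q.
    by rewrite mulrAC euler; ring.
  by rewrite Eab /gamma; ring.
have [theta [omega Eg]] : exists a b, gamma = F * a + z * b.
  apply: (collinear_mem C) => // c ccs; apply/eqP.
  have /eqP := congr1 (ray (e1 + c *: e2)) EgQ.
  rewrite rayM (JF (vs_cs ccs)) mulr0 rayD (rayM _ gamma) (rayM _ z) !(ray_e12 C) mul0r addr0.
  by rewrite eq_sym mulf_eq0 (negbTE (ray_Q_neq0 ccs)) orbF.
have EQ2 : ray e2 Q = 'X * ray e2 Q2.
  by rewrite EQ rayD !rayM !(ray_e2 C) mul0r add0r.
have Q20 : ray e2 Q2 = 0.
  have := congr1 (ray e2) EgQ; rewrite Eg /alpha (rayD _ _ (z * _)) !(rayM _ _ F) !(rayM _ z).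
  rewrite !(ray_e2 C) !mul0r addr0 (rayM _ _ Q) (rayD _ (F * _)) !rayM rayC rayB rayM.
  rewrite !(ray_e2 C) !mul0r subr0 addr0 ray_F_e2 EQ2 => /eqP.
  rewrite -subr_eq0.
  have -> : (size cs)%:R%:P * ray e2 Q2 * 'X^(size cs) -
     'X^(size cs) * ray e2 theta * ('X * ray e2 Q2) =
     'X^(size cs) * ray e2 Q2 * ((size cs)%:R%:P - 'X * ray e2 theta) by ring.
  rewrite !mulf_eq0 expf_eq0 polyX_eq0 andbF /= => /orP[/eqP//|/eqP].
  move=> /(congr1 (fun p : {poly k} => p.[0])).
  rewrite hornerD hornerN hornerM hornerC hornerX mul0r subr0 horner0 => /eqP.
  by rewrite (negbTE d0).
have := congr1 (ray e2) euler; rewrite !(rayD, rayM, rayC) !(ray_e2 C) mul0r add0r.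
rewrite EQ2 Q20 !mulr0 ray_F_e2 => /eqP.
by rewrite mulf_eq0 polyC_eq0 (negbTE d0) expf_eq0 polyX_eq0 andbF.
Qed.

End FourCollinear.

(** * Two lines meeting in a point of the configuration *)

Lemma mem_seq5 (T : eqType) (a b c d e g : T) : g \in [:: a; b; c; d; e] ->
  [\/ g \in [:: a; b], g \in [:: c; d] | g = e].
Proof.
by rewrite !inE => /or4P[->|->|->|/orP[->|/eqP]];
  [constructor 1|constructor 1; rewrite orbT|constructor 2|constructor 2; rewrite orbT|constructor 3].
Qed.

Section IrrelevantPower.
Variables (k : fieldType).
Local Notation R := {mpoly k[3]}.

Lemma irr_pow_mul (I : R -> Prop) i j f : (forall g, ideal_pow (@irr k 3) i g -> I g) ->
  ideal_pow (@irr k 3) (i * j) f -> ideal_pow I j f.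
Proof.
move=> H; elim: j f => [//|j IH] f; rewrite mulnS; apply: powD_min.
  exact: pow_ideal.
by move=> a b /H Ia /IH; apply: powS_mem.
Qed.

Lemma irr2_mem (a b : R) : irr a -> irr b -> ideal_pow (@irr k 3) 2 (a * b).
Proof. by move=> ia ib; apply: powS_mem => //; apply: pow1_mem. Qed.

Lemma irr4_mem (a b c d : R) : irr a -> irr b -> irr c -> irr d ->
  ideal_pow (@irr k 3) 4 (a * b * (c * d)).
Proof. by move=> *; apply: (@powD_mem _ _ 2 2); apply: irr2_mem. Qed.

End IrrelevantPower.

Section MeetingInPoint.
Variable k : fieldType.
Local Notation R := {mpoly k[3]}.

(** The configuration is symmetric under the exchange of [x] and [y]; what
    concerns the generators [x ^+ 3], [x ^+ 2 * z] of [I] is done here, and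
    applied twice. *)
Section Half.
Variables (x y z : R) (J I : R -> Prop).
Hypotheses (ix : irr x) (iy : irr y) (iz : irr z).
Hypotheses (Jq : J (x * y)) (Jf : J (x * (z ^+ 2 - x ^+ 2))).
Hypotheses (Ix : I (x ^+ 3)) (Iy : I (y ^+ 3)).
Hypothesis I4 : forall f, ideal_pow (@irr k 3) 4 f -> I f.

Local Lemma Ixs s : ideal_pow I s ((x ^+ 3) ^+ s). Proof. exact: pow_exp. Qed.
Local Lemma Iys s : ideal_pow I s ((y ^+ 3) ^+ s). Proof. exact: pow_exp. Qed.

(** Modulo x (z^2 - x^2), a factor [x] turns the even powers of [z] into powers
    of [x]. *)
Local Lemma xz4 s : exists p, ideal_pow (@irr k 3) (4 * s).+2 p /\
  x * ((z ^+ 4) ^+ s * z ^+ 4) =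
  x * (z ^+ 2 - x ^+ 2) * p + x * ((x ^+ 4) ^+ s * x ^+ 4).
Proof.
have Hz : ideal_pow (@irr k 3) 2 (z ^+ 2 + x ^+ 2).
  by apply: idealD; [exact: pow_ideal|exact: pow_exp|exact: pow_exp].
elim: s => [|s [p [Hp E]]].
  by exists (z ^+ 2 + x ^+ 2); split=> //; ring.
exists (z ^+ 4 * p + ((x ^+ 4) ^+ s * x ^+ 4) * (z ^+ 2 + x ^+ 2)); split.
  apply: idealD; first exact: pow_ideal.
    have -> : ((4 * s.+1).+2 = 4 + (4 * s).+2)%N by lia.
    by apply: powD_mem => //; apply: pow_exp.
  have -> : ((4 * s.+1).+2 = (4 * s + 4) + 2)%N by lia.
  apply: powD_mem => //; apply: powD_mem; last exact: pow_exp.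
  by rewrite -exprM; apply: pow_exp.
rewrite [(z ^+ 4) ^+ s.+1]exprSr [(x ^+ 4) ^+ s.+1]exprSr.
have -> : x * ((z ^+ 4) ^+ s * z ^+ 4 * z ^+ 4) = (x * ((z ^+ 4) ^+ s * z ^+ 4)) * z ^+ 4 by ring.
by rewrite E; ring.
Qed.

(** The products of generators of I and of I^(s+1) that involve [x]. The ideal
    [K] stands for J I^(s+1) plus the chosen generators of I^(s+2): a product
    that contains both [x] and [y] is divisible by x y in J, a [z ^+ 2] next to
    an [x] is replaced by [x ^+ 2], and what remains is a multiple of one of the
    two generators assumed in [K]. *)
Lemma half_step s (K : R -> Prop) : is_ideal K ->
  (forall f, ideal_mul J (ideal_pow I s.+1) f -> K f) ->
  K ((x ^+ 3) ^+ s.+1 * x ^+ 3) -> K ((x ^+ 3) ^+ s.+1 * (x ^+ 2 * z)) ->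
  forall u, u \in [:: x ^+ 3; x ^+ 2 * z] ->
  [/\ forall w, w \in [:: (x ^+ 3) ^+ s * x ^+ 3; (x ^+ 3) ^+ s * (x ^+ 2 * z)] -> K (u * w),
      forall w, w \in [:: (y ^+ 3) ^+ s * y ^+ 3; (y ^+ 3) ^+ s * (y ^+ 2 * z)] -> K (u * w),
      K (u * ((z ^+ 4) ^+ s * z ^+ 4)) &
      K (z ^+ 4 * ((x ^+ 3) ^+ s * u))].
Proof.
move=> iK TK K1 K2 u Hu.
have Kq a : ideal_pow I s.+1 a -> K (x * y * a) by move=> Ha; apply: TK; apply: mul_mem.
have Kf a : ideal_pow I s.+1 a -> K (x * (z ^+ 2 - x ^+ 2) * a).
  by move=> Ha; apply: TK; apply: mul_mem.
have Ix4 a : ideal_pow (@irr k 3) 4 a -> ideal_pow I s.+1 ((x ^+ 3) ^+ s * a).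
  by move=> /I4 Ia; rewrite mulrC; apply: powS_mem => //; apply: Ixs.
have Iy4 a : ideal_pow (@irr k 3) 4 a -> ideal_pow I s.+1 ((y ^+ 3) ^+ s * a).
  by move=> /I4 Ia; rewrite mulrC; apply: powS_mem => //; apply: Iys.
have Hx22 : ideal_pow (@irr k 3) 2 (z ^+ 2 + x ^+ 2).
  by apply: idealD; [exact: pow_ideal|exact: pow_exp|exact: pow_exp].
have [p [Hp Ep]] := xz4 s.
have Kfp a : ideal_pow (@irr k 3) 2 a -> K (x * (z ^+ 2 - x ^+ 2) * (p * a)).
  move=> Ha; apply: Kf; apply: (irr_pow_mul (i := 4)) => //.
  have -> : (4 * s.+1 = (4 * s).+2 + 2)%N by lia.
  exact: powD_mem.
have Ex4 : (x ^+ 4) ^+ s = (x ^+ 3) ^+ s * x ^+ s by rewrite -exprMn -exprSr.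
have I3s : ideal_pow I s.+1 ((x ^+ 3) ^+ s.+1) by apply: pow_exp.
rewrite [(x ^+ 3) ^+ s.+1]exprSr in K1 K2 I3s.
move: Hu; rewrite !inE => /orP[]/eqP ->; split.
- move=> w; rewrite !inE => /orP[]/eqP ->.
    have -> : x ^+ 3 * ((x ^+ 3) ^+ s * x ^+ 3) = (x ^+ 3) ^+ s * x ^+ 3 * x ^+ 3 by ring.
    exact: K1.
  have -> : x ^+ 3 * ((x ^+ 3) ^+ s * (x ^+ 2 * z)) = (x ^+ 3) ^+ s * x ^+ 3 * (x ^+ 2 * z) by ring.
  exact: K2.
- move=> w; rewrite !inE => /orP[]/eqP ->.
    have -> : x ^+ 3 * ((y ^+ 3) ^+ s * y ^+ 3) = x * y * ((y ^+ 3) ^+ s * (x * x * (y * y))) by ring.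
    by apply: Kq; apply: Iy4; apply: irr4_mem.
  have -> : x ^+ 3 * ((y ^+ 3) ^+ s * (y ^+ 2 * z)) = x * y * ((y ^+ 3) ^+ s * (x * x * (y * z))) by ring.
  by apply: Kq; apply: Iy4; apply: irr4_mem.
- have -> : x ^+ 3 * ((z ^+ 4) ^+ s * z ^+ 4) = x ^+ 2 * (x * ((z ^+ 4) ^+ s * z ^+ 4)) by ring.
  rewrite Ep Ex4.
  have -> : x ^+ 2 * (x * (z ^+ 2 - x ^+ 2) * p + x * ((x ^+ 3) ^+ s * x ^+ s * x ^+ 4)) =
    x * (z ^+ 2 - x ^+ 2) * (p * x ^+ 2) + (x ^+ s * x) * ((x ^+ 3) ^+ s * x ^+ 3 * x ^+ 3) by ring.
  apply: (idealD iK); last exact: (idealMl _ iK K1).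
  by apply: Kfp; apply: pow_exp.
- have -> : z ^+ 4 * ((x ^+ 3) ^+ s * x ^+ 3) =
    x * (z ^+ 2 - x ^+ 2) * ((x ^+ 3) ^+ s * (x * x * (z ^+ 2 + x ^+ 2)))
    + x * ((x ^+ 3) ^+ s * x ^+ 3 * x ^+ 3) by ring.
  apply: (idealD iK); last exact: (idealMl _ iK K1).
  by apply: Kf; apply: Ix4; apply: (@powD_mem _ _ 2 2) => //; apply: irr2_mem.
- move=> w; rewrite !inE => /orP[]/eqP ->.
    have -> : x ^+ 2 * z * ((x ^+ 3) ^+ s * x ^+ 3) = (x ^+ 3) ^+ s * x ^+ 3 * (x ^+ 2 * z) by ring.
    exact: K2.
  have -> : x ^+ 2 * z * ((x ^+ 3) ^+ s * (x ^+ 2 * z)) =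
    x * (z ^+ 2 - x ^+ 2) * ((x ^+ 3) ^+ s * x ^+ 3) + (x ^+ 3) ^+ s * x ^+ 3 * x ^+ 3 by ring.
  by apply: (idealD iK); [apply: Kf; exact: I3s|exact: K1].
- move=> w; rewrite !inE => /orP[]/eqP ->.
    have -> : x ^+ 2 * z * ((y ^+ 3) ^+ s * y ^+ 3) = x * y * ((y ^+ 3) ^+ s * (x * z * (y * y))) by ring.
    by apply: Kq; apply: Iy4; apply: irr4_mem.
  have -> : x ^+ 2 * z * ((y ^+ 3) ^+ s * (y ^+ 2 * z)) = x * y * ((y ^+ 3) ^+ s * (x * z * (y * z))) by ring.
  by apply: Kq; apply: Iy4; apply: irr4_mem.
- have -> : x ^+ 2 * z * ((z ^+ 4) ^+ s * z ^+ 4) = x * z * (x * ((z ^+ 4) ^+ s * z ^+ 4)) by ring.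
  rewrite Ep Ex4.
  have -> : x * z * (x * (z ^+ 2 - x ^+ 2) * p + x * ((x ^+ 3) ^+ s * x ^+ s * x ^+ 4)) =
    x * (z ^+ 2 - x ^+ 2) * (p * (x * z)) + (x ^+ s * x) * ((x ^+ 3) ^+ s * x ^+ 3 * (x ^+ 2 * z)) by ring.
  apply: (idealD iK); last exact: (idealMl _ iK K2).
  by apply: Kfp; apply: irr2_mem.
- have -> : z ^+ 4 * ((x ^+ 3) ^+ s * (x ^+ 2 * z)) =
    x * (z ^+ 2 - x ^+ 2) * ((x ^+ 3) ^+ s * (x * z * (z ^+ 2 + x ^+ 2)))
    + x * ((x ^+ 3) ^+ s * x ^+ 3 * (x ^+ 2 * z)) by ring.
  apply: (idealD iK); last exact: (idealMl _ iK K2).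
  by apply: Kf; apply: Ix4; apply: (@powD_mem _ _ 2 2) => //; apply: irr2_mem.
Qed.

End Half.

Lemma uniq_pm : (2%:R : k) != 0 -> uniq [:: 1; -1 : k].
Proof. by rewrite /= !inE andbT -addr_eq0 -mulr2n. Qed.

(** A polynomial vanishing at the two points e3 + e1 and e3 - e1 lies in
    (x^2 - z^2, y), and [x] times either generator is in [J]. *)
Lemma half_final (e1 e2 e3 : 'rV[k]_3) x y z (J I : R -> Prop) s g :
  coords e1 e2 e3 x y z -> (2%:R : k) != 0 ->
  J (x * y) -> J (x * (z ^+ 2 - x ^+ 2)) -> I (x ^+ 3) ->
  ray (e3 + 1 *: e1) g = 0 -> ray (e3 + (-1) *: e1) g = 0 ->
  ideal_mul J (ideal_pow I s) ((x ^+ 3) ^+ s * x ^+ 2 * g).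
Proof.
move=> C n2 Jq Jf Ix g1 g2.
have iT := mul_ideal J (ideal_pow I s).
have Ixs : ideal_pow I s ((x ^+ 3) ^+ s) by exact: pow_exp.
have C' : coords e3 e1 e2 z x y by apply: coords_rot; apply: coords_rot.
have [|c|a [b ->]] := collinear_mem (cs := [:: 1; -1]) (f := g) C'.
- exact: uniq_pm.
- by rewrite !inE => /orP[]/eqP ->.
rewrite !big_cons big_nil mpolyCN mpolyC1.
have -> : (x ^+ 3) ^+ s * x ^+ 2 * ((x - 1 * z) * ((x - -1 * z) * 1) * a + y * b) =
  - ((x * (z ^+ 2 - x ^+ 2)) * ((x ^+ 3) ^+ s)) * (x * a) + (x * y) * ((x ^+ 3) ^+ s) * (x * b) by ring.
apply: idealD => //; apply: idealMr => //; last exact: mul_mem.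
by apply: idealN => //; exact: mul_mem.
Qed.

(** Up to signs and multiples of x y, the minors of x y and x (z^2 - x^2) are
    2 x^2 z and x z^2 - 3 x^3; the latter differs from x (z^2 - x^2) by 2 x^3. *)
Lemma half_jac (e1 e2 e3 : 'rV[k]_3) x y z (J : R -> Prop) :
  coords e1 e2 e3 x y z -> (2%:R : k) != 0 ->
  J (x * y) -> J (x * (z ^+ 2 - x ^+ 2)) ->
  [/\ jac J (x ^+ 3), jac J (x ^+ 2 * z) & jac J (x * z ^+ 2)].
Proof.
move=> C n2 Jq Jf; have iI := jac_ideal J.
have half (f : R) : jac J (2%:R * f) -> jac J f.
  have E2 : (2%:R : R) = (2%:R : k)%:MP by rewrite rmorph_nat.
  move=> If; have -> : f = 2%:R^-1%:MP * (2%:R * f).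
    by rewrite E2 mulrA -mpolyCM mulVf // mpolyC1 mul1r.
  exact: idealMl.
have If := jac_sub Jf.
have I1 : jac J (2%:R * (x ^+ 2 * z)).
  have := jac_bracket e2 e3 Jq Jf; congr (jac J _).
  by rewrite /bracket !(ddM, ddB, expr2) !(coords_dE C); ring.
have I2 : jac J (x * z ^+ 2 - 3%:R * x ^+ 3).
  have := jac_bracket e2 e1 Jq Jf; congr (jac J _).
  by rewrite /bracket !(ddM, ddB, expr2) !(coords_dE C); ring.
have I3 : jac J (x ^+ 3).
  apply: half; have -> : 2%:R * x ^+ 3 =
    x * (z ^+ 2 - x ^+ 2) - (x * z ^+ 2 - 3%:R * x ^+ 3) by ring.
  exact: idealB.
split=> //; first exact: half.
have -> : x * z ^+ 2 = x * (z ^+ 2 - x ^+ 2) + x ^+ 3 by ring.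
exact: idealD.
Qed.

Lemma half_brackets (e1 e2 e3 : 'rV[k]_3) x y z (K : R -> Prop) u w :
  coords e1 e2 e3 x y z -> is_ideal K -> K (x * y) -> K (x * (z ^+ 2 - x ^+ 2)) ->
  K (x ^+ 3) -> K (x ^+ 2 * z) -> K (bracket u w (x * y) (x * (z ^+ 2 - x ^+ 2))).
Proof.
move=> C iK Kq Kf Kx3 Kxz.
apply: (bracket_coords_min C iK); rewrite /bracket !(ddM, ddB, expr2) !(coords_dE C).
- set t := (X in K X); have -> : t = 2%:R * x ^+ 3 - x * (z ^+ 2 - x ^+ 2) by rewrite /t; ring.
  by apply: (idealB iK); [exact: (idealMl _ iK Kx3)|exact: Kf].
- set t := (X in K X); have -> : t = 2%:R * (x ^+ 2 * z) by rewrite /t; ring.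
  exact: (idealMl _ iK Kxz).
- set t := (X in K X); have -> : t = (- 2%:R * z) * (x * y) by rewrite /t; ring.
  exact: (idealMl _ iK Kq).
Qed.

(** The lines y = 0 and x = 0 meet in [e3], the third point on both of them;
    rescaling puts the other points in this position. *)
Section Configuration.
Hypothesis char0 : [pchar k] =i pred0.
Variables (e1 e2 e3 : 'rV[k]_3) (x y z : R).
Hypothesis C : coords e1 e2 e3 x y z.
Variable vs : seq 'rV[k]_3.
Hypothesis vsE : vs =i [:: e3; e3 + 1 *: e1; e3 + (-1) *: e1; e3 + 1 *: e2; e3 + (-1) *: e2].

Let J := vanish vs.
Let I := jac J.
Let q := x * y.
Let f1 := x * (z ^+ 2 - x ^+ 2).
Let f2 := y * (z ^+ 2 - y ^+ 2).

Local Lemma two_neq0 : (2%:R : k) != 0.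
Proof. by rewrite (proj1 (pcharf0P k) char0). Qed.

Let C' : coords e2 e1 e3 y x z := coords_swap C.
Let Cz1 : coords e3 e1 e2 z x y := coords_rot (coords_rot C).
Let Cz2 : coords e3 e2 e1 z y x := coords_rot (coords_rot C').

Local Lemma J_gens : [/\ J q, J f1 & J f2].
Proof.
have H f : ray e3 f = 0 -> (forall c, c ^+ 2 = 1 -> ray (e3 + c *: e1) f = 0) ->
    (forall c, c ^+ 2 = 1 -> ray (e3 + c *: e2) f = 0) -> J f.
  move=> H3 H1 H2 v; rewrite vsE !inE => /or4P[/eqP->//|/eqP->|/eqP->|/orP[]/eqP->];
    by [apply: H1; rewrite ?sqrrN expr1n|apply: H2; rewrite ?sqrrN expr1n].
have E c : c ^+ 2 = 1 -> 'X ^+ 2 - (c%:P * 'X) ^+ 2 = 0 :> {poly k}.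
  by move=> c1; rewrite exprMn -polyC_exp c1 mul1r subrr.
split; apply: H => [|c Hc|c Hc]; rewrite rayM;
  rewrite ?(ray_e3 C) ?(ray_e12 Cz1) ?(ray_e12 Cz2) ?mul0r ?mulr0 //;
  by rewrite rayB !rayXn (ray_e12 Cz1, ray_e12 Cz2) (ray_e12 Cz1, ray_e12 Cz2) E // mulr0.
Qed.

(** On the line x = 0 the element is a multiple of [f2]; the cofactor of [x] in
    the rest vanishes at the two points off this line. *)
Local Lemma J_mem f : J f -> gen [:: q; f1; f2] f.
Proof.
move=> Jf; have uniq3 : uniq [:: 0; 1; -1 : k].
  by rewrite cons_uniq (uniq_pm two_neq0) !inE eq_sym oner_eq0 eq_sym oppr_eq0 oner_eq0.
have inJ v : v \in vs -> ray v f = 0 by move=> /Jf.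
have [c|a [b Ef]] := collinear_mem (f := f) Cz2 uniq3.
  by rewrite !inE => /or3P[]/eqP ->; rewrite ?scale0r ?addr0; apply: inJ; rewrite vsE !inE eqxx ?orbT.
have {}Ef : f = - f2 * a + x * b.
  by rewrite Ef !big_cons big_nil mpolyCN mpolyC1 mpolyC0 /f2; ring.
have [_ _ Jf2] := J_gens.
have [c Hc|a' [b' Eb]] := collinear_mem (f := b) Cz1 (uniq_pm two_neq0).
  have Hv : e3 + c *: e1 \in vs.
    by move: Hc; rewrite vsE !inE => /orP[]/eqP ->; rewrite eqxx ?orbT.
  have := inJ _ Hv; rewrite Ef rayD (rayM _ (- f2)) rayN (Jf2 _ Hv) oppr0 mul0r add0r rayM !(ray_e12 Cz1).
  move=> /eqP; rewrite !mulf_eq0 polyX_eq0 polyC_eq0 orbF.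
  by move: Hc; rewrite !inE => /orP[]/eqP ->; rewrite ?oppr_eq0 oner_eq0 /= => /eqP.
have iK := gen_ideal [:: q; f1; f2].
have -> : f = - f2 * a + (x * (x ^+ 2 - z ^+ 2) * a' + q * b').
  by rewrite Ef Eb !big_cons !big_nil mpolyCN mpolyC1 /q; ring.
have -> : x * (x ^+ 2 - z ^+ 2) = - f1 by rewrite /f1; ring.
apply: idealD; [exact: iK| |apply: idealD; first exact: iK]; apply: idealMr => //;
  rewrite ?(idealN iK) //; try (apply: idealN; first exact: iK); apply: gen_mem;
  by rewrite !inE eqxx ?orbT.
Qed.

Let U := [:: x ^+ 3; x ^+ 2 * z; y ^+ 3; y ^+ 2 * z; z ^+ 4].
Let W s := [:: (x ^+ 3) ^+ s * x ^+ 3; (x ^+ 3) ^+ s * (x ^+ 2 * z);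
   (y ^+ 3) ^+ s * y ^+ 3; (y ^+ 3) ^+ s * (y ^+ 2 * z); (z ^+ 4) ^+ s * z ^+ 4].

Local Lemma I_z4 : I (z ^+ 4).
Proof.
have [Jq Jf1 Jf2] := J_gens; have iI := jac_ideal J.
have Jq' : J (y * x) by rewrite mulrC.
have [Ix3 Ix2z Ixz2] := half_jac C two_neq0 Jq Jf1.
have [Iy3 Iy2z Iyz2] := half_jac C' two_neq0 Jq' Jf2.
have H := jac_bracket e1 e2 Jf1 Jf2.
have -> : z ^+ 4 = bracket e1 e2 f1 f2 + 3%:R * z * (x ^+ 2 * z) + 3%:R * z * (y ^+ 2 * z)
     - 9%:R * x * y * q.
  by rewrite /bracket /f1 /f2 /q !(ddM, ddB, expr2) !(coords_dE C); ring.
apply: (idealB iI); last exact: (idealMl _ iI (jac_sub Jq)).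
apply: (idealD iI); last exact: (idealMl _ iI Iy2z).
by apply: (idealD iI); [exact: H|exact: (idealMl _ iI Ix2z)].
Qed.

Local Lemma I_U u : u \in U -> I u.
Proof.
have [Jq Jf1 Jf2] := J_gens.
have Jq' : J (y * x) by rewrite mulrC.
have [Ix3 Ix2z _] := half_jac C two_neq0 Jq Jf1.
have [Iy3 Iy2z _] := half_jac C' two_neq0 Jq' Jf2.
rewrite !inE => /or4P[/eqP->|/eqP->|/eqP->|/orP[]/eqP->].
- exact: Ix3.
- exact: Ix2z.
- exact: Iy3.
- exact: Iy2z.
- exact: I_z4.
Qed.

(** Splitting off powers of [z] writes a form of degree 4 through the
    generators of [I]. *)
Local Lemma I_irr4 f : ideal_pow (@irr k 3) 4 f -> I f.
Proof.
have [Jq Jf1 Jf2] := J_gens; have iI := jac_ideal J.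
have Jq' : J (y * x) by rewrite mulrC.
have [Ix3 Ix2z Ixz2] := half_jac C two_neq0 Jq Jf1.
have [Iy3 Iy2z Iyz2] := half_jac C' two_neq0 Jq' Jf2.
have Iq : I q := jac_sub Jq.
have H (a : R) : ideal_pow (@irr k 3) 2 a -> I (x * a) /\ I (y * a).
  move=> /(irr_pow_split C) [b [c [d [Hb Hc ->]]]].
  have [r [_ [[r' [_ [[r'' [_ [-> ->]]] ->]]] Eb]]] := irr_gen C (pow1_min (irr_ideal k 3) Hb).
  have [t [_ [[t' [_ [[t'' [_ [-> ->]]] ->]]] Ec]]] := irr_gen C (pow1_min (irr_ideal k 3) Hc).
  rewrite Eb Ec; split.
    have -> : x * (x * (r * x + (r' * y + (r'' * z + 0))) + y * (t * x + (t' * y + (t'' * z + 0))) + d * z ^+ 2) =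
      r * x ^+ 3 + (x * r' + (t * x + (t' * y + t'' * z))) * q + r'' * (x ^+ 2 * z) + d * (x * z ^+ 2).
      by rewrite /q; ring.
    apply: (idealD iI); last exact: (idealMl _ iI Ixz2).
    apply: (idealD iI); last exact: (idealMl _ iI Ix2z).
    by apply: (idealD iI); [exact: (idealMl _ iI Ix3)|exact: (idealMl _ iI Iq)].
  have -> : y * (x * (r * x + (r' * y + (r'' * z + 0))) + y * (t * x + (t' * y + (t'' * z + 0))) + d * z ^+ 2) =
      t' * y ^+ 3 + (y * t + (r * x + (r' * y + r'' * z))) * q + t'' * (y ^+ 2 * z) + d * (y * z ^+ 2).
    by rewrite /q; ring.
  apply: (idealD iI); last exact: (idealMl _ iI Iyz2).
  apply: (idealD iI); last exact: (idealMl _ iI Iy2z).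
  by apply: (idealD iI); [exact: (idealMl _ iI Iy3)|exact: (idealMl _ iI Iq)].
move=> /(irr_pow_split C) [a [b [c [Ha Hb ->]]]].
have [Ia _] := H a (pow_anti (leqnSn 2) (irr_ideal k 3) Ha).
have [_ Ib] := H b (pow_anti (leqnSn 2) (irr_ideal k 3) Hb).
apply: (idealD iI); last exact: (idealMl _ iI I_z4).
by apply: (idealD iI); [exact: Ia|exact: Ib].
Qed.

Local Lemma I_mem f : I f -> gen ([:: q; f1; f2] ++ U) f.
Proof.
set G := _ ++ _; have iG : is_ideal (gen G) by exact: gen_ideal.
have G_ i : (i < 8)%N -> gen G (nth 0 G i) by move=> lt_i; apply: gen_mem; exact: mem_nth.
have Gq : gen G q := G_ 0 isT.
have Gf1 : gen G f1 := G_ 1 isT.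
have Gf2 : gen G f2 := G_ 2 isT.
have Gx3 : gen G (x ^+ 3) := G_ 3 isT.
have Gxz : gen G (x ^+ 2 * z) := G_ 4 isT.
have Gy3 : gen G (y ^+ 3) := G_ 5 isT.
have Gyz : gen G (y ^+ 2 * z) := G_ 6 isT.
have Gz4 : gen G (z ^+ 4) := G_ 7 isT.
have JG g : J g -> gen G g.
  move=> /J_mem; move: g; apply: (gen_min iG) => h.
  by rewrite !inE => /or3P[]/eqP ->; [exact: Gq|exact: Gf1|exact: Gf2].
move: f; apply: (jac_sub_min iG JG) => u w.
have B g h : gen G (bracket e1 e2 g h) -> gen G (bracket e2 e3 g h) ->
    gen G (bracket e3 e1 g h) -> gen G (bracket u w g h).
  by move=> *; apply: (bracket_coords_min C).
have Bq1 : gen G (bracket u w q f1) := half_brackets u w C iG Gq Gf1 Gx3 Gxz.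
have Gq' : gen G (y * x) by rewrite mulrC; exact: Gq.
have Bq2 : gen G (bracket u w q f2).
  rewrite /q [x * y]mulrC; exact: (half_brackets u w C' iG Gq' Gf2 Gy3 Gyz).
have B12 : gen G (bracket u w f1 f2).
  apply: B; rewrite /bracket /f1 /f2 !(ddM, ddB, expr2) !(coords_dE C).
  - set t := (X in gen G X).
    have -> : t = z ^+ 4 - 3%:R * z * (x ^+ 2 * z) - 3%:R * z * (y ^+ 2 * z) + 9%:R * x * y * q.
      by rewrite /t /q; ring.
    apply: (idealD iG); last exact: (idealMl _ iG Gq).
    apply: (idealB iG); last exact: (idealMl _ iG Gyz).
    by apply: (idealB iG); [exact: Gz4|exact: (idealMl _ iG Gxz)].
  - set t := (X in gen G X).
    have -> : t = - (2%:R * z * f1) - (2%:R * z) * x ^+ 3 + 6%:R * y * z * q.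
      by rewrite /t /q /f1; ring.
    apply: (idealD iG); last exact: (idealMl _ iG Gq).
    apply: (idealB iG); last exact: (idealMl _ iG Gx3).
    exact: (idealN iG (idealMl _ iG Gf1)).
  - set t := (X in gen G X).
    have -> : t = - (2%:R * z * f2) - (2%:R * z) * y ^+ 3 + 6%:R * x * z * q.
      by rewrite /t /q /f2; ring.
    apply: (idealD iG); last exact: (idealMl _ iG Gq).
    apply: (idealB iG); last exact: (idealMl _ iG Gy3).
    exact: (idealN iG (idealMl _ iG Gf2)).
exact: (bracket_gen3_min iG J_mem Gq Gf1 Gf2 Bq1 Bq2 B12).
Qed.

Local Lemma W_pow s w : w \in W s -> ideal_pow I s.+1 w.
Proof.
have step e a b : I a -> I b -> ideal_pow I e.+1 (a ^+ e * b).
  by move=> Ia Ib; rewrite mulrC; apply: powS_mem => //; apply: pow_exp.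
have IU i : (i < 5)%N -> I (nth 0 U i) by move=> lt_i; apply: I_U; exact: mem_nth.
rewrite !inE => /or4P[/eqP->|/eqP->|/eqP->|/orP[]/eqP->]; apply: step.
- exact: (IU 0%N).
- exact: (IU 0%N).
- exact: (IU 0%N).
- exact: (IU 1%N).
- exact: (IU 2%N).
- exact: (IU 2%N).
- exact: (IU 2%N).
- exact: (IU 3%N).
- exact: (IU 4%N).
- exact: (IU 4%N).
Qed.

(** By induction on [s], multiplying the five generators of I^(s+1) by those of
    I: [half_step] treats the products involving [x] and, after the exchange of
    [x] and [y], those involving [y]. *)
Local Lemma pow_reduce s f : ideal_pow I s.+1 f ->
  isum (ideal_mul J (ideal_pow I s)) (gen (W s)) f.
Proof.
have [Jq Jf1 Jf2] := J_gens; have iI := jac_ideal J; have iJ := vanish_ideal vs.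
have [ix iy iz] := irr_coords C.
elim: s f => [|s IH] f.
  have iK : is_ideal (isum (ideal_mul J (ideal_pow I 0)) (gen (W 0))).
    by apply: isum_ideal; [exact: mul_ideal|exact: gen_ideal].
  have KJ g : J g -> isum (ideal_mul J (ideal_pow I 0)) (gen (W 0)) g.
    move=> Jg; apply: isuml; first exact: gen_ideal.
    by rewrite -[g]mulr1; apply: mul_mem.
  move=> /(pow1_min iI) /I_mem; move: f; apply: (gen_min iK) => g.
  rewrite mem_cat => /orP[|gU].
    by rewrite !inE => /or3P[]/eqP ->; apply: KJ; [exact: Jq|exact: Jf1|exact: Jf2].
  apply: isumr; first exact: mul_ideal.
  by apply: gen_mem; rewrite /W !expr0 !mul1r; exact: gU.
set T := ideal_mul J (ideal_pow I s.+1); set K := isum T (gen (W s.+1)).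
have iK : is_ideal K by apply: isum_ideal; [exact: mul_ideal|exact: gen_ideal].
have TK g : T g -> K g by apply: isuml; exact: gen_ideal.
have WK g : g \in W s.+1 -> K g.
  by move=> gW; apply: isumr; [exact: mul_ideal|exact: gen_mem].
apply: mul_min => // a b Ia /IH [t [w [Ht Hw ->]]].
rewrite mulrDr; apply: idealD => //.
  by apply: TK; exact: mul_powS_mem.
move: w Hw; apply: (gen_min (colon_idealr a iK)) => w wW.
move: a {Ia} (I_mem Ia); apply: (gen_min (colon_ideall w iK)) => g.
rewrite mem_cat => /orP[gJ|gU].
  apply: TK; apply: mul_mem; last exact: W_pow.
  by move: gJ; rewrite !inE => /or3P[]/eqP ->; [exact: Jq|exact: Jf1|exact: Jf2].
have IU i : (i < 5)%N -> I (nth 0 U i) by move=> lt_i; apply: I_U; exact: mem_nth.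
have Ix3 : I (x ^+ 3) := IU 0%N isT.
have Iy3 : I (y ^+ 3) := IU 2%N isT.
have Jq' : J (y * x) by rewrite mulrC.
have KW i : (i < 5)%N -> K (nth 0 (W s.+1) i) by move=> lt_i; apply: WK; exact: mem_nth.
have Hx u Hu := half_step ix iy iz Jq Jf1 Ix3 Iy3 I_irr4 iK TK (KW 0%N isT) (KW 1%N isT) (u := u) Hu.
have Hy u Hu := half_step iy ix iz Jq' Jf2 Iy3 Ix3 I_irr4 iK TK (KW 2%N isT) (KW 3%N isT) (u := u) Hu.
have UE : [\/ g \in [:: x ^+ 3; x ^+ 2 * z], g \in [:: y ^+ 3; y ^+ 2 * z] | g = z ^+ 4].
  exact: mem_seq5 gU.
have WE : [\/ w \in [:: (x ^+ 3) ^+ s * x ^+ 3; (x ^+ 3) ^+ s * (x ^+ 2 * z)],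
    w \in [:: (y ^+ 3) ^+ s * y ^+ 3; (y ^+ 3) ^+ s * (y ^+ 2 * z)] | w = (z ^+ 4) ^+ s * z ^+ 4].
  exact: mem_seq5 wW.
case: UE => [/Hx[Kx Ky Kz _]|/Hy[Ky Kx Kz _]|Eg].
- by case: WE => [/Kx|/Ky|->].
- by case: WE => [/Kx|/Ky|->].
rewrite Eg; case: WE => [wx|wy|->].
- have [u Hu ->] : exists2 u, u \in [:: x ^+ 3; x ^+ 2 * z] & w = (x ^+ 3) ^+ s * u.
    by move: wx; rewrite !inE => /orP[]/eqP->; [exists (x ^+ 3)|exists (x ^+ 2 * z)];
      rewrite ?mem_head // mem_behead //= mem_head.
  by have [_ _ _] := Hx u Hu.
- have [u Hu ->] : exists2 u, u \in [:: y ^+ 3; y ^+ 2 * z] & w = (y ^+ 3) ^+ s * u.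
    by move: wy; rewrite !inE => /orP[]/eqP->; [exists (y ^+ 3)|exists (y ^+ 2 * z)];
      rewrite ?mem_head // mem_behead //= mem_head.
  by have [_ _ _] := Hy u Hu.
have -> : z ^+ 4 * ((z ^+ 4) ^+ s * z ^+ 4) = (z ^+ 4) ^+ s.+1 * z ^+ 4.
  by rewrite [(z ^+ 4) ^+ s.+1]exprSr; ring.
exact: (KW 4%N isT).
Qed.

(** After the reduction of [f] to the five generators [W s], the coefficient of
    the power of [z] vanishes at [e3], where the other generators vanish; it
    lies in (x, y), and turns that term into multiples of the x-generators and
    of the y-generators modulo J I^s. What is left splits into a part with a
    high power of [x] and one with a high power of [y]. At the two points other
    than [e3] with y = 0 the second part is zero, so the first one vanishes
    there too and [half_final] applies to it; likewise for the second. *)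
Lemma meeting_in_point_VV : VV_torsion_free J I.
Proof.
have [Jq Jf1 Jf2] := J_gens; have iI := jac_ideal J; have iJ := vanish_ideal vs.
have [ix iy iz] := irr_coords C; have n2 := two_neq0.
apply: VV_intro => //; first exact: jac_sub.
case=> [//|s] f _ Jf If /=.
have Jq' : J (y * x) by rewrite mulrC.
have IU i : (i < 5)%N -> I (nth 0 U i) by move=> lt_i; apply: I_U; exact: mem_nth.
have Ix3 : I (x ^+ 3) := IU 0%N isT.
have Iy3 : I (y ^+ 3) := IU 2%N isT.
set T := ideal_mul J (ideal_pow I s); have iT : is_ideal T by exact: mul_ideal.
have TJ g : T g -> J g by apply: (mul_min iJ) => a b Ja _; apply: (idealMr _ iJ Ja).
have [t [w [Ht Hw Ef]]] := pow_reduce If.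
move: Hw Ef => [r1 [_ [[r2 [_ [[r3 [_ [[r4 [_ [[r5 [_ [-> ->]]] ->]]] ->]]] ->]]] ->]]] Ef.
set xs := (x ^+ 3) ^+ s in Ef; set ys := (y ^+ 3) ^+ s in Ef.
(* r5 is the coefficient of the power of z *)
have H5 : ray e3 r5 = 0.
  have e3vs : e3 \in vs by rewrite vsE !inE eqxx.
  have := Jf _ e3vs; rewrite Ef rayD (TJ _ Ht _ e3vs) add0r.
  rewrite !(rayD, rayM) !rayXn !(ray_e3 C) ray0 !expr0n /= !(mul0r, mulr0) !add0r addr0.
  by move=> /eqP; rewrite !mulf_eq0 !expf_eq0 polyX_eq0 !andbF !orbF => /eqP.
have [a [_ [[b [_ [-> ->]]] E5]]] : gen [:: x; y] r5.
  apply: (ray_vanish_mem (a := z)) H5 => [|i]; first exact: gen_ideal.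
  exists (e1 0 i)%:MP, ((e2 0 i)%:MP * y); split; first by exists (e2 0 i)%:MP, 0; rewrite addr0.
  by rewrite (coordsX C); ring.
have T4 p l g : ideal_pow (@irr k 3) (4 * s).+2 p -> J g -> T (l * (g * p)).
  move=> Hp Jg; apply: idealMl => //; apply: mul_mem => //.
  apply: (irr_pow_mul (i := 4) I_irr4); apply: (pow_anti _ (irr_ideal k 3) Hp); lia.
have [p [Hp Ep]] := xz4 ix iz s; have [p' [Hp' Ep']] := xz4 iy iz s.
have Ex : (x ^+ 4) ^+ s = xs * x ^+ s by rewrite -exprMn -exprSr.
have Ey : (y ^+ 4) ^+ s = ys * y ^+ s by rewrite -exprMn -exprSr.
pose gx := (r1 + a * x ^+ s * x ^+ 2) * x + r2 * z.
pose gy := (r3 + b * y ^+ s * y ^+ 2) * y + r4 * z.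
have Ef' : f = t + (a * (f1 * p) + b * (f2 * p')) + (xs * x ^+ 2 * gx + ys * y ^+ 2 * gy).
  rewrite Ef E5.
  have -> : (a * x + (b * y + 0)) * ((z ^+ 4) ^+ s * z ^+ 4) =
    a * (x * ((z ^+ 4) ^+ s * z ^+ 4)) + b * (y * ((z ^+ 4) ^+ s * z ^+ 4)) by ring.
  by rewrite Ep Ep' Ex Ey /f1 /f2 /gx /gy; ring.
have Tt : T (t + (a * (f1 * p) + b * (f2 * p'))).
  by apply: (idealD iT); [exact: Ht|apply: (idealD iT); [exact: (T4 _ _ _ Hp Jf1)|exact: (T4 _ _ _ Hp' Jf2)]].
have Jw : J (xs * x ^+ 2 * gx + ys * y ^+ 2 * gy).
  have -> : xs * x ^+ 2 * gx + ys * y ^+ 2 * gy = f - (t + (a * (f1 * p) + b * (f2 * p'))).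
    by rewrite Ef'; ring.
  by apply: (idealB iJ); [exact: Jf|exact: TJ].
have vx c : c \in [:: 1; -1] -> ray (e3 + c *: e1) gx = 0.
  move=> Hc; have Hv : e3 + c *: e1 \in vs.
    by move: Hc; rewrite vsE !inE => /orP[]/eqP ->; rewrite eqxx ?orbT.
  have := Jw _ Hv; rewrite rayD (rayM _ _ gx) (rayM _ _ gy) (rayM _ xs) (rayM _ ys).
  rewrite (rayXn _ 2 y) !rayXn !(ray_e12 Cz1) !expr0n /= mulr0 mul0r addr0 => /eqP.
  rewrite !mulf_eq0 !expf_eq0 mulf_eq0 polyX_eq0 polyC_eq0 orbF.
  by move: Hc; rewrite !inE => /orP[]/eqP ->; rewrite ?oppr_eq0 oner_eq0 !andbF /= => /eqP.
have vy c : c \in [:: 1; -1] -> ray (e3 + c *: e2) gy = 0.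
  move=> Hc; have Hv : e3 + c *: e2 \in vs.
    by move: Hc; rewrite vsE !inE => /orP[]/eqP ->; rewrite eqxx ?orbT.
  have := Jw _ Hv; rewrite rayD (rayM _ _ gx) (rayM _ _ gy) (rayM _ xs) (rayM _ ys).
  rewrite (rayXn _ 2 x) !rayXn !(ray_e12 Cz2) !expr0n /= mulr0 mul0r add0r => /eqP.
  rewrite !mulf_eq0 !expf_eq0 mulf_eq0 polyX_eq0 polyC_eq0 orbF.
  by move: Hc; rewrite !inE => /orP[]/eqP ->; rewrite ?oppr_eq0 oner_eq0 !andbF /= => /eqP.
have pm c : c = 1 \/ c = -1 -> c \in [:: 1; -1 : k] by move=> [] ->; rewrite !inE eqxx ?orbT.
rewrite Ef'; apply: (idealD iT); first exact: Tt.
apply: (idealD iT).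
  exact: (half_final s C n2 Jq Jf1 Ix3 (vx _ (pm _ (or_introl erefl))) (vx _ (pm _ (or_intror erefl)))).
exact: (half_final s C' n2 Jq' Jf2 Iy3 (vy _ (pm _ (or_introl erefl))) (vy _ (pm _ (or_intror erefl)))).
Qed.

End Configuration.
End MeetingInPoint.

(** * Two lines meeting outside the configuration *)

Section MeetingOutside.
Variable k : fieldType.
Local Notation R := {mpoly k[3]}.
Local Notation irr := (@irr k 3).

Lemma formXn d e (f : R) : form d f -> form (d * e) (f ^+ e).
Proof.
move=> Hf; elim: e => [|e IH]; first by rewrite muln0 expr0 -mpolyC1; apply: formC.
by rewrite mulnS exprS; apply: formM; [exact: Hf|exact: IH].
Qed.

(** Take a product of elements of orders 3 and 3 j + 1: by induction the latter
    leaves over a factor in the irrelevant ideal, which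
    raises the order of the former to 4, and the hypothesis gives it back. *)
Lemma irr_pow_sub (I : R -> Prop) :
  (forall f, ideal_pow irr 4 f -> ideal_mul irr (fun g => I g /\ ideal_pow irr 3 g) f) ->
  forall j f, ideal_pow irr (3 * j).+1 f -> ideal_mul irr (ideal_pow I j) f.
Proof.
move=> H; elim=> [|j IH] f.
  rewrite muln0; apply: mul_min; first exact: mul_ideal.
  by move=> a b ia _; exact: mul_mem.
have iK : is_ideal (ideal_mul irr (ideal_pow I j.+1)) by exact: mul_ideal.
have -> : ((3 * j.+1).+1 = 3 + (3 * j).+1)%N by lia.
move: f; apply: (powD_min iK) => a c Ha /IH; move: c.
apply: (mul_min (colon_idealr a iK)) => u w iu Iw.
have /H : ideal_pow irr 4 (u * a) by apply: powS_mem.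
rewrite mulrA [a * u]mulrC; move: (u * a).
apply: (mul_min (colon_ideall w iK)) => u' g iu' [Ig _].
by rewrite -mulrA; apply: mul_mem => //; apply: powS_mem.
Qed.

Section Irr4.
Variables (e1 e2 e3 : 'rV[k]_3) (x y z : R).
Hypothesis C : coords e1 e2 e3 x y z.
Variables (p r : k).
Hypothesis disc : 4%:R * p ^+ 3 + 27%:R * r ^+ 2 != 0.
Hypothesis three_neq0 : (3%:R : k) != 0.
Let A : R := z ^+ 3 + p%:MP * z * y ^+ 2 + r%:MP * y ^+ 3.
Let a : R := 2%:R * p%:MP * z * y + 3%:R * r%:MP * y ^+ 2.
Let b : R := 3%:R * z ^+ 2 + p%:MP * y ^+ 2.
Variable K : R -> Prop.
Hypotheses (iK : is_ideal K) (Kq : K (x * y)) (Kx3 : K (x ^+ 3))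
  (Kxxz : K (x ^+ 2 * z)) (Kxzz : K (x * z ^+ 2)) (Kya : K (y * a)) (Kyb : K (y * b))
  (KA : K A).

(** The discriminant of the binary cubic [A] is, up to a constant, the
    resultant of its partial derivatives [a], [b]. When it is nonzero, the
    products of y a, y b by y and z span the quartics in y, z divisible by y;
    z A adds z^4, and the quartics divisible by x come from the other
    generators. Each of these products is an element of the irrelevant ideal
    times one of K of order 3. *)
Lemma irr4_cubic f : ideal_pow irr 4 f -> ideal_mul irr (fun g => K g /\ ideal_pow irr 3 g) f.
Proof.
have [ix iy iz] := irr_coords C.
set S := ideal_mul irr _; have iS : is_ideal S by exact: mul_ideal.
have i2 (u v : R) : irr u -> irr v -> ideal_pow irr 2 (u * v) by apply: irr2_mem.
have P2 := pow_ideal irr 2; have P3 := pow_ideal irr 3.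
have i22 (u : R) : irr u -> ideal_pow irr 2 (u ^+ 2) by apply: pow_exp.
have i33 (u : R) : irr u -> ideal_pow irr 3 (u ^+ 3) by apply: pow_exp.
have ia : ideal_pow irr 2 a.
  apply: (idealD P2); last exact: (idealMl _ P2 (i22 _ iy)).
  by rewrite -mulrA; apply: (idealMl _ P2 (i2 _ _ iz iy)).
have ib : ideal_pow irr 2 b.
  by apply: (idealD P2); [exact: (idealMl _ P2 (i22 _ iz))|exact: (idealMl _ P2 (i22 _ iy))].
have iA : ideal_pow irr 3 A.
  apply: (idealD P3); last exact: (idealMl _ P3 (i33 _ iy)).
  apply: (idealD P3); first exact: i33.
  by rewrite -mulrA; apply: (idealMl _ P3); apply: powS_mem iz (i22 _ iy).
have Kx h : ideal_pow irr 2 h -> K (x * h).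
  move=> /(irr_pow_split C) [u [v [w [Hu Hv ->]]]].
  have [s1 [_ [[s2 [_ [[s3 [_ [-> ->]]] ->]]] Eu]]] := irr_gen C (pow1_min (irr_ideal k 3) Hu).
  have -> : x * (x * u + y * v + w * z ^+ 2) =
    s1 * x ^+ 3 + (s2 * x + v) * (x * y) + s3 * (x ^+ 2 * z) + w * (x * z ^+ 2).
    by rewrite Eu; ring.
  apply: (idealD iK); last exact: (idealMl _ iK Kxzz).
  apply: (idealD iK); last exact: (idealMl _ iK Kxxz).
  by apply: (idealD iK); [exact: (idealMl _ iK Kx3)|exact: (idealMl _ iK Kq)].
have Sx u h : irr u -> ideal_pow irr 2 h -> S (u * (x * h)).
  move=> iu ih; apply: mul_mem => //; split; [exact: Kx|exact: powS_mem].
have Sya u : irr u -> S (u * (y * a)).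
  by move=> iu; apply: mul_mem => //; split; [exact: Kya|exact: powS_mem].
have Syb u : irr u -> S (u * (y * b)).
  by move=> iu; apply: mul_mem => //; split; [exact: Kyb|exact: powS_mem].
have inv (c : k) g : c != 0 -> S (c%:MP * g) -> S g.
  move=> c0 Sg; have -> : g = c^-1%:MP * (c%:MP * g).
    by rewrite mulrA -mpolyCM mulVf // mpolyC1 mul1r.
  exact: idealMl.
have E2 : (2%:R : R) = (2%:R : k)%:MP by rewrite rmorph_nat.
have E3 : (3%:R : R) = (3%:R : k)%:MP by rewrite rmorph_nat.
pose D0 := y * (y * a); pose D1 := 3%:R * (z * (y * a)) - 2%:R * p%:MP * (y * (y * b)).
have SD0 : S D0 by exact: Sya.
have SD1 : S D1 by apply: (idealB iS); apply: (idealMl _ iS); [exact: Sya|exact: Syb].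
have ED : (4%:R * p ^+ 3 + 27%:R * r ^+ 2)%:MP = 4%:R * p%:MP ^+ 3 + 27%:R * r%:MP ^+ 2 :> R.
  by rewrite !exprS !expr0; ring.
have Sy4 : S (y ^+ 4).
  apply: (inv _ _ disc); rewrite ED.
  have -> : (4%:R * p%:MP ^+ 3 + 27%:R * r%:MP ^+ 2) * y ^+ 4 =
    9%:R * r%:MP * D0 - 2%:R * p%:MP * D1 by rewrite /D0 /D1 /a /b; ring.
  by apply: (idealB iS); apply: (idealMl _ iS).
have Szy3 : S (z * y ^+ 3).
  apply: (inv _ _ disc); rewrite ED.
  have -> : (4%:R * p%:MP ^+ 3 + 27%:R * r%:MP ^+ 2) * (z * y ^+ 3) =
    2%:R * p%:MP ^+ 2 * D0 + 3%:R * r%:MP * D1 by rewrite /D0 /D1 /a /b; ring.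
  by apply: (idealD iS); apply: (idealMl _ iS).
have Szzyy : S (z ^+ 2 * y ^+ 2).
  apply: (inv _ _ three_neq0); rewrite -E3.
  have -> : 3%:R * (z ^+ 2 * y ^+ 2) = y * (y * b) - p%:MP * y ^+ 4 by rewrite /b; ring.
  by apply: (idealB iS); [exact: Syb|apply: (idealMl _ iS)].
have Sz3y : S (z ^+ 3 * y).
  apply: (inv _ _ three_neq0); rewrite -E3.
  have -> : 3%:R * (z ^+ 3 * y) = z * (y * b) - p%:MP * (z * y ^+ 3) by rewrite /b; ring.
  by apply: (idealB iS); [exact: Syb|apply: (idealMl _ iS)].
have Sz4 : S (z ^+ 4).
  have -> : z ^+ 4 = z * A - p%:MP * (z ^+ 2 * y ^+ 2) - r%:MP * (z * y ^+ 3) by rewrite /A; ring.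
  apply: (idealB iS); last exact: (idealMl _ iS Szy3).
  by apply: (idealB iS); [apply: mul_mem|exact: (idealMl _ iS Szzyy)].
have Sx3 h : ideal_pow irr 3 h -> S (x * h).
  move: h; apply: mul_min => [|u h iu ih]; first exact: colon_idealr.
  by rewrite mulrCA; apply: Sx.
have Sy3 h : ideal_pow irr 3 h -> S (y * h).
  move=> /(irr_pow_split C) [u [v [w [Hu Hv ->]]]].
  have [u1 [v1 [w1 [Hu1 Hv1 Ev]]]] := irr_pow_split C Hv.
  have [s1 [_ [[s2 [_ [[s3 [_ [-> ->]]] ->]]] Ev1]]] := irr_gen C (pow1_min (irr_ideal k 3) Hv1).
  have -> : y * (x * u + y * v + w * z ^+ 3) =
    y * (x * u) + y * (x * (y * u1)) + s1 * (y * (x * (y * y)))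
     + s2 * y ^+ 4 + s3 * (z * y ^+ 3) + w1 * (z ^+ 2 * y ^+ 2) + w * (z ^+ 3 * y).
    by rewrite Ev Ev1; ring.
  have Sq : S (s1 * (y * (x * (y * y)))).
    by apply: (idealMl _ iS); apply: Sx; [exact: iy|exact: i2].
  apply: (idealD iS); last exact: (idealMl _ iS Sz3y).
  apply: (idealD iS); last exact: (idealMl _ iS Szzyy).
  apply: (idealD iS); last exact: (idealMl _ iS Szy3).
  apply: (idealD iS); last exact: (idealMl _ iS Sy4).
  apply: (idealD iS); last exact: Sq.
  apply: (idealD iS); first exact: Sx.
  by apply: Sx => //; apply: i2 => //; apply: (pow1_min (irr_ideal k 3) Hu1).
move=> /(irr_pow_split C) [u [v [w [Hu Hv ->]]]].
apply: (idealD iS); last exact: (idealMl _ iS Sz4).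
by apply: (idealD iS); [exact: Sx3|exact: Sy3].
Qed.

End Irr4.

(** The value of a combination of the generators [W] below at a point of the
    line x = 0, where Y = - c B: the factor that remains is quadratic in c. *)
Local Lemma eval_on_cubic (v : 'I_3 -> k) (r1 r2 r3 r4 r5 : k) (X X' Y B : R) s (c d : k) :
  X.@[v] = 0 -> Y.@[v] = - (c * d) -> B.@[v] = d ->
  (r1%:MP * (X ^+ s.+1 * X) + r2%:MP * (X ^+ s.+1 * X') + r3%:MP * (B ^+ s.+1 * Y) +
   r4%:MP * (B ^+ s.+1 * B) + r5%:MP * (B ^+ s * Y ^+ 2)).@[v] =
  d ^+ s.+2 * (r5 * c ^+ 2 - r3 * c + r4).
Proof.
rewrite !(mevalD, mevalM, mevalC, rmorphXn) /= => -> -> ->.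
by rewrite [0 ^+ s.+1]expr0n /= !mul0r !mulr0 !add0r !exprS; ring.
Qed.

(** The line y = 0 carries two of the points and the line x = 0 the other
    three; they meet in [e3], which is not one of the points. *)
Section Configuration.
Hypothesis char0 : [pchar k] =i pred0.
Variables (e1 e2 e3 : 'rV[k]_3) (x y z : R).
Hypothesis C : coords e1 e2 e3 x y z.
Variables (c1 c2 c3 : k).
Hypotheses (c_uniq : uniq [:: c1; c2; c3]) (c_sum : c1 + c2 + c3 = 0).
Variable vs : seq 'rV[k]_3.
Hypothesis vsE : vs =i [:: e1 + 1 *: e3; e1 + (-1) *: e3;
  e2 + c1 *: e3; e2 + c2 *: e3; e2 + c3 *: e3].

(* the coefficients of the cubic whose roots are the c_i, depressed because of
   the normalisation c_sum *)
Let p := c1 * c2 + c1 * c3 + c2 * c3.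
Let r := - (c1 * c2 * c3).
Let A : R := z ^+ 3 + p%:MP * z * y ^+ 2 + r%:MP * y ^+ 3.
Let a : R := 2%:R * p%:MP * z * y + 3%:R * r%:MP * y ^+ 2.
Let b : R := 3%:R * z ^+ 2 + p%:MP * y ^+ 2.

Let J := vanish vs.
Let I := jac J.
Let q := x * y.
Let f1 := x * (z ^+ 2 - x ^+ 2).
Let f2 := A - x ^+ 2 * z.

Let natk_neq0 m : (m.+1%:R : k) != 0.
Proof. by rewrite (proj1 (pcharf0P k) char0). Qed.

Let Cy : coords e1 e3 e2 x z y := coords_swap (coords_rot (coords_rot C)) .
Let Cx : coords e2 e3 e1 y z x := coords_rot C.

Let c3E : c3 = - c1 - c2.
Proof. by rewrite -(addrK (c1 + c2) c3) [c3 + _]addrC c_sum; ring. Qed.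

Local Lemma cubic_prod : \prod_(c <- [:: c1; c2; c3]) (z - c%:MP * y) = A.
Proof. by rewrite !big_cons big_nil /A /p /r c3E; ring. Qed.

Local Lemma cubic_root c : c \in [:: c1; c2; c3] -> c ^+ 3 + p * c + r = 0.
Proof.
by rewrite !inE => /or3P[]/eqP->; rewrite /p /r c3E; ring.
Qed.

Local Lemma cubic_disc : 4%:R * p ^+ 3 + 27%:R * r ^+ 2 != 0.
Proof.
have -> : 4%:R * p ^+ 3 + 27%:R * r ^+ 2 = - ((c1 - c2) * (c1 - c3) * (c2 - c3)) ^+ 2.
  by rewrite /p /r c3E; ring.
rewrite oppr_eq0 expf_eq0 /= !mulf_eq0 !subr_eq0.
by move: c_uniq; rewrite /= !inE !negb_or !andbT => /andP[/andP[/negbTE-> /negbTE->] /negbTE->].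
Qed.

Local Lemma cubic_deriv_neq0 c : c \in [:: c1; c2; c3] -> 3%:R * c ^+ 2 + p != 0.
Proof.
move: c_uniq; rewrite /= !inE !negb_or !andbT => /andP[/andP[n12 n13] n23].
move=> /or3P[]/eqP->.
- have -> : 3%:R * c1 ^+ 2 + p = (c1 - c2) * (c1 - c3) by rewrite /p c3E; ring.
  by rewrite mulf_neq0 // subr_eq0.
- have -> : 3%:R * c2 ^+ 2 + p = (c2 - c1) * (c2 - c3) by rewrite /p c3E; ring.
  by rewrite mulf_neq0 // subr_eq0 // eq_sym.
- have -> : 3%:R * c3 ^+ 2 + p = (c3 - c1) * (c3 - c2) by rewrite /p c3E; ring.
  by rewrite mulf_neq0 // subr_eq0 // eq_sym.
Qed.

Local Lemma two_lines_J f : J f <->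
  (forall c, c \in [:: 1; -1] -> ray (e1 + c *: e3) f = 0) /\
  (forall c, c \in [:: c1; c2; c3] -> ray (e2 + c *: e3) f = 0).
Proof.
split=> [Jf|[H1 H2] v].
  by split=> c; rewrite !inE; [case/orP|case/or3P] => /eqP ->; apply: Jf;
    rewrite vsE !inE eqxx ?orbT.
rewrite vsE !inE => /or4P[/eqP->|/eqP->|/eqP->|/orP[]/eqP->];
  by [apply: H1; rewrite !inE eqxx ?orbT|apply: H2; rewrite !inE eqxx ?orbT].
Qed.

Local Lemma two_lines_gens : [/\ J q, J f1 & J f2].
Proof.
have pmE c : c \in [:: 1; -1 : k] -> c ^+ 2 = 1.
  by rewrite !inE => /orP[]/eqP->; rewrite ?sqrrN expr1n.
have E c (X : {poly k}) : c ^+ 2 = 1 -> (c%:P * X) ^+ 2 - X ^+ 2 = 0.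
  by move=> c1'; rewrite exprMn -polyC_exp c1' mul1r subrr.
split; apply/two_lines_J; split=> c Hc.
- by rewrite rayM !(ray_e12 Cy) mulr0.
- by rewrite rayM !(ray_e12 Cx) mul0r.
- by rewrite rayM rayB !rayXn !(ray_e12 Cy) E ?mulr0 ?pmE.
- by rewrite rayM !(ray_e12 Cx) mul0r.
- rewrite /f2 /A !(rayB, rayD, rayM, rayXn, rayC, ray_e12 Cy) !expr0n /= !mulr0 !addr0.
  have -> : (c%:P * 'X) ^+ 3 - 'X ^+ 2 * (c%:P * 'X) = ((c%:P * 'X) ^+ 2 - 'X ^+ 2) * (c%:P * 'X) :> {poly k}.
    by ring.
  by rewrite E ?mul0r ?pmE.
- rewrite /f2 /A !(rayB, rayD, rayM, rayXn, rayC, ray_e12 Cx) expr0n /= mul0r subr0.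
  have -> : (c%:P * 'X) ^+ 3 + p%:P * (c%:P * 'X) * 'X ^+ 2 + r%:P * 'X ^+ 3 =
    (c ^+ 3 + p * c + r)%:P * 'X ^+ 3 :> {poly k} by ring.
  by rewrite cubic_root // polyC0 mul0r.
Qed.

Local Lemma two_lines_mem f : J f -> gen [:: q; f1; f2] f.
Proof.
move=> Jf; have [Jq Jf1 Jf2] := two_lines_gens.
have [H1 H2] := proj1 (two_lines_J f) Jf.
have [g [h]] := collinear_mem Cx c_uniq H2; rewrite cubic_prod => Ef.
pose h' := h + x * z * g.
have {}Ef : f = g * f2 + x * h' by rewrite Ef /f2 /h'; ring.
have [c Hc|g' [h'' Eh]] := collinear_mem (f := h') Cy (uniq_pm (natk_neq0 1)).
  have := H1 c Hc; rewrite Ef rayD 2!rayM.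
  rewrite (proj1 (proj1 (two_lines_J f2) Jf2) c Hc) mulr0 add0r (ray_e12 Cy).
  by move=> /eqP; rewrite mulf_eq0 polyX_eq0 => /eqP.
exists h'', (g' * f1 + (g * f2 + 0)); split.
  by exists g', (g * f2 + 0); split=> //; exists g, 0.
rewrite Ef Eh !big_cons big_nil mpolyCN mpolyC1 /f1 /q; ring.
Qed.

Let ya := y * a.
Let yb := y * b.

Local Lemma two_lines_dd : [/\ dd e1 f2 = - (2%:R * x * z), dd e2 f2 = a & dd e3 f2 = b - x ^+ 2].
Proof.
have E : f2 = z * (z * z) + p%:MP * (z * (y * y)) + r%:MP * (y * (y * y)) - x * x * z.
  by rewrite /f2 /A; ring.
by split; rewrite E ddB !ddD !ddCM !ddM !(coords_dE C) /a /b; ring.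
Qed.

Local Lemma two_lines_jac : [/\ I (x ^+ 3), I (x ^+ 2 * z), I (x * z ^+ 2), I ya & I yb].
Proof.
have [Jq Jf1 Jf2] := two_lines_gens; have iI := jac_ideal J.
have [Ix3 Ix2z Ixz2] := half_jac C (natk_neq0 1) Jq Jf1.
have [d1 d2 d3] := two_lines_dd; have Iq : I q := jac_sub Jq.
split; [exact: Ix3|exact: Ix2z|exact: Ixz2| |].
  have -> : ya = bracket e1 e2 q f2 - 2%:R * (x ^+ 2 * z).
    by rewrite /bracket d1 d2 /q !ddM !(coords_dE C) /ya; ring.
  apply: (idealB iI); last exact: (idealMl _ iI Ix2z).
  exact: (jac_bracket e1 e2 Jq Jf2).
have -> : yb = bracket e1 e3 q f2 + x * q.
  by rewrite /bracket d1 d3 /q !ddM !(coords_dE C) /yb; ring.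
by apply: (idealD iI); [exact: (jac_bracket e1 e3 Jq Jf2)|exact: (idealMl _ iI Iq)].
Qed.

Local Lemma two_lines_irr4 f : ideal_pow irr 4 f ->
  ideal_mul irr (fun g => I g /\ ideal_pow irr 3 g) f.
Proof.
have [Jq Jf1 Jf2] := two_lines_gens; have iI := jac_ideal J.
have [Ix3 Ix2z Ixz2 Iya Iyb] := two_lines_jac.
have IA : I A.
  have -> : A = f2 + x ^+ 2 * z by rewrite /f2; ring.
  by apply: (idealD iI); [exact: jac_sub|exact: Ix2z].
exact: (irr4_cubic C cubic_disc (natk_neq0 2) iI (jac_sub Jq) Ix3 Ix2z Ixz2 Iya Iyb IA).
Qed.

Local Lemma two_lines_pow j f : ideal_pow irr (3 * j).+1 f -> ideal_pow I j f.
Proof.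
move=> /(irr_pow_sub two_lines_irr4); move: f; apply: (mul_min (pow_ideal I j)) => u w _ Iw.
exact: (idealMl _ (pow_ideal I j) Iw).
Qed.

Let U := [:: x ^+ 3; x ^+ 2 * z; ya; yb].

Local Lemma two_lines_mem_jac f : I f -> gen ([:: q; f1; f2] ++ U) f.
Proof.
set G := _ ++ _; have iG : is_ideal (gen G) by exact: gen_ideal.
have G_ i : (i < 7)%N -> gen G (nth 0 G i) by move=> lt_i; apply: gen_mem; exact: mem_nth.
have Gq : gen G q := G_ 0%N isT.
have Gf1 : gen G f1 := G_ 1%N isT.
have Gf2 : gen G f2 := G_ 2%N isT.
have Gx3 : gen G (x ^+ 3) := G_ 3%N isT.
have Gxz : gen G (x ^+ 2 * z) := G_ 4%N isT.
have Gya : gen G ya := G_ 5%N isT.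
have Gyb : gen G yb := G_ 6%N isT.
have Gxzz : gen G (x * z ^+ 2).
  have -> : x * z ^+ 2 = f1 + x ^+ 3 by rewrite /f1; ring.
  by apply: (idealD iG); [exact: Gf1|exact: Gx3].
have GA : gen G A.
  have -> : A = f2 + x ^+ 2 * z by rewrite /f2; ring.
  by apply: (idealD iG); [exact: Gf2|exact: Gxz].
have G4 g : ideal_pow irr 4 g -> gen G g.
  move=> /(irr4_cubic C cubic_disc (natk_neq0 2) iG Gq Gx3 Gxz Gxzz Gya Gyb GA).
  by move: g; apply: (mul_min iG) => u w _ [Gw _]; exact: (idealMl _ iG Gw).
have JG g : J g -> gen G g.
  move=> /two_lines_mem; move: g; apply: (gen_min iG) => h.
  by rewrite !inE => /or3P[]/eqP ->; [exact: Gq|exact: Gf1|exact: Gf2].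
move: f; apply: (jac_sub_min iG JG) => u w.
have [d1 d2 d3] := two_lines_dd.
have B g h : gen G (bracket e1 e2 g h) -> gen G (bracket e2 e3 g h) ->
    gen G (bracket e3 e1 g h) -> gen G (bracket u w g h).
  by move=> *; apply: (bracket_coords_min C).
have Bq1 : gen G (bracket u w q f1) := half_brackets u w C iG Gq Gf1 Gx3 Gxz.
have Bq2 : gen G (bracket u w q f2).
  apply: B; rewrite /bracket ?d1 ?d2 ?d3 /q !ddM !(coords_dE C).
  - set t := (X in gen G X); have -> : t = ya + 2%:R * (x ^+ 2 * z) by rewrite /t /ya; ring.
    by apply: (idealD iG); [exact: Gya|exact: (idealMl _ iG Gxz)].
  - set t := (X in gen G X).
    have -> : t = 3%:R * f1 + 2%:R * x ^+ 3 + (p%:MP * y) * q by rewrite /t /q /f1 /b; ring.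
    apply: (idealD iG); last exact: (idealMl _ iG Gq).
    by apply: (idealD iG); [exact: (idealMl _ iG Gf1)|exact: (idealMl _ iG Gx3)].
  - set t := (X in gen G X); have -> : t = x * q - yb by rewrite /t /q /yb; ring.
    by apply: (idealB iG); [exact: (idealMl _ iG Gq)|exact: Gyb].
have [ix iy iz] := irr_coords C.
have i3 : is_ideal (ideal_pow irr 3) by exact: pow_ideal.
have if1 : ideal_pow irr 3 f1.
  have -> : f1 = x * (z * z) - x ^+ 3 by rewrite /f1; ring.
  apply: (idealB i3); last exact: pow_exp.
  by apply: powS_mem ix _; apply: irr2_mem.
have if2 : ideal_pow irr 3 f2.
  have -> : f2 = z ^+ 3 + p%:MP * (z * (y * y)) + r%:MP * y ^+ 3 - z * (x * x) by rewrite /f2 /A; ring.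
  apply: (idealB i3); last by apply: powS_mem iz _; apply: irr2_mem.
  apply: (idealD i3); last by apply: (idealMl _ i3); apply: pow_exp.
  apply: (idealD i3); first exact: pow_exp.
  by apply: (idealMl _ i3); apply: powS_mem iz _; apply: irr2_mem.
have B12 : gen G (bracket u w f1 f2).
  have iirr := irr_ideal k 3.
  have D v g : ideal_pow irr 3 g -> ideal_pow irr 2 (dd v g) by apply: (@dd_pow _ _ irr v 2 g iirr).
  apply: G4; apply: (idealB (pow_ideal irr 4)); apply: (@powD_mem _ _ 2 2); exact: D.
exact: (bracket_gen3_min iG two_lines_mem Gq Gf1 Gf2 Bq1 Bq2 B12).
Qed.

(* for s = 0 the truncated predecessor turns the last entry into ya ^+ 2, a
   multiple of the third *)
Let W s := [:: (x ^+ 3) ^+ s * x ^+ 3; (x ^+ 3) ^+ s * (x ^+ 2 * z);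
  yb ^+ s * ya; yb ^+ s * yb; yb ^+ s.-1 * ya ^+ 2].

Let w2 := 6%:R * ya ^+ 2 + 2%:R * p%:MP * yb ^+ 2 - 9%:R * A * ya.
Let v2 := 6%:R * ((x * z * a) * ya) + 2%:R * p%:MP * ((x * z * b) * yb) - 9%:R * A * (x * z * a).

(** At the three points a = - c b, so that a^3 + p a b^2 - r b^3 vanishes there
    and is a multiple of [A]. Multiplied by y^3 its cofactor becomes [w2], in
    the square of the Jacobian ideal. As A = f2 + x^2 z, the extra term is a
    multiple of q = x y. The consequence is that (y a)^3 may be replaced by
    products with more factors y b, modulo J times a power of I. *)
Local Lemma cubic_relation :
  ya ^+ 3 = f2 * w2 + q * v2 + yb * (r%:MP * yb ^+ 2 - p%:MP * yb * ya).
Proof. by rewrite /w2 /v2 /ya /yb /f2 /q /a /b /A; ring. Qed.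

Local Lemma two_lines_W_pow s w : w \in W s -> ideal_pow I s.+1 w.
Proof.
have [Ix3 Ix2z _ Iya Iyb] := two_lines_jac; have iI := jac_ideal J.
have step e g h : I g -> I h -> ideal_pow I e.+1 (g ^+ e * h).
  by move=> Ig Ih; rewrite mulrC; apply: powS_mem; [exact: Ih|apply: pow_exp; exact: Ig].
rewrite !inE => /or4P[/eqP->|/eqP->|/eqP->|/orP[]/eqP->].
- exact: step.
- exact: step.
- exact: step.
- exact: step.
case: s => [|s] /=.
  2: have := powD_mem (pow_exp s Iyb) (pow_exp 2 Iya); rewrite addn2; exact.
rewrite expr0 mul1r; apply: (@pow_anti _ I 2 1) => //.
by apply: pow_exp; exact: Iya.
Qed.

(** Modulo J I^s, the power I^(s+1) is generated by five elements of the same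
    degree: mixed products of the x-side and the y-side are divisible by
    q = x y, on the x-side z^2 is replaced by x^2, and on the y-side
    [cubic_relation] leaves at most two factors y a. *)
Local Lemma two_lines_reduce s f : ideal_pow I s.+1 f ->
  isum (ideal_mul J (ideal_pow I s)) (gen (W s)) f.
Proof.
have [Jq Jf1 Jf2] := two_lines_gens; have iI := jac_ideal J; have iJ := vanish_ideal vs.
have [Ix3 Ix2z _ Iya Iyb] := two_lines_jac.
have [ix iy iz] := irr_coords C.
elim: s f => [|s IH] f.
  have iK : is_ideal (isum (ideal_mul J (ideal_pow I 0)) (gen (W 0))).
    by apply: isum_ideal; [exact: mul_ideal|exact: gen_ideal].
  have KJ g : J g -> isum (ideal_mul J (ideal_pow I 0)) (gen (W 0)) g.
    move=> Jg; apply: isuml; first exact: gen_ideal.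
    by rewrite -[g]mulr1; apply: mul_mem.
  move=> /(pow1_min iI) /two_lines_mem_jac; move: f; apply: (gen_min iK) => g.
  rewrite mem_cat => /orP[|gU].
    by rewrite !inE => /or3P[]/eqP ->; apply: KJ; [exact: Jq|exact: Jf1|exact: Jf2].
  apply: isumr; first exact: mul_ideal.
  apply: gen_mem; rewrite /W !expr0 !mul1r.
  by move: (ya ^+ 2) => t; rewrite -[X in _ \in X]/(U ++ [:: t]) mem_cat gU.
set T := ideal_mul J (ideal_pow I s.+1); set K := isum T (gen (W s.+1)).
have iT : is_ideal T by exact: mul_ideal.
have iK : is_ideal K by apply: isum_ideal; [exact: mul_ideal|exact: gen_ideal].
have TK g : T g -> K g by apply: isuml; exact: gen_ideal.
have KW i : (i < 5)%N -> K (nth 0 (W s.+1) i).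
  by move=> lt_i; apply: isumr; [exact: iT|apply: gen_mem; exact: mem_nth].
have W0 : K ((x ^+ 3) ^+ s * x ^+ 3 * x ^+ 3) by rewrite -exprSr; exact: (KW 0%N isT).
have W1 : K ((x ^+ 3) ^+ s * x ^+ 3 * (x ^+ 2 * z)) by rewrite -exprSr; exact: (KW 1%N isT).
have W2' : K (yb ^+ s * yb * ya) by rewrite -exprSr; exact: (KW 2%N isT).
have W3 : K (yb ^+ s * yb * yb) by rewrite -exprSr; exact: (KW 3%N isT).
have W4 : K (yb ^+ s * ya ^+ 2) by exact: (KW 4%N isT).
apply: mul_min => // g h Ig /IH [t [w [Ht Hw ->]]].
rewrite mulrDr; apply: (idealD iK).
  by apply: TK; exact: mul_powS_mem.
move: w Hw; apply: (gen_min (colon_idealr g iK)) => w wW.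
move: g {Ig} (two_lines_mem_jac Ig); apply: (gen_min (colon_ideall w iK)) => g.
rewrite mem_cat => /orP[gJ|gU].
  apply: TK; apply: mul_mem; last exact: two_lines_W_pow.
  by move: gJ; rewrite !inE => /or3P[]/eqP ->; [exact: Jq|exact: Jf1|exact: Jf2].
have I4 u : ideal_pow irr 4 u -> I u.
  by move=> iu; apply: (pow1_min iI); apply: (two_lines_pow (j := 1)).
have Kq u : ideal_pow I s.+1 u -> K (q * u) by move=> Hu; apply: TK; apply: mul_mem.
have Kf u : ideal_pow I s.+1 u -> K (f1 * u) by move=> Hu; apply: TK; apply: mul_mem.
have Kf2 u : ideal_pow I s.+1 u -> K (f2 * u) by move=> Hu; apply: TK; apply: mul_mem.
have Ixs : ideal_pow I s ((x ^+ 3) ^+ s) by apply: pow_exp.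
have Iybs : ideal_pow I s (yb ^+ s) by apply: pow_exp.
have P2 := pow_ideal irr 2.
have ia : ideal_pow irr 2 a.
  have -> : a = (2%:R * p%:MP) * (z * y) + (3%:R * r%:MP) * (y * y) by rewrite /a; ring.
  by apply: (idealD P2); apply: (idealMl _ P2); apply: irr2_mem.
have ib : ideal_pow irr 2 b.
  have -> : b = 3%:R * (z * z) + p%:MP * (y * y) by rewrite /b; ring.
  by apply: (idealD P2); apply: (idealMl _ P2); apply: irr2_mem.
have I2 l m c : irr l -> irr m -> ideal_pow irr 2 c -> I (l * m * c).
  by move=> il im ic; apply: I4; apply: (@powD_mem _ _ 2 2) => //; apply: irr2_mem.
(* such a product has a factor q, which lies in J *)
have mixed u c l : ideal_pow I s u -> ideal_pow irr 2 c -> irr l ->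
    K (x ^+ 2 * l * (y * c * u)).
  move=> Hu ic il; have -> : x ^+ 2 * l * (y * c * u) = q * (x * l * c * u) by rewrite /q; ring.
  by apply: Kq; apply: powS_mem => //; apply: I2.
have Ixs1 : ideal_pow I s.+1 ((x ^+ 3) ^+ s * x ^+ 3) by rewrite mulrC; apply: powS_mem.
have C_pow : exists2 u, ideal_pow I s u & yb ^+ s.-1 * ya ^+ 2 = ya * u.
  case: s {IH T K iT iK TK KW W0 W1 W2' W3 W4 t Ht wW Kq Kf Kf2 Ixs Iybs mixed Ixs1} => [|s] /=.
    by exists ya => //; rewrite expr0 mul1r expr2.
  by exists (yb ^+ s * ya); [rewrite mulrC; apply: powS_mem => //; apply: pow_exp|ring].
have [u0 Iu0 Eu0] := C_pow.
have Ex3 : x ^+ 3 = x ^+ 2 * x by rewrite exprSr.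
have y_sides l : irr l ->
   [/\ K (x ^+ 2 * l * (yb ^+ s * ya)), K (x ^+ 2 * l * (yb ^+ s * yb)) &
       K (x ^+ 2 * l * (yb ^+ s.-1 * ya ^+ 2))].
  move=> il; split.
  - by rewrite [yb ^+ s * ya]mulrC /ya; apply: mixed.
  - by rewrite [yb ^+ s * yb]mulrC {1}/yb; apply: mixed.
  - by rewrite Eu0 {1}/ya; apply: mixed.
have x_sides c : ideal_pow irr 2 c ->
   [/\ K (y * c * ((x ^+ 3) ^+ s * x ^+ 3)) & K (y * c * ((x ^+ 3) ^+ s * (x ^+ 2 * z)))].
  move=> ic; split.
    have -> : y * c * ((x ^+ 3) ^+ s * x ^+ 3) = x ^+ 2 * x * (y * c * (x ^+ 3) ^+ s) by ring.
    exact: mixed.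
  have -> : y * c * ((x ^+ 3) ^+ s * (x ^+ 2 * z)) = x ^+ 2 * z * (y * c * (x ^+ 3) ^+ s) by ring.
  exact: mixed.
have [xa1 xa2] := x_sides a ia; have [xb1 xb2] := x_sides b ib.
have [yx1 yx2 yx3] := y_sides x ix; have [yz1 yz2 yz3] := y_sides z iz.
rewrite -Ex3 in yx1 yx2 yx3.
have Ka2 : K (ya * (yb ^+ s * ya)).
  by have -> : ya * (yb ^+ s * ya) = yb ^+ s * ya ^+ 2 by ring.
have Kab : K (ya * (yb ^+ s * yb)).
  by have -> : ya * (yb ^+ s * yb) = yb ^+ s * yb * ya by ring.
have Kba : K (yb * (yb ^+ s * ya)).
  by have -> : yb * (yb ^+ s * ya) = yb ^+ s * yb * ya by ring.
have Kbb : K (yb * (yb ^+ s * yb)).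
  by have -> : yb * (yb ^+ s * yb) = yb ^+ s * yb * yb by ring.
have [Kbaa Kbbb Kbba Kw] : [/\ K (yb * (yb ^+ s.-1 * ya ^+ 2)),
    K (yb ^+ s.-1 * yb * yb * yb), K (yb ^+ s.-1 * yb * yb * ya) &
    forall u, ideal_pow I 2 u -> ideal_pow I s.+1 (yb ^+ s.-1 * u)].
  move: W2' W3 W4; case: (s) => [|s'] /=; last first.
    rewrite -!exprSr => H2 H3 H4; split.
    - by rewrite mulrA -exprS; exact: H4.
    - exact: H3.
    - exact: H2.
    - by move=> u Hu; have := @powD_mem _ I s' 2 _ _ (pow_exp s' Iyb) Hu; rewrite addn2; apply.
  rewrite expr0 !mul1r => H2 H3 H4; split.
  - exact: (idealMl _ iK H4).
  - exact: (idealMr _ iK H3).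
  - exact: (idealMr _ iK H3).
  - by move=> u Hu; rewrite mul1r; exact: (@pow_anti _ I 2 1 u isT iI Hu).
have Kaaa : K (ya * (yb ^+ s.-1 * ya ^+ 2)).
  have -> : ya * (yb ^+ s.-1 * ya ^+ 2) = yb ^+ s.-1 * ya ^+ 3 by ring.
  rewrite cubic_relation.
  have -> : yb ^+ s.-1 * (f2 * w2 + q * v2 + yb * (r%:MP * yb ^+ 2 - p%:MP * yb * ya)) =
    f2 * (yb ^+ s.-1 * w2) + q * (yb ^+ s.-1 * v2) + r%:MP * (yb ^+ s.-1 * yb * yb * yb)
     - p%:MP * (yb ^+ s.-1 * yb * yb * ya) by ring.
  have iI2 := pow_ideal I 2.
  have IA : I A.
    have -> : A = f2 + x ^+ 2 * z by rewrite /f2; ring.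
    by apply: (idealD iI); [exact: jac_sub|exact: Ix2z].
  have I11 u v : I u -> I v -> ideal_pow I 2 (u * v).
    by move=> Iu Iv; apply: powS_mem; [exact: Iu|exact: pow1_mem].
  apply: (idealB iK); last exact: (idealMl _ iK Kbba).
  apply: (idealD iK); last exact: (idealMl _ iK Kbbb).
  apply: (idealD iK).
    apply: Kf2; apply: Kw; rewrite /w2 -[9%:R * A * _]mulrA.
    apply: (idealB iI2); last exact: (idealMl _ iI2 (I11 _ _ IA Iya)).
    apply: (idealD iI2); apply: (idealMl _ iI2); rewrite expr2.
      exact: (I11 _ _ Iya Iya).
    exact: (I11 _ _ Iyb Iyb).
  apply: Kq; apply: Kw; rewrite /v2 -[9%:R * A * _]mulrA.
  have Ixza := I2 _ _ _ ix iz ia; have Ixzb := I2 _ _ _ ix iz ib.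
  apply: (idealB iI2); last exact: (idealMl _ iI2 (I11 _ _ IA Ixza)).
  apply: (idealD iI2); apply: (idealMl _ iI2); first exact: (I11 _ _ Ixza Iya).
  exact: (I11 _ _ Ixzb Iyb).
have Kxx1 : K (x ^+ 3 * ((x ^+ 3) ^+ s * x ^+ 3)) by rewrite mulrC.
have Kxx2 : K (x ^+ 3 * ((x ^+ 3) ^+ s * (x ^+ 2 * z))).
  by have -> : x ^+ 3 * ((x ^+ 3) ^+ s * (x ^+ 2 * z)) = (x ^+ 3) ^+ s * x ^+ 3 * (x ^+ 2 * z) by ring.
have Kxx3 : K (x ^+ 2 * z * ((x ^+ 3) ^+ s * x ^+ 3)) by rewrite mulrC.
have Kxx4 : K (x ^+ 2 * z * ((x ^+ 3) ^+ s * (x ^+ 2 * z))).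
  have -> : x ^+ 2 * z * ((x ^+ 3) ^+ s * (x ^+ 2 * z)) =
    f1 * ((x ^+ 3) ^+ s * x ^+ 3) + (x ^+ 3) ^+ s * x ^+ 3 * x ^+ 3 by rewrite /f1; ring.
  by apply: (idealD iK); [exact: Kf|exact: W0].
move: gU wW; rewrite !inE.
case/or4P => /eqP->; case/or4P => [/eqP->|/eqP->|/eqP->|/orP[]/eqP->].
- exact: Kxx1.
- exact: Kxx2.
- exact: yx1.
- exact: yx2.
- exact: yx3.
- exact: Kxx3.
- exact: Kxx4.
- exact: yz1.
- exact: yz2.
- exact: yz3.
- exact: xa1.
- exact: xa2.
- exact: Ka2.
- exact: Kab.
- exact: Kaaa.
- exact: xb1.
- exact: xb2.
- exact: Kba.
- exact: Kbb.
- exact: Kbaa.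
Qed.

(** The five generators [W s.+1] have linearly independent values at the five
    points: 1 and c at the points (1, 0, c) and, up to a nonzero factor, 1, c
    and c^2 at the points (0, 1, c). So an element of J in I^(s+2) has, modulo
    J I^(s+1), only coefficients in the irrelevant ideal; what remains has one
    order more than the generators, and then any decomposition over the
    generators of J has cofactors of high enough order to lie in I^(s+1). *)
Lemma two_lines_VV : VV_torsion_free J I.
Proof.
have [Jq Jf1 Jf2] := two_lines_gens; have iI := jac_ideal J; have iJ := vanish_ideal vs.
have [Ix3 Ix2z _ Iya Iyb] := two_lines_jac.
have [ix iy iz] := irr_coords C.
have Fx := coords_formx C; have Fy := coords_formy C; have Fz := coords_formz C.
apply: VV_intro => //; first exact: jac_sub.
case=> [|[|s]] f // _ Jf If; rewrite [_.-1]/=.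
set T := ideal_mul J (ideal_pow I s.+1); have iT : is_ideal T by exact: mul_ideal.
have TJ g : T g -> J g by apply: (mul_min iJ) => g' h Jg' _; apply: (idealMr _ iJ Jg').
have [t [w [Ht Hw Ef]]] := two_lines_reduce If.
move: Hw Ef => [r1 [_ [[r2 [_ [[r3 [_ [[r4 [_ [[r5 [_ [-> ->]]] ->]]] ->]]] ->]]] ->]]] Ef.
pose D := (3 * s.+2)%N.
set w1 := (x ^+ 3) ^+ s.+1 * x ^+ 3 in Ef; set w2' := (x ^+ 3) ^+ s.+1 * (x ^+ 2 * z) in Ef.
set w3 := yb ^+ s.+1 * ya in Ef; set w4 := yb ^+ s.+1 * yb in Ef.
set w5 := yb ^+ s.+1.-1 * ya ^+ 2 in Ef.
have Fa : form 2 a.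
  have -> : a = (2%:R * p)%:MP * (z * y) + (3%:R * r)%:MP * (y * y) by rewrite /a; ring.
  by apply: formD; apply: formCM; [exact: (formM Fz Fy)|exact: (formM Fy Fy)].
have Fb : form 2 b.
  have -> : b = (3%:R)%:MP * (z * z) + p%:MP * (y * y) by rewrite /b; ring.
  by apply: formD; apply: formCM; [exact: (formM Fz Fz)|exact: (formM Fy Fy)].
have Fya : form 3 ya by exact: (formM Fy Fa).
have Fyb : form 3 yb by exact: (formM Fy Fb).
have Fx3 : form 3 (x ^+ 3) by exact: (formXn 3 Fx).
have FD d (g : R) : form d g -> d = D -> form D g by move=> + <-.
have F1 : form D w1.
  have Fw := formM (formXn s.+1 Fx3) Fx3.
  by apply: (FD _ _ Fw); rewrite /D; lia.
have F2 : form D w2'.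
  have Fw := formM (formXn s.+1 Fx3) (formM (formXn 2 Fx) Fz).
  by apply: (FD _ _ Fw); rewrite /D; lia.
have F3 : form D w3.
  have Fw := formM (formXn s.+1 Fyb) Fya.
  by apply: (FD _ _ Fw); rewrite /D; lia.
have F4 : form D w4.
  have Fw := formM (formXn s.+1 Fyb) Fyb.
  by apply: (FD _ _ Fw); rewrite /D; lia.
have F5 : form D w5.
  have Fw := formM (formXn s Fyb) (formXn 2 Fya).
  by apply: (FD _ _ Fw); rewrite /D; lia.
(* split the coefficients into constants and elements of the irrelevant ideal *)
pose cst (g : R) := g.@[(0 : 'rV[k]_3) 0].
pose g := (cst r1)%:MP * w1 + (cst r2)%:MP * w2' + (cst r3)%:MP * w3 +
  (cst r4)%:MP * w4 + (cst r5)%:MP * w5.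
pose h := (r1 - (cst r1)%:MP) * w1 + (r2 - (cst r2)%:MP) * w2' + (r3 - (cst r3)%:MP) * w3 +
  (r4 - (cst r4)%:MP) * w4 + (r5 - (cst r5)%:MP) * w5.
have Egh : f - t = g + h by rewrite Ef /g /h; ring.
have Jgh : J (g + h) by rewrite -Egh; apply: (idealB iJ); [exact: Jf|exact: TJ].
have iPD := pow_ideal irr D.+1.
have Hh : ideal_pow irr D.+1 h.
  have H u v : form D v -> ideal_pow irr D.+1 ((u - (cst u)%:MP) * v).
    by move=> /form_irr; apply: powS_mem; exact: irr_decomp.
  by do 4?[apply: (idealD iPD)]; apply: H.
have Fg : form D g by do 4?[apply: formD]; apply: formCM.
have g_eval v : v \in vs -> g.@[v 0] = 0.
  move=> vvs; have := congr1 (fun P : {poly k} => P`_D) (Jgh v vvs).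
  by rewrite rayD coefD (coef_ray_pow_irr _ Hh) // addr0 (ray_form _ Fg) coefZ coefXn eqxx mulr1 coef0.
have g0 : g = 0.
  have ev13 c : c \in [:: 1; -1] -> cst r1 + c * cst r2 = 0.
    move=> Hc; have Hv : e1 + c *: e3 \in vs.
      by move: Hc; rewrite vsE !inE => /orP[]/eqP->; rewrite eqxx ?orbT.
    have := g_eval _ Hv; have -> : e1 + c *: e3 = 1 *: e1 + 0 *: e2 + c *: e3 by rewrite scale1r scale0r addr0.
    rewrite /g /w1 /w2' /w3 /w4 /w5 /ya /yb !(mevalD, mevalM, mevalC, rmorphXn) /=.
    rewrite (coords_evalx C) (coords_evaly C) (coords_evalz C) !mul0r !expr1n !mulr1 !mul1r.
    by rewrite !mulr0 !addr0 [c * _]mulrC.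
  have ev23 c : c \in [:: c1; c2; c3] -> cst r5 * c ^+ 2 - cst r3 * c + cst r4 = 0.
    move=> Hc; have Hv : e2 + c *: e3 \in vs.
      by move: Hc; rewrite vsE !inE => /or3P[]/eqP->; rewrite eqxx ?orbT.
    have Ev : e2 + c *: e3 = 0 *: e1 + 1 *: e2 + c *: e3 by rewrite scale1r scale0r add0r.
    have evx : (x ^+ 3).@[(e2 + c *: e3) 0] = 0.
      by rewrite rmorphXn /= Ev (coords_evalx C) expr0n.
    have evy : y.@[(e2 + c *: e3) 0] = 1 by rewrite Ev (coords_evaly C).
    have evz : z.@[(e2 + c *: e3) 0] = c by rewrite Ev (coords_evalz C).
    have evb : yb.@[(e2 + c *: e3) 0] = 3%:R * c ^+ 2 + p.
      by rewrite /yb /b !(mevalD, mevalM, mevalC, rmorphXn, rmorph_nat) /= evy evz; ring.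
    have eva : ya.@[(e2 + c *: e3) 0] = - (c * (3%:R * c ^+ 2 + p)).
      rewrite /ya /a !(mevalD, mevalM, mevalC, rmorphXn, rmorph_nat) /= evy evz.
      have -> : 3%:R * r = - (3%:R * c ^+ 3 + 3%:R * p * c).
        by apply/eqP; rewrite -addr_eq0; apply/eqP; rewrite -[RHS](mulr0 3%:R) -(cubic_root Hc); ring.
      by ring.
    have := g_eval _ Hv; rewrite /g (eval_on_cubic _ _ _ _ _ _ _ evx eva evb) => /eqP.
    by rewrite mulf_eq0 expf_eq0 (negbTE (cubic_deriv_neq0 Hc)) andbF => /eqP.
  have /ev13 E1 : 1 \in [:: 1; -1 : k] by rewrite !inE eqxx.
  have /ev13 E2 : -1 \in [:: 1; -1 : k] by rewrite !inE eqxx orbT.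
  have /ev23 F1' : c1 \in [:: c1; c2; c3] by rewrite !inE eqxx.
  have /ev23 F2' : c2 \in [:: c1; c2; c3] by rewrite !inE eqxx orbT.
  have /ev23 F3' : c3 \in [:: c1; c2; c3] by rewrite !inE eqxx !orbT.
  have r10 : cst r1 = 0.
    apply: (mulfI (natk_neq0 1)); rewrite mulr0 -[RHS](addr0 0) -{1}E1 -E2; ring.
  have r20 : cst r2 = 0 by move: E1; rewrite r10 add0r mul1r.
  have [n12 n13 n23] : [/\ c1 - c2 != 0, c1 - c3 != 0 & c2 - c3 != 0].
    move: c_uniq; rewrite /= !inE !negb_or !andbT => /andP[/andP[n12 n13] n23].
    by rewrite !subr_eq0.
  have G2 : cst r5 * (c1 + c2) - cst r3 = 0.
    by apply: (mulfI n12); rewrite mulr0 -[RHS](subrr 0) -{1}F1' -F2'; ring.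
  have G3 : cst r5 * (c1 + c3) - cst r3 = 0.
    by apply: (mulfI n13); rewrite mulr0 -[RHS](subrr 0) -{1}F1' -F3'; ring.
  have r50 : cst r5 = 0.
    by apply: (mulfI n23); rewrite mulr0 -[RHS](subrr 0) -{1}G2 -G3; ring.
  have r30 : cst r3 = 0 by move/eqP: G2; rewrite r50 mul0r sub0r oppr_eq0 => /eqP.
  have r40 : cst r4 = 0 by move: F1'; rewrite r50 r30 !mul0r subrr add0r.
  by rewrite /g r10 r20 r30 r40 r50 !mpolyC0 !mul0r !addr0.
have Eh : f = t + h by rewrite -[h]add0r -g0 -Egh; ring.
have Jh : J h by rewrite -[h]add0r -g0.
rewrite Eh; apply: (idealD iT); first exact: Ht.
have F_f1 : form 3 f1.
  have -> : f1 = x * (z * z) - x ^+ 3 by rewrite /f1; ring.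
  by apply: formB; [exact: (formM Fx (formM Fz Fz))|exact: Fx3].
have F_f2 : form 3 f2.
  have -> : f2 = z ^+ 3 + p%:MP * (z * (y * y)) + r%:MP * y ^+ 3 - z * (x * x) by rewrite /f2 /A; ring.
  apply: formB; last exact: (formM Fz (formM Fx Fx)).
  apply: formD; last by apply: formCM; exact: (formXn 3 Fy).
  apply: formD; first exact: (formXn 3 Fz).
  by apply: formCM; exact: (formM Fz (formM Fy Fy)).
have Tmul d u v : (3 * s.+1 < d)%N -> ideal_pow irr d u -> J v -> T (u * v).
  move=> lt_d Hu Jv; rewrite mulrC; apply: mul_mem; first exact: Jv.
  by apply: two_lines_pow; exact: (pow_anti lt_d (irr_ideal k 3) Hu).
have Tq u : ideal_pow irr (D.+1 - 2) u -> T (u * q).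
  by move=> Hu; apply: (Tmul (D.+1 - 2)%N) => //; rewrite /D; lia.
have Tf1 u : ideal_pow irr (D.+1 - 3) u -> T (u * f1).
  by move=> Hu; apply: (Tmul (D.+1 - 3)%N) => //; rewrite /D; lia.
have Tf2 u : ideal_pow irr (D.+1 - 3) u -> T (u * f2).
  by move=> Hu; apply: (Tmul (D.+1 - 3)%N) => //; rewrite /D; lia.
apply: (graded_gen_min (s := [:: (q, 2); (f1, 3); (f2, 3)]%N) (D := D.+1) iT) Hh.
- move=> v; rewrite !inE => /or3P[]/eqP -> /=.
  + exact: (formM Fx Fy).
  + exact: F_f1.
  + exact: F_f2.
- move=> v u; rewrite !inE => /or3P[]/eqP -> Hu.
  + exact: (Tq _ Hu).
  + exact: (Tf1 _ Hu).
  + exact: (Tf2 _ Hu).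
exact: two_lines_mem.
Qed.

End Configuration.
End MeetingOutside.

(** * Points in general linear position *)

(** Distinctness of labels, from the pairwise distinctness [U] of a list that
    contains them. *)
Ltac distinct U :=
  move: (U); rewrite /= !inE !negb_or !andbT -!andbA;
  repeat (move=> /andP[?]); move=> ?;
  repeat (apply/andP; split); first [assumption | by rewrite eq_sym].

Section GeneralPosition.
Variable k : fieldType.
Local Notation R := {mpoly k[3]}.
Local Notation irr := (@irr k 3).
Implicit Types (f g h : R) (i j l : 'I_5).

Lemma label_mem (s : seq 'I_5) i : uniq s -> size s = 5%N -> i \in s.
Proof.
move=> s_uniq s_size; apply: contraT => i_s.
have : uniq (i :: s) by rewrite /= i_s.
by move=> /card_uniqP Es; have := max_card (mem (i :: s)); rewrite Es card_ord /= s_size.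
Qed.

Lemma labels2 i j : i != j -> exists a b c, uniq [:: i; a; b; c; j].
Proof.
move=> ij; have : #|~: [set i; j]| = 3%N by rewrite cardsCs setCK card_ord cards2 ij.
have := enum_uniq (mem (~: [set i; j])); rewrite cardE.
have sub l : l \in enum (~: [set i; j]) -> (l != i) && (l != j).
  by rewrite mem_enum !inE negb_or.
case: (enum _) sub => [|a [|b [|c [|//]]]] // sub s_uniq _.
have /andP[ai aj] := sub a (mem_head _ _).
have /andP[bi bj] : (b != i) && (b != j) by apply: sub; rewrite !inE eqxx orbT.
have /andP[ci cj] : (c != i) && (c != j) by apply: sub; rewrite !inE eqxx !orbT.
exists a, b, c; move: s_uniq; rewrite /= !inE !negb_or !andbT => /andP[/andP[ab ac] bc].
by rewrite !(eq_sym i) ai bi ci (eq_sym j i) ij ab ac aj bc bj cj.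
Qed.

Variable v : 'I_5 -> 'rV[k]_3.
Hypothesis v_gen : forall i j l, uniq [:: i; j; l] -> det3 (v i) (v j) (v l) != 0.
Variable vs : seq 'rV[k]_3.
Hypothesis vsE : forall u, reflect (exists i, u = v i) (u \in vs).

Let J := vanish vs.
Let I := jac J.
Let N f := I f /\ ideal_pow irr 3 f.
Let L i j : R := lf (v i) (v j).
Let D i j l : k := det3 (v i) (v j) (v l).

Local Lemma gpJ f : J f <-> forall i, ray (v i) f = 0.
Proof.
split=> [Jf i|H u /vsE [i ->]]; last exact: H.
by apply: Jf; apply/vsE; exists i.
Qed.

Local Lemma gpJ_form d f : form d f -> (forall i, f.@[v i 0] = 0) -> J f.
Proof. by move=> Ff H; apply/gpJ => i; apply: (ray_form_eq0 Ff). Qed.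

Local Lemma gpN_ideal : is_ideal N.
Proof. by apply: capI_ideal; [exact: jac_ideal|exact: pow_ideal]. Qed.

Local Lemma Lray i j l : ray (v l) (L i j) = D i j l *: 'X.
Proof. exact: lf_ray. Qed.
Local Lemma Leval i j l : (L i j).@[v l 0] = D i j l.
Proof. exact: lf_eval. Qed.
Local Lemma Ldd i j l : dd (v l) (L i j) = (D i j l)%:MP.
Proof. exact: lf_dd. Qed.
Local Lemma Lform i j : form 1 (L i j). Proof. exact: lf_form. Qed.
Local Lemma LC i j : L j i = - L i j.
Proof. by rewrite /L lf.unlock; ring. Qed.
Local Lemma Dij i j : D i j i = 0. Proof. exact: det3_aba. Qed.
Local Lemma Djj i j : D i j j = 0. Proof. exact: det3_abb. Qed.
Local Lemma Dii i j : D i i j = 0. Proof. exact: det3_aab. Qed.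
Local Lemma DC i j l : D j i l = - D i j l. Proof. exact: det3_swap12. Qed.

(** Modulo the lines joining the point to two others, the variables are
    multiples of the equation of the third side: [ray_vanish_mem] applies. *)
Local Lemma one_point i j l f : uniq [:: i; j; l] -> ray (v i) f = 0 ->
  exists g h, f = L i j * g + L i l * h.
Proof.
move=> /v_gen D0 f0.
have [a [_ [[b [_ [-> ->]]] ->]]] : gen [:: L i j; L i l] f.
  apply: (ray_vanish_mem (a := (D i j l)^-1%:MP * L j l)) f0; first exact: gen_ideal.
  move=> c; exists (v l 0 c * (D i j l)^-1)%:MP, (- (v j 0 c * (D i j l)^-1)%:MP * L i l + 0).
  split; first by exists (- (v j 0 c * (D i j l)^-1)%:MP), 0.
  have := cramer (v i) (v j) (v l) c; rewrite -/(D i j l) -/(L j l) -/(L l i) -/(L i j) => E.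
  have -> : 'X_c = (D i j l)^-1%:MP * ((D i j l)%:MP * 'X_c) :> R.
    by rewrite mulrA -mpolyCM mulVf // mpolyC1 mul1r.
  by rewrite E (LC i l) !mpolyCM; ring.
by exists a, b; ring.
Qed.

(** The conic through five points, as a member of the pencil of conics through
    the first four. *)
Let conic a b c d e : R :=
  (D a c e * D b d e)%:MP * (L a b * L c d) - (D a b e * D c d e)%:MP * (L a c * L b d).

Local Lemma conic_form a b c d e : form 2 (conic a b c d e).
Proof.
by apply: formB; apply: formCM; exact: (formM (Lform _ _) (Lform _ _)).
Qed.

Local Lemma conic_J a b c d e : uniq [:: a; b; c; d; e] -> J (conic a b c d e).
Proof.
move=> U; apply: (gpJ_form (conic_form _ _ _ _ _)) => i.
rewrite mevalB !mevalM !mevalC !Leval.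
have := label_mem i U erefl; rewrite !inE => /or4P[/eqP->|/eqP->|/eqP->|/orP[]/eqP->];
  rewrite ?Dij ?Djj ?mul0r ?mulr0 ?mul0r ?mulr0 ?subrr //.
by ring.
Qed.

(** A cubic with a double point at [a], through four more points. *)
Let cub a b c d e : R := L a b * L a c * L d e.

Local Lemma cub_form a b c d e : form 3 (cub a b c d e).
Proof. by exact: (formM (formM (Lform _ _) (Lform _ _)) (Lform _ _)). Qed.

Local Lemma cub_J a b c d e : uniq [:: a; b; c; d; e] -> J (cub a b c d e).
Proof.
move=> U; apply: (gpJ_form (cub_form _ _ _ _ _)) => i.
rewrite !mevalM !Leval.
have := label_mem i U erefl; rewrite !inE => /or4P[/eqP->|/eqP->|/eqP->|/orP[]/eqP->];
  by rewrite ?Dij ?Djj ?mul0r ?mulr0 ?mul0r.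
Qed.

(** The points are peeled off one at a time: an element of the ideal of a point
    is a combination of two lines through it, and a line that misses the next
    point leaves a cofactor vanishing there. After [a] and [b] the product of
    [L a c] and [L b d] is traded for the conic, and a multiple of [L a b]
    remains, whose cofactor vanishes at [c], [d], [e]. *)
Local Lemma gp_mem a b c d e f : uniq [:: a; b; c; d; e] -> J f ->
  gen [:: conic a b c d e; cub c d e a b; cub d c e a b; cub e c d a b] f.
Proof.
move=> U /gpJ Hf; set q := conic a b c d e.
have /gpJ Hq := conic_J U.
have off i j l g : uniq [:: i; j; l] -> ray (v l) (L i j * g) = 0 -> ray (v l) g = 0.
  move=> /v_gen D0; rewrite rayM Lray => /eqP.
  by rewrite mulf_eq0 scaler_eq0 polyX_eq0 orbF (negbTE D0) => /eqP.
have [f1 [f2 Ef]] : exists g h, f = L a b * g + L a c * h.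
  by apply: one_point (Hf a); distinct U.
have [g [h Eh]] : exists g h, f2 = L b a * g + L b d * h.
  have U3 : uniq [:: a; c; b] by distinct U.
  have U3' : uniq [:: b; a; d] by distinct U.
  apply: (one_point U3'); apply: (off _ _ _ _ U3).
  by have := Hf b; rewrite Ef rayD rayM Lray Djj scale0r mul0r add0r.
have nz : D a b e * D c d e != 0 by rewrite mulf_neq0 // v_gen //; distinct U.
pose t := (D a b e * D c d e)^-1; pose s := D a c e * D b d e.
have Eq : L a c * L b d = t%:MP * (s%:MP * (L a b * L c d) - q).
  have -> : s%:MP * (L a b * L c d) - q = (D a b e * D c d e)%:MP * (L a c * L b d).
    by rewrite /q /conic /s; ring.
  by rewrite [RHS]mulrA -mpolyCM mulVf // mpolyC1 mul1r.
pose g1 := f1 - L a c * g + t%:MP * s%:MP * L c d * h.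
have {}Ef : f = L a b * g1 - t%:MP * q * h.
  have -> : f = L a b * (f1 - L a c * g) + (L a c * L b d) * h by rewrite Ef Eh (LC a b); ring.
  by rewrite Eq /g1; ring.
have Hg1 i : uniq [:: a; b; i] -> ray (v i) g1 = 0.
  move=> U3; apply: (off _ _ _ _ U3).
  have -> : L a b * g1 = f + t%:MP * q * h by rewrite Ef; ring.
  by rewrite rayD Hf 2!rayM Hq mulr0 mul0r addr0.
have [x1 [x2 E1]] : exists g h, g1 = L c d * g + L c e * h.
  by apply: one_point; [distinct U|apply: Hg1; distinct U].
have [y1 [y2 E2]] : exists g h, x2 = L d c * g + L d e * h.
  have U3 : uniq [:: c; e; d] by distinct U.
  apply: one_point; first by distinct U.
  apply: (off _ _ _ _ U3); have := Hg1 d; rewrite E1 rayD rayM Lray Djj scale0r mul0r add0r.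
  by apply; distinct U.
have {}E1 : g1 = L c d * (x1 - L c e * y1) + L c e * L d e * y2 by rewrite E1 E2 (LC c d); ring.
have [z1 [z2 E3]] : exists g h, x1 - L c e * y1 = L e c * g + L e d * h.
  have U3 : uniq [:: c; d; e] by distinct U.
  apply: one_point; first by distinct U.
  apply: (off _ _ _ _ U3); have := Hg1 e; rewrite E1 rayD (rayM _ (_ * _)) (rayM _ (L c e)) !Lray Djj scale0r !mul0r addr0.
  by apply; distinct U.
have -> : f = (- t%:MP * h) * q + - z1 * cub c d e a b + z2 * cub d c e a b + y2 * cub e c d a b.
  rewrite Ef E1 E3 /cub (LC c e) (LC d e) (LC c d); ring.
set G := gen _; have iG : is_ideal G by exact: gen_ideal.
have G_ m : (m < 4)%N -> G (nth 0 [:: q; cub c d e a b; cub d c e a b; cub e c d a b] m).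
  by move=> lt_i; apply: gen_mem; exact: mem_nth.
have G0 : G q := G_ 0%N isT.
have G1 : G (cub c d e a b) := G_ 1%N isT.
have G2 : G (cub d c e a b) := G_ 2%N isT.
have G3 : G (cub e c d a b) := G_ 3%N isT.
apply: (idealD iG); last exact: (idealMl _ iG G3).
apply: (idealD iG); last exact: (idealMl _ iG G2).
by apply: (idealD iG); [exact: (idealMl _ iG G0)|exact: (idealMl _ iG G1)].
Qed.

(** An element of [J] of order at least 3 + m has cofactors of order m + 1 on
    the conic and m on the cubics. *)
Local Lemma gp_graded_min a b c d e (K : R -> Prop) m f : uniq [:: a; b; c; d; e] ->
  is_ideal K ->
  (forall u, ideal_pow irr m.+1 u -> K (u * conic a b c d e)) ->
  (forall u w, ideal_pow irr m u -> J w -> ideal_pow irr 3 w -> K (u * w)) ->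
  J f -> ideal_pow irr (3 + m) f -> K f.
Proof.
move=> U iK Kq Kc /(gp_mem U).
apply: (graded_gen_min (s := [:: (conic a b c d e, 2); (cub c d e a b, 3);
  (cub d c e a b, 3); (cub e c d a b, 3)]%N) iK).
  move=> t; rewrite !inE => /or4P[]/eqP->; [exact: conic_form|exact: cub_form..].
have Ucub i j l n p : uniq [:: i; j; l; n; p] ->
  forall u, ideal_pow irr (3 + m - 3) u -> K (u * cub i j l n p).
  move=> U' u Hu; apply: Kc; [|exact: cub_J U'|exact: (form_irr (cub_form _ _ _ _ _))].
  by rewrite addKn in Hu.
move=> t u; rewrite !inE => /or4P[]/eqP-> Hu.
- exact: (Kq _ Hu).
- by apply: Ucub Hu; distinct U.
- by apply: Ucub Hu; distinct U.
- by apply: Ucub Hu; distinct U.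
Qed.

(** Modulo [J] a form is determined by its values at the five points, and forms
    supported at a single point correct these values one at a time. *)
Local Lemma interpolate_mem n (K : R -> Prop) : is_ideal K ->
  (forall f, form n f -> J f -> K f) ->
  (forall i, exists g, [/\ form n g, K g, g.@[v i 0] != 0 & forall l, l != i -> g.@[v l 0] = 0]) ->
  forall f, form n f -> K f.
Proof.
move=> iK KJ H f Ff.
suff G (s : seq 'I_5) g : form n g -> (forall i, i \notin s -> g.@[v i 0] = 0) -> K g.
  by apply: (G (enum 'I_5)) => // i; rewrite mem_enum.
elim: s g => [|i s IH] g Fg Hg.
  by apply: KJ => //; apply: (gpJ_form Fg) => i; apply: Hg.
have [h [Fh Kh hi hl]] := H i.
pose c := g.@[v i 0] / h.@[v i 0].
have -> : g = (g - c%:MP * h) + c%:MP * h by rewrite subrK.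
apply: (idealD iK); last exact: (idealMl _ iK Kh).
apply: IH => [|l ls]; first by apply: formB => //; apply: formCM.
rewrite mevalB mevalM mevalC; have [->|li] := eqVneq l i.
  by rewrite /c divfK // subrr.
by rewrite hl // mulr0 subr0; apply: Hg; rewrite in_cons negb_or li.
Qed.

(** Take the conic through the points and a cubic of [J] with a double point at
    [b], containing the line through [c] and [d]. In the directions [v c], [v d]
    their bracket vanishes at [b], where the cubic is singular, and at [c] and
    [d], since by Euler's relation the derivative along [v c] at [v c] is a
    multiple of the value. At [a] it is a product of determinants. *)
Local Lemma minor_support a b c d e : uniq [:: a; b; c; d; e] ->
  exists g, [/\ N g, form 3 g, g.@[v a 0] != 0 &
    forall l, l \in [:: b; c; d] -> g.@[v l 0] = 0].
Proof.
move=> U; set q := conic a b c d e; set f := cub b a e c d.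
have U' : uniq [:: b; a; e; c; d] by distinct U.
have Jq := conic_J U; have Jf := cub_J U'.
exists (bracket (v c) (v d) q f).
have Edq i : dd (v i) q = (D a c e * D b d e)%:MP * ((D a b i)%:MP * L c d + L a b * (D c d i)%:MP)
   - (D a b e * D c d e)%:MP * ((D a c i)%:MP * L b d + L a c * (D b d i)%:MP).
  by rewrite /q /conic ddB !ddCM !ddM !Ldd.
have Edf i : dd (v i) f = ((D b a i)%:MP * L b e + L b a * (D b e i)%:MP) * L c d
   + L b a * L b e * (D c d i)%:MP.
  by rewrite /f /cub !ddM !Ldd.
have F3 : form 3 (bracket (v c) (v d) q f).
  have F1 i : form 1 (dd (v i) q).
    by rewrite Edq; apply: formB; apply: formCM; apply: formD;
      [apply: formCM|rewrite mulrC; apply: formCM|apply: formCM|rewrite mulrC; apply: formCM];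
      exact: Lform.
  have F2 i : form 2 (dd (v i) f).
    rewrite Edf; apply: formD.
      apply: (formM (d := 1) (e := 1)); last exact: Lform.
      by apply: formD; [apply: formCM|rewrite mulrC; apply: formCM]; exact: Lform.
    by rewrite mulrC; apply: formCM; exact: (formM (Lform _ _) (Lform _ _)).
  by apply: formB; exact: (formM (F1 _) (F2 _)).
split => //.
- by split; [exact: jac_bracket|exact: form_irr].
- rewrite /bracket !Edq !Edf !(mevalB, mevalD, mevalM, mevalC) !Leval.
  rewrite !(Dij, Djj, Dii, mul0r, mulr0, add0r, addr0).
  rewrite !(DC a b).
  set t := (X in X != 0).
  have -> : t = - (D a b e * D c d e * D a c d * D b d a * D a b c * D b e a * D c d a).
    by rewrite /t; ring.
  by rewrite oppr_eq0 !mulf_neq0 // v_gen //; distinct U.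
- move=> l; rewrite !inE /bracket !Edq !Edf => /or3P[]/eqP->;
    rewrite !(mevalB, mevalD, mevalM, mevalC) !Leval;
    by rewrite !(Dij, Djj, Dii, mul0r, mulr0, add0r, addr0, subr0, subrr, oppr0).
Qed.

Local Lemma pair_support i j : i != j -> exists g, [/\ N g, form 3 g, g.@[v i 0] != 0 &
  forall l, l != i -> l != j -> g.@[v l 0] = 0].
Proof.
move=> /labels2[a [b [c U]]]; have [g [Ng Fg gi gl]] := minor_support U.
exists g; split=> // l li lj; apply: gl.
have := label_mem l U erefl; rewrite !inE (negbTE li) (negbTE lj) /= !orbA orbF.
by [].
Qed.

Local Lemma gpN_form3 g : form 3 g -> J g -> N g.
Proof. by move=> Fg Jg; split; [exact: jac_sub|exact: form_irr]. Qed.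

(** Cubics in the Jacobian ideal separate the points up to one linear condition
    on the values: by [pair_support] there are some supported at [i] and [j]
    and nonzero at [i], so that [g], supported at [j], is the only form to be
    added. *)
Local Lemma irr3_split j g : form 3 g -> g.@[v j 0] != 0 ->
  (forall l, l != j -> g.@[v l 0] = 0) ->
  forall h, ideal_pow irr 3 h -> isum N (gen [:: g]) h.
Proof.
move=> Fg gj gl; have iK : is_ideal (isum N (gen [:: g])).
  by apply: isum_ideal; [exact: gpN_ideal|exact: gen_ideal].
have NK w : N w -> isum N (gen [:: g]) w by apply: isuml; exact: gen_ideal.
have Kg : isum N (gen [:: g]) g.
  by apply: isumr; [exact: gpN_ideal|apply: gen_mem; exact: mem_head].
apply: (irr_pow_min iK); apply: (interpolate_mem iK) => [w Fw Jw|i].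
  by apply: NK; exact: gpN_form3.
have [->|ij] := eqVneq i j; first by exists g; split.
have [w [Nw Fw wi wl]] := pair_support ij.
exists (w - (w.@[v j 0] / g.@[v j 0])%:MP * g); split.
- by apply: formB; [exact: Fw|apply: formCM; exact: Fg].
- by apply: (idealB iK); [exact: NK|exact: (idealMl _ iK Kg)].
- by rewrite mevalB mevalM (gl i ij) mulr0 subr0.
move=> l li; rewrite mevalB mevalM mevalC; have [->|lj] := eqVneq l j.
  by rewrite divfK // subrr.
by rewrite (gl l lj) mulr0 subr0 wl.
Qed.

(** A line through [j] makes a cubic supported at [i] and [j] into a quartic
    supported at [i] alone, so that quartics can be interpolated. *)
Local Lemma gp_irr4 f : ideal_pow irr 4 f -> ideal_mul irr N f.
Proof.
have iK : is_ideal (ideal_mul irr N) by exact: mul_ideal.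
have [a [b [c U]]] := labels2 (isT : (ord0 : 'I_5) != ord_max).
apply: (irr_pow_min iK); apply: (interpolate_mem iK) => [w Fw Jw|i].
  apply: (gp_graded_min (m := 1) U iK) Jw (form_irr Fw) => [u|u t iu Jt it].
    move: u; apply: mul_min; first exact: colon_ideall.
    move=> g h ig /(pow1_min (irr_ideal k 3)) ih; rewrite -mulrA; apply: mul_mem => //.
    have Jq := conic_J U; split; first by apply: idealMl; [exact: jac_ideal|exact: jac_sub].
    by apply: powS_mem => //; exact: (form_irr (conic_form _ _ _ _ _)).
  by apply: mul_mem; [exact: (pow1_min (irr_ideal k 3))|split; [exact: jac_sub|]].
have [j ij] : exists j, i != j.
  by have [->|i0'] := eqVneq i ord0; [exists ord_max|exists ord0].
have [g [Ng Fg gi gl]] := pair_support ij.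
have [l [b' [c' U']]] := labels2 ij.
exists (L j l * g); split.
- exact: (formM (Lform _ _) Fg).
- by apply: mul_mem => //; apply: (pow1_min (irr_ideal k 3)); exact: (form_irr (Lform _ _)).
- by rewrite mevalM mulf_neq0 // Leval v_gen //; distinct U'.
move=> l' li; rewrite mevalM; have [->|lj] := eqVneq l' j; first by rewrite Leval Dij mul0r.
by rewrite gl // mulr0.
Qed.

(** The cubic with a double point at [a] times a cubic [g] supported at [a]: the
    six lines can be regrouped into the product of two cubics of the ideal once
    the pair [L e a], [L b c] is replaced, modulo a conic [t] of the ideal, by
    the pair [L e b], [L a c]. This is how products with the form [g]
    left over by [irr3_split] are handled. *)
Local Lemma regroup a b c d e : uniq [:: a; b; c; d; e] -> exists g t X Y u,
  [/\ form 3 g, g.@[v a 0] != 0, forall l, l != a -> g.@[v l 0] = 0 &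
   [/\ J t, (J X /\ ideal_pow irr 3 X), J Y, ideal_pow irr 4 u &
    cub a b e c d * g = t * u + X * Y]].
Proof.
move=> U; set g := L b c * L b d * L b e.
pose k1 := D e b d * D a c d; pose k2 := D e a d * D b c d.
have k10 : k1 != 0 by rewrite mulf_neq0 // v_gen //; distinct U.
pose t := L e a * L b c - (k1^-1 * k2)%:MP * (L e b * L a c).
have Ft : form 2 t.
  by apply: formB; [|apply: formCM]; exact: (formM (Lform _ _) (Lform _ _)).
have Jt : J t.
  apply: (gpJ_form Ft) => i; rewrite mevalB !mevalM mevalC !Leval.
  have := label_mem i U erefl; rewrite !inE => /or4P[/eqP->|/eqP->|/eqP->|/orP[]/eqP->];
    rewrite ?Dij ?Djj ?mul0r ?mulr0 ?mul0r ?mulr0 ?subrr //.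
  by rewrite -/k1 -/k2 mulrAC mulVf // mul1r subrr.
have U1 : uniq [:: b; a; e; c; d] by distinct U.
have U2 : uniq [:: b; d; e; a; c] by distinct U.
exists g, t, ((k1^-1 * k2)%:MP * - cub b a e c d), (cub b d e a c), (- (L a b * L c d * (L b d * L b e))).
split.
- exact: (formM (formM (Lform _ _) (Lform _ _)) (Lform _ _)).
- by rewrite !mevalM !Leval !mulf_neq0 // v_gen //; distinct U.
- move=> l la; rewrite !mevalM !Leval.
  have := label_mem l U erefl; rewrite !inE (negbTE la) /= => /or4P[]/eqP->;
    by rewrite ?Dij ?Djj ?mul0r ?mulr0 ?mul0r.
split.
- exact: Jt.
- have P3 := pow_ideal irr 3; split.
    by apply: (idealMl _ (vanish_ideal vs)); apply: (idealN (vanish_ideal vs)); exact: cub_J.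
  by apply: (idealMl _ P3); apply: (idealN P3); exact: (form_irr (cub_form _ _ _ _ _)).
- exact: cub_J.
- apply: idealN; first exact: pow_ideal.
  exact: (form_irr (formM (formM (Lform _ _) (Lform _ _)) (formM (Lform _ _) (Lform _ _)))).
by rewrite /cub /g /t (LC a e) (LC b e) (LC a b); ring.
Qed.

Local Lemma gp_pow s f : ideal_pow irr (3 * s).+1 f -> ideal_pow I s f.
Proof.
move=> /(irr_pow_sub gp_irr4); move: f; apply: (mul_min (pow_ideal I s)) => u w _ Iw.
exact: (idealMl _ (pow_ideal I s) Iw).
Qed.

(** By induction on [s], for a cubic [w] with a double point: a factor of order
    3 of [u] is split by [irr3_split] into one in [I], to which the induction
    applies, and a multiple of [g]. The product of [g] and [w] is turned by
    [regroup] into a product of two cubics of [J], one of which serves as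
    element of [I], up to a multiple of a conic of [J] whose cofactor has order
    one more. *)
Local Lemma gp_cubics s w u : J w -> ideal_pow irr 3 w -> ideal_pow irr (3 * s) u ->
  ideal_mul J (ideal_pow I s) (u * w).
Proof.
have [a [b [c U]]] := labels2 (isT : (ord0 : 'I_5) != ord_max).
move: ord_max U => e; move: ord0 => d; move=> U; have iI := jac_ideal J.
elim: s u w => [|s IH] u w Jw iw iu.
  by rewrite mulrC; apply: mul_mem.
set T := ideal_mul J (ideal_pow I s.+1); have iT : is_ideal T by exact: mul_ideal.
have TS g h : ideal_mul J (ideal_pow I s) g -> I h -> T (h * g).
  by move=> Hg Ih; exact: mul_powS_mem.
have Tq g h : J g -> ideal_pow irr (3 * s.+1).+1 h -> T (h * g).
  by move=> Jg ih; rewrite mulrC; apply: mul_mem => //; apply: gp_pow.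
(* the conic is covered by Tq, and the other generators of J are these cubics *)
have Tcub i j l m n : uniq [:: i; j; l; m; n] -> T (u * cub i j l m n).
  move=> U'; have U2 : uniq [:: i; j; m; n; l] by distinct U'.
  have [g [t [X [Y [y [Fg gi gl [Jt [JX iX] JY iy E]]]]]]] := regroup U2.
  have Jc := cub_J U'; have ic := form_irr (cub_form i j l m n).
  move: iu; rewrite mulnS; move: u; apply: powD_min; first exact: colon_ideall.
  move=> h u' ih iu'.
  have [n' [_ [[In' _] [r [_ [-> ->]]] ->]]] := irr3_split Fg gi gl ih.
  have -> : (n' + (r * g + 0)) * u' * cub i j l m n =
    n' * (u' * cub i j l m n) + r * (y * u' * t) + r * (Y * (u' * X)).
    have -> : (n' + (r * g + 0)) * u' * cub i j l m n =
      n' * (u' * cub i j l m n) + r * u' * (cub i j l m n * g) by ring.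
    by rewrite E; ring.
  apply: (idealD iT); last by apply: (idealMl _ iT); apply: TS; [exact: IH|exact: jac_sub].
  apply: (idealD iT); first by apply: TS => //; exact: IH.
  apply: (idealMl _ iT); apply: Tq => //.
  have -> : ((3 * s.+1).+1 = 4 + 3 * s)%N by lia.
  exact: powD_mem.
have iTu := colon_idealr u iT.
have Tc i j l m n g : uniq [:: i; j; l; m; n] -> T (u * (g * cub i j l m n)).
  by move=> U'; rewrite mulrCA; apply: (idealMl _ iT); exact: Tcub.
have iw' : ideal_pow irr (3 + 0) w by rewrite addn0.
apply: (graded_gen_min (s := [:: (conic d a b c e, 2); (cub b c e d a, 3);
  (cub c b e d a, 3); (cub e b c d a, 3)]%N) iTu _ _ (gp_mem U Jw) iw').
  move=> t; rewrite !inE => /or4P[]/eqP->; [exact: conic_form|exact: cub_form..].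
move=> t g; rewrite !inE => /or4P[]/eqP-> ig.
- rewrite mulrA; apply: Tq; first exact: conic_J U.
  have -> : ((3 * s.+1).+1 = 3 * s.+1 + 1)%N by lia.
  exact: (powD_mem iu ig).
- by apply: Tc; distinct U.
- by apply: Tc; distinct U.
- by apply: Tc; distinct U.
Qed.

(** Apart from the conic, the generators of [J] are cubics, and minors of the
    conic with a cubic have order 1 + 2. *)
Local Lemma gp_jac_mem a b c d e f : uniq [:: a; b; c; d; e] -> I f ->
  exists u n, N n /\ f = conic a b c d e * u + n.
Proof.
move=> U; set q := conic a b c d e.
have iI := jac_ideal J; have iN := gpN_ideal.
have iK : is_ideal (fun f => exists u n, N n /\ f = q * u + n).
  split=> [|_ _ [u [n [Nn ->]]] [u' [n' [Nn' ->]]]|r _ [u [n [Nn ->]]]].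
  - by exists 0, 0; split; [exact: ideal0|ring].
  - by exists (u + u'), (n + n'); split; [exact: idealD|ring].
  - by exists (r * u), (r * n); split; [exact: idealMl|ring].
have Kq : exists u n, N n /\ q = q * u + n.
  by exists 1, 0; split; [exact: ideal0|ring].
have KN g : N g -> exists u n, N n /\ g = q * u + n.
  by move=> Ng; exists 0, g; split=> //; ring.
have Jq := conic_J U; have iq := form_irr (conic_form a b c d e).
have P3 := pow_ideal irr 3.
pose S g := g = q \/ (J g /\ ideal_pow irr 3 g).
have JS g : J g -> ideal_span S g.
  move=> /(gp_mem U); apply: gen_min; first exact: span_ideal.
  have Sc i j l m n : uniq [:: i; j; l; m; n] -> ideal_span S (cub i j l m n).
    move=> U'; apply: span_mem; right.
    by split; [exact: cub_J|exact: (form_irr (cub_form _ _ _ _ _))].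
  move=> h; rewrite !inE => /or4P[]/eqP->; first by apply: span_mem; left.
  - by apply: Sc; distinct U.
  - by apply: Sc; distinct U.
  - by apply: Sc; distinct U.
have KS g : S g -> exists u n, N n /\ g = q * u + n.
  by move=> [->//|[Jg ig]]; apply: KN; split; [exact: jac_sub|exact: ig].
move: f; apply: (jac_sub_min iK).
  by move=> g /JS; move: g; apply: (span_min iK).
move=> u w; apply: (bracket_gen_min iK JS KS).
have iirr := irr_ideal k 3.
have D2 z g : ideal_pow irr 2 g -> ideal_pow irr 1 (dd z g) by apply: (@dd_pow _ _ irr z 1 g iirr).
have D3 z g : ideal_pow irr 3 g -> ideal_pow irr 2 (dd z g) by apply: (@dd_pow _ _ irr z 2 g iirr).
have B g h : J g -> J h -> ideal_pow irr 2 g -> ideal_pow irr 3 h ->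
    exists u' n, N n /\ bracket u w g h = q * u' + n.
  move=> Jg Jh ig ih; apply: KN; split; first exact: jac_bracket.
  by apply: (idealB P3); apply: (@powD_mem _ irr 1 2); [exact: D2|exact: D3|exact: D2|exact: D3].
move=> g h [->|[Jg ig]] [->|[Jh ih]].
- by rewrite bracketff; exact: (ideal0 iK).
- exact: B.
- by rewrite bracketC; apply: (idealN iK); exact: B.
- by apply: B => //; exact: (pow_anti (leqnSn 2) iirr ig).
Qed.

(** Powers of I = (q) + N are q I^t + N^(t+1), and q lies in J. The part in
    N^(t+1) is in [J] again and has order 3 (t + 1), so its cofactors on the
    conic and on the cubics have orders 3 t + 1 and 3 t: [gp_pow] and
    [gp_cubics] apply. *)
Lemma general_position_VV : VV_torsion_free J I.
Proof.
have [a [b [c U]]] := labels2 (isT : (ord0 : 'I_5) != ord_max).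
move: ord_max U => e; move: ord0 => d; move=> U.
have iI := jac_ideal J; have iJ := vanish_ideal vs; have iN := gpN_ideal.
set q := conic d a b c e; have Jq : J q := conic_J U.
have pow_mem t f : ideal_pow I t.+1 f ->
    exists u n, [/\ ideal_pow I t u, ideal_pow N t.+1 n & f = q * u + n].
  have NI s n : ideal_pow N s n -> ideal_pow I s n by apply: pow_sub => h [].
  elim: t f => [|t IH] f.
    move=> /(pow1_min iI) /(gp_jac_mem U) [u [n [Nn ->]]].
    by exists u, n; split=> //; apply: pow1_mem.
  have P1 := pow_ideal I t.+1; have P2 := pow_ideal N t.+2.
  move: f; apply: mul_min.
    split=> [|_ _ [u [n [Hu Hn ->]]] [u' [n' [Hu' Hn' ->]]]|r _ [u [n [Hu Hn ->]]]].
    - by exists 0, 0; split; [exact: (ideal0 P1)|exact: (ideal0 P2)|ring].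
    - by exists (u + u'), (n + n'); split; [exact: (idealD P1)|exact: (idealD P2)|ring].
    - by exists (r * u), (r * n); split; [exact: (idealMl _ P1)|exact: (idealMl _ P2)|ring].
  move=> g h Ig /IH [u [n [Hu Hn ->]]].
  have [u' [n' [Nn' Eg]]] := gp_jac_mem U Ig.
  exists (g * u + u' * n), (n' * n); split.
  - apply: (idealD P1); first exact: powS_mem.
    by apply: (idealMl _ P1); exact: NI.
  - exact: powS_mem.
  - by rewrite mulrDr {2}Eg -/q; ring.
apply: VV_intro => //; first exact: jac_sub.
case=> [//|[//|t]] f _ Jf If; rewrite [_.-1]/=.
set T := ideal_mul J (ideal_pow I t.+1); have iT : is_ideal T by exact: mul_ideal.
have [u [n [Hu Hn Ef]]] := pow_mem _ _ If.
have Jn : J n.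
  have -> : n = f - q * u by rewrite Ef; ring.
  by apply: (idealB iJ); [exact: Jf|exact: (idealMr _ iJ Jq)].
have in3 : ideal_pow irr (3 + 3 * t.+1) n.
  rewrite -mulnS; elim: (t.+2) n Hn {Ef Jn} => [//|s IH] n; rewrite mulnS.
  apply: mul_min; first exact: pow_ideal.
  by move=> g h [_ ig] /IH ih; exact: powD_mem.
rewrite Ef; apply: (idealD iT); first exact: mul_mem.
apply: (gp_graded_min U iT) Jn in3 => [h ih|h w ih Jw iw].
  by rewrite mulrC; apply: mul_mem; [exact: Jq|exact: gp_pow].
exact: gp_cubics.
Qed.

End GeneralPosition.

(** * From configurations of points to normal forms *)

Lemma VV_ext (A : comNzRingType) (J J' I I' : A -> Prop) :
  (forall f, J f <-> J' f) -> (forall f, I f <-> I' f) ->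
  VV_torsion_free J I -> VV_torsion_free J' I'.
Proof.
move=> EJ EI H t t2 f.
have powE s g : ideal_pow I s g <-> ideal_pow I' s g.
  by split; apply: pow_sub => h /EI.
rewrite -EJ -powE (H t t2); split; apply: mul_sub => h; by [move=> /EJ|move=> /powE].
Qed.

Section Normalisation.
Variable k : fieldType.
Local Notation R := {mpoly k[3]}.
Implicit Types (a b c u w : 'rV[k]_3).

Lemma jac_ext (J J' : R -> Prop) : (forall f, J f <-> J' f) -> forall f, jac J f <-> jac J' f.
Proof.
by move=> E f; split; apply: jac_sub_min; try exact: jac_ideal;
  [move=> g /E; exact: jac_sub|move=> u w g h /E ? /E ?; exact: jac_bracket|
   move=> g /E; exact: jac_sub|move=> u w g h /E ? /E ?; exact: jac_bracket].
Qed.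

Lemma vanish_scale (vs vs' : seq 'rV[k]_3) :
  (forall u, u \in vs -> exists2 u', u' \in vs' & exists t : k, u = t *: u') ->
  (forall u, u \in vs' -> exists2 u', u' \in vs & exists t : k, u = t *: u') ->
  forall f, vanish vs f <-> vanish vs' f.
Proof.
move=> H H' f; split=> Hf u uvs.
  by have [u' /Hf f0 [c ->]] := H' u uvs; apply: ray_scale.
by have [u' /Hf f0 [c ->]] := H u uvs; apply: ray_scale.
Qed.

Lemma VV_scale (vs vs' : seq 'rV[k]_3) :
  (forall u, u \in vs -> exists2 u', u' \in vs' & exists t : k, u = t *: u') ->
  (forall u, u \in vs' -> exists2 u', u' \in vs & exists t : k, u = t *: u') ->
  VV_torsion_free (vanish vs) (jac (vanish vs)) ->
  VV_torsion_free (vanish vs') (jac (vanish vs')).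
Proof. by move=> H H'; apply: VV_ext; [|apply: jac_ext]; apply: vanish_scale. Qed.

Lemma cramer_vec a b c u :
  det3 a b c *: u = det3 b c u *: a + det3 c a u *: b + det3 a b u *: c.
Proof. by apply/rowP; apply: ord3P; rewrite !mxE /det3; ring. Qed.

Lemma det3_neq0_ex a b : a != 0 -> (forall t : k, b != t *: a) -> exists u, det3 a b u != 0.
Proof.
move=> a0 ab; pose t i := det3 a b (delta_mx 0 i).
have tE : [/\ t i0 = a 0 i1 * b 0 i2 - a 0 i2 * b 0 i1,
    t i1 = a 0 i2 * b 0 i0 - a 0 i0 * b 0 i2 & t i2 = a 0 i0 * b 0 i1 - a 0 i1 * b 0 i0].
  by rewrite /t /det3; split; rewrite !mxE /=; ring.
have [/existsP[i ti]|] := boolP [exists i, t i != 0]; first by exists (delta_mx 0 i).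
rewrite negb_exists => /forallP t0; have {}t0 i : t i = 0 by have := t0 i; rewrite negbK => /eqP.
case: tE; rewrite !t0 => /esym/eqP; rewrite subr_eq0 => /eqP E12.
move=> /esym/eqP; rewrite subr_eq0 => /eqP E20 /esym/eqP; rewrite subr_eq0 => /eqP E01.
have prop i : a 0 i != 0 -> (forall j, a 0 i * b 0 j = a 0 j * b 0 i) -> False.
  move=> ai H; have := ab (b 0 i / a 0 i); move/eqP; apply.
  by apply/rowP => j; rewrite mxE; apply: (mulfI ai); rewrite H; field.
have {}a0 : [|| a 0 i0 != 0, a 0 i1 != 0 | a 0 i2 != 0].
  apply: contraR a0; rewrite !negb_or !negbK => /and3P[/eqP z0 /eqP z1 /eqP z2].
  by apply/eqP/rowP; apply: ord3P; rewrite mxE.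
case: (or3P a0) => /prop F; exfalso; apply: F; apply: ord3P => //.
Qed.

(** The points [p1], [p2], [p3] lie on the line Lf = 0, on which [p4], [p5] do
    not, and Mf = 0 is the line through [p4] and [p5]. *)
Section ThreeOnALine.
Hypothesis char0 : [pchar k] =i pred0.
Variable vs : seq 'rV[k]_3.
Variables p1 p2 p3 p4 p5 : 'rV[k]_3.
Hypothesis vsE : vs =i [:: p1; p2; p3; p4; p5].
Hypotheses (p12 : forall t : k, p2 != t *: p1) (p13 : forall t : k, p3 != t *: p1)
  (p23 : forall t : k, p3 != t *: p2).
Hypotheses (p4_neq0 : p4 != 0) (p45 : forall t : k, p5 != t *: p4).
Hypotheses (p123 : det3 p1 p2 p3 = 0) (p124 : det3 p1 p2 p4 != 0) (p125 : det3 p1 p2 p5 != 0).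

Let Lf u := det3 p1 p2 u.
Let Mf u := det3 p4 p5 u.
(* the intersection point o of the two lines, and a point w' of the second one
   such that w' + o and w' - o represent p4 and p5 *)
Let o := Lf p5 *: p4 - Lf p4 *: p5.
Let w' := Lf p5 *: p4 + Lf p4 *: p5.

Let natk_neq0 m : (m.+1%:R : k) != 0.
Proof. by rewrite (proj1 (pcharf0P k) char0). Qed.

Local Lemma LfZ t u : Lf (t *: u) = t * Lf u. Proof. exact: det3Z. Qed.
Local Lemma LfD u w : Lf (u + w) = Lf u + Lf w. Proof. exact: det3D. Qed.
Local Lemma MfZ t u : Mf (t *: u) = t * Mf u. Proof. exact: det3Z. Qed.
Local Lemma MfD u w : Mf (u + w) = Mf u + Mf w. Proof. exact: det3D. Qed.
Local Lemma Lo : Lf o = 0.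
Proof. by rewrite /o -scaleNr LfD !LfZ; ring. Qed.
Local Lemma Lw' : Lf w' = 2%:R * (Lf p5 * Lf p4).
Proof. by rewrite /w' LfD !LfZ; ring. Qed.
Local Lemma Mo : Mf o = 0.
Proof. by rewrite /o -scaleNr MfD !MfZ /Mf det3_aba det3_abb !mulr0 addr0. Qed.
Local Lemma Mw' : Mf w' = 0.
Proof. by rewrite /w' MfD !MfZ /Mf det3_aba det3_abb !mulr0 addr0. Qed.

Local Lemma det_w'o u : det3 w' u o = 2%:R * Lf p5 * Lf p4 * Mf u.
Proof.
have H (s t : k) : det3 (s *: p4 + t *: p5) u (s *: p4 - t *: p5) = 2%:R * s * t * det3 p4 p5 u.
  by rewrite /det3 !mxE; ring.
exact: H.
Qed.

Local Lemma on_both u w : Mf w != 0 -> Lf w = 0 -> Lf u = 0 -> Mf u = 0 ->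
  exists t : k, u = t *: o.
Proof.
move=> Mw Lw Lu Mu; have D0 : det3 w' w o != 0.
  by rewrite det_w'o !mulf_neq0.
have [a [b [c Eu]]] := coords_basis (coords_exist D0) u.
have a0 : a = 0.
  move: Lu; rewrite Eu !LfD !LfZ Lw Lo Lw' !mulr0 !addr0 => /eqP.
  by rewrite !mulf_eq0 (negbTE (natk_neq0 1)) (negbTE p124) (negbTE p125) !orbF => /eqP.
have b0 : b = 0.
  move: Mu; rewrite Eu !MfD !MfZ Mo Mw' !mulr0 addr0 add0r => /eqP.
  by rewrite mulf_eq0 (negbTE Mw) orbF => /eqP.
by exists c; rewrite Eu a0 b0 !scale0r !add0r.
Qed.

Local Lemma L1 : Lf p1 = 0. Proof. exact: det3_aba. Qed.
Local Lemma L2 : Lf p2 = 0. Proof. exact: det3_abb. Qed.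

Local Lemma p4E : w' + 1 *: o = (2%:R * Lf p5) *: p4.
Proof. by rewrite scale1r /w' /o addrACA subrr addr0 -scalerDl mulr_natl mulr2n. Qed.
Local Lemma p5E : w' + (-1) *: o = (2%:R * Lf p4) *: p5.
Proof.
by rewrite scaleN1r /w' /o opprB [X in X + _]addrC addrACA subrr addr0 -scalerDl mulr_natl mulr2n.
Qed.

Local Lemma scale_both u u' (t : k) : t != 0 -> u' = t *: u ->
  (exists s : k, u' = s *: u) /\ (exists s : k, u = s *: u').
Proof. by move=> t0 ->; split; [exists t|exists t^-1; rewrite scalerA mulVf ?scale1r]. Qed.

Local Lemma p4_scale : 2%:R * Lf p5 != 0. Proof. by rewrite mulf_neq0. Qed.
Local Lemma p5_scale : 2%:R * Lf p4 != 0. Proof. by rewrite mulf_neq0. Qed.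

(** Normalised by Mf = 1, the points p_i are w + c_i o, and taking the
    barycentre for [w] makes the sum of the c_i zero. *)
Lemma meets_outside_VV : Mf p1 != 0 -> Mf p2 != 0 -> Mf p3 != 0 ->
  VV_torsion_free (vanish vs) (jac (vanish vs)).
Proof.
move=> M1 M2 M3.
pose n u := (Mf u)^-1 *: u.
have Mn u : Mf u != 0 -> Mf (n u) = 1 by move=> Mu; rewrite MfZ mulVf.
have Ln u : Lf u = 0 -> Lf (n u) = 0 by move=> Lu; rewrite LfZ Lu mulr0.
pose w := 3%:R^-1 *: (n p1 + n p2 + n p3).
have Mw : Mf w = 1.
  have E3 : 1 + 1 + 1 = 3%:R :> k by ring.
  by rewrite MfZ !MfD !Mn // E3 mulVf // natk_neq0.
have Lw : Lf w = 0 by rewrite LfZ !LfD !Ln ?L1 ?L2 // !addr0 mulr0.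
have Mw0 : Mf w != 0 by rewrite Mw oner_eq0.
have Ho u : Lf u = 0 -> Mf u != 0 -> exists c : k, n u = w + c *: o.
  move=> Lu Mu; have [c Ec] : exists c : k, n u - w = c *: o.
    apply: (on_both Mw0 Lw); rewrite -[- w]scaleN1r.
      by rewrite LfD (Ln _ Lu) LfZ Lw mulr0 addr0.
    by rewrite MfD (Mn _ Mu) MfZ Mw mulr1 subrr.
  by exists c; rewrite -Ec addrC subrK.
have [c1 E1] := Ho p1 L1 M1; have [c2 E2] := Ho p2 L2 M2; have [c3 E3] := Ho p3 p123 M3.
have D0 : det3 w' w o != 0 by rewrite det_w'o !mulf_neq0.
have o0 : o != 0.
  apply: contraNneq D0 => ->; by rewrite /det3 !mxE !mulr0 !addr0.
have csum : c1 + c2 + c3 = 0.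
  have : (c1 + c2 + c3) *: o = 0.
    have : n p1 + n p2 + n p3 = 3%:R *: w by rewrite /w scalerA mulfV ?scale1r // natk_neq0.
    rewrite E1 E2 E3 => /eqP; rewrite -subr_eq0 => /eqP <-.
    rewrite !scalerDl; apply/rowP => i; rewrite !mxE; ring.
  by move=> /eqP; rewrite scaler_eq0 (negbTE o0) orbF => /eqP.
have inj u u' (c : k) : Mf u != 0 -> (forall t : k, u' != t *: u) -> n u = w + c *: o ->
    forall c' : k, n u' = w + c' *: o -> Mf u' != 0 -> c != c'.
  move=> Mu uu' Eu c' Eu' Mu'; apply/eqP => cc'; have := uu' (Mf u' / Mf u); move/eqP; apply.
  by rewrite -scalerA -/(n u) Eu cc' -Eu' scalerA mulfV ?scale1r.
have c_uniq : uniq [:: c1; c2; c3].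
  rewrite /= !inE negb_or !andbT (inj _ _ _ M1 p12 E1 _ E2 M2) (inj _ _ _ M1 p13 E1 _ E3 M3).
  exact: (inj _ _ _ M2 p23 E2 _ E3 M3).
pose vs' := [:: w' + 1 *: o; w' + (-1) *: o; w + c1 *: o; w + c2 *: o; w + c3 *: o].
have nE u (c : k) : Mf u != 0 -> n u = w + c *: o -> u = Mf u *: (w + c *: o).
  by move=> Mu <-; rewrite /n scalerA mulfV ?scale1r.
apply: (VV_scale (vs := vs')); last first.
- exact: (two_lines_VV char0 (coords_exist D0) c_uniq csum (fun _ => erefl)).
- move=> u; rewrite vsE !inE => /or4P[/eqP->|/eqP->|/eqP->|/orP[]/eqP->].
  + by exists (w + c1 *: o); [rewrite !inE eqxx ?orbT|exists (Mf p1); exact: nE].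
  + by exists (w + c2 *: o); [rewrite !inE eqxx ?orbT|exists (Mf p2); exact: nE].
  + by exists (w + c3 *: o); [rewrite !inE eqxx ?orbT|exists (Mf p3); exact: nE].
  + exists (w' + 1 *: o); first by rewrite !inE eqxx.
    exact: (proj2 (scale_both p4_scale p4E)).
  + exists (w' + (-1) *: o); first by rewrite !inE eqxx orbT.
    exact: (proj2 (scale_both p5_scale p5E)).
- move=> u; rewrite !inE => /or4P[/eqP->|/eqP->|/eqP->|/orP[]/eqP->].
  + by exists p4; [rewrite vsE !inE eqxx ?orbT|exists (2%:R * Lf p5); exact: p4E].
  + by exists p5; [rewrite vsE !inE eqxx ?orbT|exists (2%:R * Lf p4); exact: p5E].
  + by exists p1; [rewrite vsE !inE eqxx ?orbT|exists (Mf p1)^-1; rewrite -E1].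
  + by exists p2; [rewrite vsE !inE eqxx ?orbT|exists (Mf p2)^-1; rewrite -E2].
  + by exists p3; [rewrite vsE !inE eqxx ?orbT|exists (Mf p3)^-1; rewrite -E3].
Qed.

Local Lemma lines_distinct : Mf p1 = 0 -> Mf p2 = 0 -> False.
Proof.
move=> M1 M2; have [u /eqP[]] := det3_neq0_ex p4_neq0 p45.
rewrite -/(Mf u); apply: (mulfI p124); rewrite mulr0 -MfZ (cramer_vec p1 p2 p4 u).
by rewrite !MfD !MfZ M1 M2 [Mf p4]det3_aba !mulr0 !addr0.
Qed.

(** Here o represents [p3]; with [w] the midpoint of the normalised [p1] and
    [p2], the four other points are o + w', o - w', o + e2 and o - e2, where e2
    is a multiple of [w]. *)
Lemma meets_in_p3_VV : Mf p3 = 0 -> VV_torsion_free (vanish vs) (jac (vanish vs)).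
Proof.
move=> M3; have := cramer_vec p1 p2 p4 p3; rewrite p123 scale0r addr0.
set D := det3 p1 p2 p4; set A := det3 p2 p4 p3; set B := det3 p4 p1 p3 => E3.
have MAB : A * Mf p1 + B * Mf p2 = 0 by rewrite -!MfZ -MfD -E3 MfZ M3 mulr0.
have p3E : p3 = (D^-1 * A) *: p1 + (D^-1 * B) *: p2.
  by rewrite -!scalerA -scalerDr -E3 scalerA mulVf // scale1r.
have B0 : B != 0.
  by apply: contraNneq (p13 (D^-1 * A)) => B0; rewrite {1}p3E B0 mulr0 scale0r addr0.
have A0 : A != 0.
  by apply: contraNneq (p23 (D^-1 * B)) => A0; rewrite {1}p3E A0 mulr0 scale0r add0r.
have M1 : Mf p1 != 0.
  apply/eqP => M1; apply: (lines_distinct M1); apply: (mulfI B0).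
  by rewrite mulr0 -[RHS]MAB M1 mulr0 add0r.
have M2 : Mf p2 != 0.
  apply/eqP => M2; apply: (fun H => lines_distinct H M2); apply: (mulfI A0).
  by rewrite mulr0 -[RHS]MAB M2 mulr0 addr0.
pose n u := (Mf u)^-1 *: u.
have Mn u : Mf u != 0 -> Mf (n u) = 1 by move=> Mu; rewrite MfZ mulVf.
have Ln u : Lf u = 0 -> Lf (n u) = 0 by move=> Lu; rewrite LfZ Lu mulr0.
have n2 : (2%:R : k) != 0 by exact: natk_neq0.
pose w := 2%:R^-1 *: (n p1 + n p2).
have Mw : Mf w = 1.
  have E2 : 1 + 1 = 2%:R :> k by ring.
  by rewrite MfZ !MfD !Mn // E2 mulVf.
have Lw : Lf w = 0 by rewrite LfZ !LfD !Ln ?L1 ?L2 // !addr0 mulr0.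
have Mw0 : Mf w != 0 by rewrite Mw oner_eq0.
have [t Et] : exists t : k, n p1 - w = t *: o.
  apply: (on_both Mw0 Lw); rewrite -[- w]scaleN1r.
    by rewrite LfD (Ln _ L1) LfZ Lw mulr0 addr0.
  by rewrite MfD (Mn _ M1) MfZ Mw mulr1 subrr.
have Esum : n p1 + n p2 = w + w.
  by rewrite -mulr2n -scaler_nat /w scalerA mulfV // scale1r.
have Et' : n p2 - w = - (t *: o).
  by rewrite -Et opprB; apply/eqP; rewrite subr_eq addrAC eq_sym subr_eq -Esum addrC.
have t0 : t != 0.
  apply/eqP => t0; move: Et Et'; rewrite t0 scale0r oppr0.
  move=> /eqP; rewrite subr_eq0 => /eqP E1 /eqP; rewrite subr_eq0 => /eqP E2.
  have := p12 (Mf p2 / Mf p1); move/eqP; apply.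
  by rewrite -scalerA -/(n p1) E1 -E2 scalerA mulfV ?scale1r.
pose e2 := t^-1 *: w.
have D0 : det3 w' e2 o != 0.
  by rewrite det_w'o /e2 MfZ Mw mulr1 !mulf_neq0 // invr_neq0.
have [c Ec] := on_both Mw0 Lw p123 M3.
have c0 : c != 0.
  by apply: contraNneq (p13 0) => c0; rewrite Ec c0 !scale0r.
have q1 : o + 1 *: e2 = (t^-1 * (Mf p1)^-1) *: p1.
  rewrite -scalerA -/(n p1) scale1r /e2 -{1}[o]scale1r -(mulVf t0) -scalerA -Et.
  by rewrite -scalerDr subrK.
have q2 : o + (-1) *: e2 = (- t^-1 * (Mf p2)^-1) *: p2.
  rewrite -scalerA -/(n p2) scaleN1r /e2 -{1}[o]scale1r -(mulVf t0) -scalerA.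
  by rewrite -[t *: o]opprK -Et' opprB -scalerBr addrAC subrr add0r scalerN scaleNr.
have q4 : o + 1 *: w' = (2%:R * Lf p5) *: p4 by rewrite -p4E !scale1r addrC.
have q5 : o + (-1) *: w' = (- (2%:R * Lf p4)) *: p5.
  by rewrite [RHS]scaleNr -p5E !scaleN1r opprB.
have s1 : t^-1 * (Mf p1)^-1 != 0 by rewrite mulf_neq0 // invr_neq0.
have s2 : - t^-1 * (Mf p2)^-1 != 0 by rewrite mulf_neq0 // ?oppr_eq0 invr_neq0.
have s5 : - (2%:R * Lf p4) != 0 by rewrite oppr_eq0; exact: p5_scale.
pose vs' := [:: o; o + 1 *: w'; o + (-1) *: w'; o + 1 *: e2; o + (-1) *: e2].
apply: (VV_scale (vs := vs')); last first.
- exact: (meeting_in_point_VV char0 (coords_exist D0) (fun _ => erefl)).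
- move=> u; rewrite vsE !inE => /or4P[/eqP->|/eqP->|/eqP->|/orP[]/eqP->].
  + exists (o + 1 *: e2); first by rewrite !inE eqxx ?orbT.
    exact: (proj2 (scale_both s1 q1)).
  + exists (o + (-1) *: e2); first by rewrite !inE eqxx ?orbT.
    exact: (proj2 (scale_both s2 q2)).
  + by exists o; [rewrite !inE eqxx|exists c].
  + exists (o + 1 *: w'); first by rewrite !inE eqxx ?orbT.
    exact: (proj2 (scale_both p4_scale q4)).
  + exists (o + (-1) *: w'); first by rewrite !inE eqxx ?orbT.
    exact: (proj2 (scale_both s5 q5)).
- move=> u; rewrite !inE => /or4P[/eqP->|/eqP->|/eqP->|/orP[]/eqP->].
  + by exists p3; [rewrite vsE !inE eqxx ?orbT|exact: (proj2 (scale_both c0 Ec))].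
  + by exists p4; [rewrite vsE !inE eqxx ?orbT|exists (2%:R * Lf p5)].
  + by exists p5; [rewrite vsE !inE eqxx ?orbT|exists (- (2%:R * Lf p4))].
  + by exists p1; [rewrite vsE !inE eqxx ?orbT|exists (t^-1 * (Mf p1)^-1)].
  + by exists p2; [rewrite vsE !inE eqxx ?orbT|exists (- t^-1 * (Mf p2)^-1)].
Qed.

End ThreeOnALine.
End Normalisation.

Section Plane.
Variable k : fieldType.
Implicit Types (a b c u : 'rV[k]_3) (L : {vspace 'rV[k]_3}).

Lemma on_line a b u : a != 0 -> (forall t : k, b != t *: a) -> det3 a b u = 0 ->
  exists s t : k, u = s *: a + t *: b.
Proof.
move=> a0 ab u0; have [e De] := det3_neq0_ex a0 ab.
have := cramer_vec a b e u; rewrite u0 scale0r addr0 => E.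
exists ((det3 a b e)^-1 * det3 b e u), ((det3 a b e)^-1 * det3 e a u).
by rewrite -!scalerA -scalerDr -E scalerA mulVf // scale1r.
Qed.

Lemma det3_comb a b s t s' t' :
  det3 a (s *: a + t *: b) (s' *: a + t' *: b) = 0.
Proof. by rewrite /det3 !mxE; ring. Qed.

(** Two lines that share two points coincide. *)
Lemma same_line a b c u : b != 0 -> (forall t : k, c != t *: b) ->
  det3 a b c = 0 -> det3 b c u = 0 -> det3 a b u = 0.
Proof.
move=> b0 bc; rewrite -det3_rot => /(on_line b0 bc)[s [t ->]] /(on_line b0 bc)[s' [t' ->]].
by rewrite det3_swap12 det3_comb oppr0.
Qed.

Lemma dim_pair a b : a != 0 -> (forall t : k, b != t *: a) -> \dim (<[a]> + <[b]>) = 2.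
Proof.
move=> a0 ab; have : free [:: b; a].
  rewrite free_cons seq1_free a0 andbT span_seq1.
  by apply/negP => /vlineP[t]; apply/eqP.
by rewrite /free span_cons span_seq1 addvC => /eqP.
Qed.

Lemma mem_line L a b u : \dim L = 2 -> a != 0 -> (forall t : k, b != t *: a) ->
  a \in L -> b \in L -> (u \in L) = (det3 a b u == 0).
Proof.
move=> L2 a0 ab aL bL; have -> : L = (<[a]> + <[b]>)%VS.
  by apply/esym/eqP; rewrite eqEdim subv_add -!memvE aL bL L2 dim_pair.
apply/memv_addP/eqP => [[_ /vlineP[s ->] [_ /vlineP[t ->] ->]]|/(on_line a0 ab)[s [t ->]]].
  by rewrite det3D !det3Z det3_aba det3_abb !mulr0 addr0.
by exists (s *: a); rewrite ?memvZ ?memv_line //; exists (t *: b); rewrite ?memvZ ?memv_line.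
Qed.

End Plane.

Section FivePoints.
Variable k : closedFieldType.
Hypothesis char0 : [pchar k] =i pred0.
Variable v : 'I_5 -> 'rV[k]_3.
Hypothesis v_neq0 : forall i, v i != 0.
Hypothesis v_indep : forall i j, i != j -> forall t : k, v j != t *: v i.
Variable vs : seq 'rV[k]_3.
Hypothesis vsE : forall u, reflect (exists i, u = v i) (u \in vs).

Local Notation VV := (VV_torsion_free (vanish vs) (jac (vanish vs))).
Let D i j l := det3 (v i) (v j) (v l).

Local Lemma vs_labels i j l a b : uniq [:: i; j; l; a; b] ->
  vs =i [:: v i; v j; v l; v a; v b].
Proof.
move=> U u; apply/vsE/idP => [[m ->]|].
  by have := map_f v (label_mem m U erefl).
by move=> H; have /mapP[m _ ->] : u \in [seq v m | m <- [:: i; j; l; a; b]] by []; exists m.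
Qed.

(** The line through the two other points either avoids the three collinear
    ones or passes through exactly one of them, which may be listed last. *)
Lemma three_collinear_VV i j l a b : uniq [:: i; j; l; a; b] ->
  D i j l = 0 -> D i j a != 0 -> D i j b != 0 -> VV.
Proof.
have in_last i' j' l' : uniq [:: i'; j'; l'; a; b] -> D i' j' l' = 0 ->
    D i' j' a != 0 -> D i' j' b != 0 -> D a b l' = 0 -> VV.
  move=> U D0 Da Db; have ab : a != b by distinct U.
  have ij' : i' != j' by distinct U.
  have il' : i' != l' by distinct U.
  have jl' : j' != l' by distinct U.
  exact: (meets_in_p3_VV char0 (vs_labels U) (v_indep ij') (v_indep il')
    (v_indep jl') (v_neq0 a) (v_indep ab)).
have off p q r m : q != r -> D p q r = 0 -> D p q m != 0 -> D q r m != 0.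
  by move=> qr D0; apply: contra_neq => E; apply: (same_line (v_neq0 q) (v_indep qr)) E.
move=> U D0 Da Db; have ab : a != b by distinct U.
have ij : i != j by distinct U.
have il : i != l by distinct U.
have jl : j != l by distinct U.
have D1 : D j l i = 0 by rewrite /D det3_rot.
have D2 : D l i j = 0 by rewrite /D det3_rot.
have [Mi|Mi] := eqVneq (D a b i) 0.
  apply: (in_last j l i) => //; [by distinct U|exact: (off _ _ _ _ jl D0 Da)|exact: (off _ _ _ _ jl D0 Db)].
have [Mj|Mj] := eqVneq (D a b j) 0.
  have li : l != i by rewrite eq_sym.
  by apply: (in_last l i j) => //; [distinct U|exact: (off _ _ _ _ li D1 (off _ _ _ _ jl D0 Da))|
     exact: (off _ _ _ _ li D1 (off _ _ _ _ jl D0 Db))].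
have [Ml|Ml] := eqVneq (D a b l) 0; first exact: (in_last i j l).
exact: (meets_outside_VV char0 (vs_labels U) (v_indep ij) (v_indep il)
  (v_indep jl)).
Qed.

(** The parameter [t] is chosen so that the basis vector [e2] of the line
    represents none of the points; this makes them of the form e1 + c e2. At
    most one of the points is off the line, and it serves as [e3]. *)
Lemma four_on_a_line_not_VV i j : i != j ->
  (4 <= #|[set l | D i j l == 0%R]|)%N -> ~ VV.
Proof.
move=> ij S4; set S := [set l | D i j l == 0] in S4.
have [e3 De3 e3P] : exists2 e3, det3 (v i) (v j) e3 != 0 & forall l, l \notin S -> v l = e3.
  have [l0 l0S|allS] := pickP [pred l | l \notin S]; last first.
    have [e3 De3] := det3_neq0_ex (v_neq0 i) (v_indep ij).
    by exists e3 => // l lS; have := allS l; rewrite /= lS.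
  exists (v l0) => [|l lS]; first by move: l0S; rewrite /= inE.
  have : (#|~: S| <= 1)%N by rewrite cardsCs setCK card_ord; lia.
  by move/card_le1_eqP/(_ l l0); rewrite !inE in lS l0S * => ->.
pose al l := (det3 (v i) (v j) e3)^-1 * det3 (v j) e3 (v l).
pose be l := (det3 (v i) (v j) e3)^-1 * det3 e3 (v i) (v l).
have vE l : l \in S -> v l = al l *: v i + be l *: v j.
  rewrite inE => /eqP D0; have := cramer_vec (v i) (v j) e3 (v l).
  rewrite -/(D i j l) D0 scale0r addr0 => E.
  by rewrite -!scalerA -scalerDr -E scalerA mulVf // scale1r.
have [t tP] : exists t, ~~ root (\prod_(l in S) ((be l)%:P - al l *: 'X)) t.
  apply/closed_nonrootP/prodf_neq0 => l lS; apply: contraNneq (v_neq0 l) => E.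
  rewrite vE //; have := congr1 (fun p : {poly k} => p`_0) E.
  have := congr1 (fun p : {poly k} => p`_1) E.
  rewrite !coefE /= mulr1 mulr0 sub0r subr0 => /eqP; rewrite oppr_eq0 => /eqP -> ->.
  by rewrite !scale0r addr0.
have ga0 l : l \in S -> be l - t * al l != 0.
  move=> lS; apply: contraNneq tP => E; rewrite rootE horner_prod (bigD1 l) //= !hornerE.
  by rewrite mulrC [al l * t]mulrC E mulr0.
pose e1 := v j; pose e2 := v i + t *: v j.
pose c l := al l / (be l - t * al l).
have veE l : l \in S -> v l = (be l - t * al l) *: (e1 + c l *: e2).
  move=> lS; rewrite {1}vE // scalerDr scalerA /c [_ * (_ / _)]mulrC divfK ?ga0 //.
  by rewrite /e1 /e2; apply/rowP => m; rewrite !mxE; ring.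
have c_inj : {in enum S &, injective c}.
  move=> l l'; rewrite !mem_enum => lS lS' E; apply/eqP; apply/negPn/negP => ll'.
  have := v_indep ll' ((be l' - t * al l') / (be l - t * al l)); move/eqP; apply.
  by rewrite {1}(veE _ lS) (veE _ lS') scalerA divfK ?ga0 // E.
have D0 : det3 e1 e2 e3 != 0.
  have -> : det3 e1 e2 e3 = - det3 (v i) (v j) e3.
    by rewrite /e1 /e2 /det3 !mxE; ring.
  by rewrite oppr_eq0.
pose vs' := [seq e1 + x *: e2 | x <- [seq c l | l <- enum S]] ++ [seq v l | l <- enum (~: S)].
move=> H; have : VV_torsion_free (vanish vs') (jac (vanish vs')).
  apply: VV_scale H => u; last first.
    rewrite mem_cat => /orP[/mapP[x /mapP[l lS ->] ->]|/mapP[l _ ->]].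
      rewrite mem_enum in lS; exists (v l); first by apply/vsE; exists l.
      by exists (be l - t * al l)^-1; rewrite (veE _ lS) scalerA mulVf ?ga0 // scale1r.
    by exists (v l); [apply/vsE; exists l|exists 1; rewrite scale1r].
  move/vsE => [l ->]; have [lS|lS] := boolP (l \in S).
    exists (e1 + c l *: e2); last by exists (be l - t * al l); exact: veE.
    by rewrite mem_cat (map_f (fun x => e1 + x *: e2)) // map_f // mem_enum.
  exists (v l); last by exists 1; rewrite scale1r.
  by rewrite mem_cat (map_f v) ?orbT // mem_enum inE.
apply: (four_collinear_not_VV char0 (coords_exist D0) (cs := [seq c l | l <- enum S])).
- by rewrite map_inj_in_uniq ?enum_uniq.
- by rewrite size_map -cardE.
- by move=> x xS; rewrite mem_cat (map_f (fun x => e1 + x *: e2)).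
- move=> u; rewrite mem_cat => /orP[/mapP[x xS ->]|/mapP[l]]; first by left; exists x.
  by rewrite mem_enum inE => lS ->; right; exact: e3P.
Qed.

End FivePoints.

(** * Configurations of five points *)

Lemma card_ge3 (T : finType) (A : {set T}) i j l :
  uniq [:: i; j; l] -> i \in A -> j \in A -> l \in A -> (3 <= #|A|)%N.
Proof.
move=> /card_uniqP /= <- iA jA lA; apply/subset_leq_card/subsetP => m.
by rewrite !inE => /or3P[]/eqP->.
Qed.

Lemma enum3 (A : {set 'I_5}) : (3 <= #|A|)%N ->
  exists i j l, uniq [:: i; j; l] /\ {subset [:: i; j; l] <= A}.
Proof.
have sub l : l \in enum A -> l \in A by rewrite mem_enum.
have := enum_uniq (mem A); rewrite cardE.
case: (enum _) sub => [|i [|j [|l s]]] // sub U _.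
have E : [:: i, j, l & s] = [:: i; j; l] ++ s by [].
exists i, j, l; split; first by move: U; rewrite E cat_uniq => /andP[].
by move=> m mS; apply: sub; rewrite E mem_cat mS.
Qed.

Lemma enum32 (A : {set 'I_5}) : #|A| = 3%N -> exists i j l a b,
  [/\ uniq [:: i; j; l; a; b], {subset [:: i; j; l] <= A}, a \notin A & b \notin A].
Proof.
move=> A3; have : #|~: A| = 2%N by rewrite cardsCs setCK card_ord A3.
have [|i [j [l [U sub]]]] := @enum3 A; first by rewrite A3.
have subC a : a \in enum (~: A) -> a \notin A by rewrite mem_enum inE.
have := enum_uniq (mem (~: A)); rewrite cardE.
case: (enum _) subC => [|a [|b [|//]]] // subC Uab _.
have Aa : a \notin A by apply: subC; exact: mem_head.
have Ab : b \notin A by apply: subC; rewrite !inE eqxx orbT.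
exists i, j, l, a, b; split=> //.
have E : [:: i; j; l; a; b] = [:: i; j; l] ++ [:: a; b] by [].
rewrite E cat_uniq U Uab andbT /= orbF negb_or.
by rewrite !(contra (fun H => sub _ H)).
Qed.

Section Configuration.
Variable k : closedFieldType.
Hypothesis char0 : [pchar k] =i pred0.
Variable X : {fset P2 k}.
Hypothesis cardX : #|` X| = 5%N.
Variable pt : 'I_5 -> P2 k.
Hypothesis pt_inj : injective pt.
Hypothesis ptX : forall P, P \in X <-> exists i, P = pt i.

Local Notation v i := (vpick (val (pt i))).
Local Notation vs := [seq vpick (val P) | P <- X].
Let D i j l := det3 (v i) (v j) (v l).
Let on (L : line k) := [set i | v i \in val L].

Local Lemma pt_neq0 i : v i != 0. Proof. exact: P2_vpick_neq0. Qed.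

Local Lemma pt_indep i j : i != j -> forall t : k, v j != t *: v i.
Proof.
move=> ij t; apply: contra_neq ij => E; apply: pt_inj.
have t0 : t != 0 by apply: contraNneq (pt_neq0 j) => t0; rewrite E t0 scale0r.
apply/esym/val_inj/eqP; rewrite eqEdim !P2_dim leqnn andbT P2_vline E.
by rewrite -memvE memvZ // memv_pick.
Qed.

Local Lemma ptE u : reflect (exists i, u = v i) (u \in vs).
Proof.
apply: (iffP mapP) => [[P /ptX[i ->] ->]|[i ->]]; first by exists i.
by exists (pt i) => //; apply/ptX; exists i.
Qed.

Local Lemma card_points_on L : #|` points_on X L| = #|on L|.
Proof.
rewrite cardE -(size_map pt); apply/perm_size/uniq_perm; first exact: fset_uniq.
  by rewrite map_inj_uniq ?enum_uniq.
move=> P; rewrite !inE; apply/andP/mapP => [[/ptX[i ->] iL]|[i + ->]].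
  by exists i; rewrite ?mem_enum ?inE // memvE -P2_vline.
by rewrite mem_enum inE memvE -P2_vline => iL; split=> //; apply/ptX; exists i.
Qed.

Local Lemma on_det L i j l : i != j -> i \in on L -> j \in on L ->
  (l \in on L) = (D i j l == 0).
Proof.
rewrite !inE => ij iL jL.
by rewrite (mem_line _ (eqP (valP L)) (pt_neq0 i) (pt_indep ij)).
Qed.

Local Lemma line_through i j : i != j -> exists L, (i \in on L) && (j \in on L).
Proof.
move=> ij; have L2 : \dim (<[v i]> + <[v j]>) == 2%N.
  by rewrite (dim_pair (pt_neq0 i) (pt_indep ij)).
by exists (exist (fun V => \dim V == 2%N) _ L2); rewrite !inE /= !memvE addvSl addvSr.
Qed.

(** Three collinear points among the five span a line, which contains exactly
    three of them unless four are collinear. *)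
Lemma VV_configuration :
  VV_torsion_free (vanish vs) (jac (vanish vs)) <->
  general_linear_position X \/ collinear_configuration 5 2 X.
Proof.
split=> [VV|].
  have [/existsP[i /existsP[j /existsP[l /andP[U D0]]]]|noL] :=
      boolP [exists i, exists j, exists l, uniq [:: i; j; l] && (D i j l == 0)].
    have ij : i != j by distinct U.
    have [L /andP[iL jL]] := line_through ij.
    right; split=> //; exists L; rewrite card_points_on.
    have onE : on L = [set m | D i j m == 0].
      by apply/setP => m; rewrite (on_det _ ij iL jL) inE.
    apply/eqP; rewrite eqn_leq; apply/andP; split.
      rewrite leqNgt; apply/negP; rewrite onE => H.
      exact: (four_on_a_line_not_VV char0 pt_neq0 pt_indep ptE ij H).
    have lL : l \in on L by rewrite (on_det _ ij iL jL).
    exact: (card_ge3 U).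
  left; split=> [|L]; first by rewrite cardX.
  rewrite card_points_on => /enum3[i [j [l [U sub]]]]; case/negP: noL.
  apply/existsP; exists i; apply/existsP; exists j; apply/existsP; exists l.
  have ij : i != j by distinct U.
  by rewrite U /= -(@on_det L) // sub // !inE eqxx ?orbT.
case=> [[_ GLP]|[_ _ _ [L]]].
  apply: (general_position_VV (v := fun i => v i)) => [i j l U|]; last exact: ptE.
  apply/eqP => D0; have ij : i != j by distinct U.
  have [L /andP[iL jL]] := line_through ij; apply: (GLP L); rewrite card_points_on.
  have lL : l \in on L by rewrite (on_det _ ij iL jL); apply/eqP.
  exact: (card_ge3 U).
rewrite card_points_on => /enum32[i [j [l [a [b [U sub aL bL]]]]]].
have ij : i != j by distinct U.
have [iL [jL lL]] : i \in on L /\ j \in on L /\ l \in on L.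
  by rewrite !sub // !inE eqxx ?orbT.
apply: (three_collinear_VV char0 pt_neq0 pt_indep ptE U).
- by apply/eqP; rewrite -[_ == _](on_det _ ij iL jL).
- by rewrite -[_ == _](on_det _ ij iL jL).
- by rewrite -[_ == _](on_det _ ij iL jL).
Qed.

End Configuration.

Lemma label_points (k : fieldType) (X : {fset P2 k}) : #|` X| = 5%N ->
  exists2 pt : 'I_5 -> P2 k, injective pt & forall P, P \in X <-> exists i, P = pt i.
Proof.
move=> cardX; have [P0 _] : exists P, P \in X by apply/fset0Pn; rewrite -cardfs_gt0 cardX.
exists (fun i => nth P0 X i) => [i j /eqP|P].
  by rewrite nth_uniq ?cardX ?fset_uniq // => /eqP/val_inj.
split=> [PX|[i ->]]; last by rewrite mem_nth ?cardX.
have lt_i : (index P X < 5)%N by rewrite -[X in (_ < X)%N]cardX index_mem.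
by exists (Ordinal lt_i); rewrite nth_index.
Qed.

Theorem proposition3p1 (k : closedFieldType) (char0 : [pchar k] =i pred0)
    (X : {fset P2 k}) (cardX : #|` X| = 5%N)
    (m : nat) (g : 'I_m -> {mpoly k[3]})
    (gens : homogeneous_generators (vanishing_ideal X) g) :
  VV_torsion_free (vanishing_ideal X) (jacobian_ideal (vanishing_ideal X) g)
  <->
  [\/ general_linear_position X,
      collinear_configuration 5 2 X
    | three_fold_meeting_in_point X].
Proof.
have [pt pt_inj ptX] := label_points cardX.
have jacE f : jacobian_ideal (vanishing_ideal X) g f <->
    jac (vanish [seq vpick (val P) | P <- X]) f.
  rewrite (jacobian_idealP gens); apply: jac_ext; exact: vanishing_idealP.
have VVE : VV_torsion_free (vanishing_ideal X) (jacobian_ideal (vanishing_ideal X) g) <->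
    VV_torsion_free (vanish [seq vpick (val P) | P <- X])
      (jac (vanish [seq vpick (val P) | P <- X])).
  split; apply: VV_ext => f; [exact: vanishing_idealP|exact: jacE|
    exact: iff_sym (vanishing_idealP X f)|exact: iff_sym (jacE f)].
rewrite VVE (VV_configuration char0 cardX pt_inj ptX).
split=> [[]|[||[]]]; by [constructor 1|constructor 2|left|right].
Qed.
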